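(* Let $\lambda>0$, $\Gamma>0$, $a>0$ be real numbers with $\lambda>6\max\{\Gamma,1/a\}$, and let $p\in L^1(\mathbb{R})\cap C(\mathbb{R})$ satisfy $|\widehat p(\xi)|\le\Gamma e^{-a|\xi|}$ for all $\xi\in\mathbb{R}$. Then there exists a solution $\sigma\in L^2(\mathbb{R})\cap C^\infty(\mathbb{R})$, with $\widehat\sigma\in L^1(\mathbb{R})$, of the band-limited integral equation $$\sigma(x)=S[T_b\sigma](x)+p(x)\quad\text{for all }x\in\mathbb{R},$$ such that $$|\widehat\sigma(\xi)|\le2\Gamma\exp\!\left(-\left(a-\frac1\lambda\right)|\xi|\right)\quad\text{for all }\xi\in\mathbb{R}.$$
   Context: Fourier transform convention: $\widehat f(\xi)=\int f(x)e^{-ix\xi}dx$, inverse $\frac1{2\pi}\int\widehat f(\xi)e^{ix\xi}d\xi$. Fix an infinitely differentiable $b:\mathbb{R}\to[0,1]$ with $b(\xi)=1$ for $|\xi|\le\lambda$ and $b(\xi)=0$ for $|\xi|\ge\sqrt2\lambda$. For $f$ with integrable Fourier transform, $T_bf(x)=\frac1{2\pi}\int_{\mathbb{R}}e^{ix\xi}\widehat f(\xi)\frac{b(\xi)}{4\lambda^2-\xi^2}d\xi$. For $f\in C^1(\mathbb{R})$, $S[f](x)=\frac14(f'(x))^2-4\lambda^2\left(e^{f(x)}-1-f(x)\right)$. *)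

(* Defs.v *)
From Stdlib Require Import Reals Lra.
Open Scope R_scope.

Definition Cpx := (R * R)%type.
Definition Cadd (z w : Cpx) : Cpx := (fst z + fst w, snd z + snd w).
Definition Csub (z w : Cpx) : Cpx := (fst z - fst w, snd z - snd w).
Definition Cmult (z w : Cpx) : Cpx :=
  (fst z * fst w - snd z * snd w, fst z * snd w + snd z * fst w).
Definition Cscale (r : R) (z : Cpx) : Cpx := (r * fst z, r * snd z).
Definition Cnorm (z : Cpx) : R := sqrt (fst z ^ 2 + snd z ^ 2).
Definition Cexpi (t : R) : Cpx := (cos t, sin t).
Definition Cexp (z : Cpx) : Cpx := (exp (fst z) * cos (snd z), exp (fst z) * sin (snd z)).
Definition C1 : Cpx := (1, 0).

Definition improper_integral (f : R -> R) (l : R) : Prop :=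
  (forall u v : R, inhabited (Riemann_integrable f u v)) /\
  forall eps : R, 0 < eps -> exists M : R, forall u v : R,
      u <= - M -> M <= v ->
      forall pr : Riemann_integrable f u v, Rabs (RiemannInt pr - l) < eps.

Definition Cintegral (f : R -> Cpx) (z : Cpx) : Prop :=
  improper_integral (fun x => fst (f x)) (fst z) /\
  improper_integral (fun x => snd (f x)) (snd z).

Definition Ccontinuous (f : R -> Cpx) : Prop :=
  continuity (fun x => fst (f x)) /\ continuity (fun x => snd (f x)).

Definition L1 (f : R -> Cpx) : Prop :=
  (forall u v : R, inhabited (Riemann_integrable (fun x => fst (f x)) u v)) /\
  (forall u v : R, inhabited (Riemann_integrable (fun x => snd (f x)) u v)) /\
  exists l : R, improper_integral (fun x => Cnorm (f x)) l.

Definition L2 (f : R -> Cpx) : Prop :=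
  (forall u v : R, inhabited (Riemann_integrable (fun x => fst (f x)) u v)) /\
  (forall u v : R, inhabited (Riemann_integrable (fun x => snd (f x)) u v)) /\
  exists l : R, improper_integral (fun x => Cnorm (f x) ^ 2) l.

Definition smooth (f : R -> R) : Prop :=
  exists d : nat -> R -> R, d O = f /\
    forall (n : nat) (x : R), derivable_pt_lim (d n) x (d (S n) x).

Definition Csmooth (f : R -> Cpx) : Prop :=
  smooth (fun x => fst (f x)) /\ smooth (fun x => snd (f x)).

Definition Cderiv (f : R -> Cpx) (x : R) (l : Cpx) : Prop :=
  derivable_pt_lim (fun t => fst (f t)) x (fst l) /\
  derivable_pt_lim (fun t => snd (f t)) x (snd l).

Definition is_FT (f F : R -> Cpx) : Prop :=
  forall xi : R, Cintegral (fun x => Cmult (f x) (Cexpi (- (x * xi)))) (F xi).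

Definition is_invFT (F f : R -> Cpx) : Prop :=
  forall x : R,
    Cintegral (fun xi => Cscale (/ (2 * PI)) (Cmult (F xi) (Cexpi (x * xi)))) (f x).

(* T_b f = g, where fh = \hat f:
   g(x) = 1/(2pi) int e^{i x xi} fh(xi) b(xi)/(4 lam^2 - xi^2) dxi *)
Definition Tb (b : R -> R) (lam : R) (fh : R -> Cpx) (g : R -> Cpx) : Prop :=
  is_invFT (fun xi => Cscale (b xi / (4 * lam ^ 2 - xi ^ 2)) (fh xi)) g.

(* S[f](x) = 1/4 f'(x)^2 - 4 lam^2 (e^{f(x)} - 1 - f(x)), given f(x) = fx, f'(x) = dfx *)
Definition S_op (lam : R) (fx dfx : Cpx) : Cpx :=
  Csub (Cscale (/ 4) (Cmult dfx dfx))
       (Cscale (4 * lam ^ 2) (Csub (Csub (Cexp fx) C1) fx)).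

(* Main.v *)
(** The equation is solved on the Fourier side. If [F] is the transform of [sigma] and
    [k = F * b / (4 lam^2 - xi^2)] that of [g = T_b sigma], then [S[g] + p] has transform

      Phi F = ph + 1/4 (i xi k) ** (i xi k) - 4 lam^2 (k^{**2}/2! + k^{**3}/3! + ...),

    where [**] is convolution divided by [2 pi]. Since [k] is supported in [[-L, L]] with
    [L = 3/2 lam >= sqrt 2 lam], and [exp (-a|eta|) exp (-a|xi - eta|) <= exp (-a|xi|)],
    convolution with [k] multiplies bounds of the form [C exp (-a|xi|)] by at most
    [sup (|k| exp (a|.|)) * L / pi]. When [lam > 6 Gam] this makes [Phi] a contraction with
    factor 1/2 on the ball [|F| <= 2 Gam exp (-a|xi|)], whose fixed point even satisfies a bound
    with rate [a] rather than [a - 1/lam].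

    Going back to [sigma] uses Fourier inversion for [p] (by Abel summation, that is, the
    Poisson kernel), and the square integrability of [sigma] comes from the same kernel. *)
From Stdlib Require Import Reals Factorial Lra Lia ClassicalEpsilon FunctionalExtensionality.
From Coquelicot Require Import Coquelicot.
Require Import Defs.
Open Scope R_scope.


(* [Cexp] has values in [Cpx], a synonym of [C] over which [ring] is not declared. *)
Ltac cring :=
  repeat match goal with
  | |- context [Cexp ?z] => let w := fresh in pose (w := Cexp z : C); change (Cexp z) with w; clearbody w
  end; lazymatch goal with |- ?a = ?b => change (@eq C a b) end; ring.

(** Integrals are taken of continuous functions over segments, with improper limits afterwards, and
    Fubini is proved on rectangles only; this shapes the whole proof. Convolutions run over [-L, L],
    the transform of [p] is truncated to [-A, A], inverse transforms to [-r, r], and integrals are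
    exchanged before any limit, with an explicit tail estimate. No function space is built: the
    weighted sup norm appears as the predicate [decay], and completeness as pointwise limits of
    sequences with increments at most c / 2^n. The constants: where b is nonzero the denominator is
    at least 2 lam^2, so the symbol is at most 1 / (2 lam^2), and at most 3 / (4 lam) after
    multiplication by |xi|. With pi > 3 the factor L / pi is at most lam / 2, and with Gam / lam <
    1/6 a difference delta becomes at most delta / 20 through the square and delta / 3 through the
    exponential. Decay is known for [ph] only; [p] is merely continuous and integrable, so inversion
    is proved at each point from the continuity of [p] there. *)

Lemma C_eq (z w : C) : fst z = fst w -> snd z = snd w -> z = w.
Proof. destruct z, w; simpl; intros -> ->; reflexivity. Qed.

Lemma Cexpi_plus (s t : R) : Cexpi (s + t) = (Cexpi s * Cexpi t)%C.
Proof.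
  apply C_eq; simpl; [rewrite cos_plus | rewrite sin_plus]; ring.
Qed.

Lemma Cmod_Cexpi (t : R) : Cmod (Cexpi t) = 1.
Proof.
  unfold Cmod, Cexpi; simpl. rewrite !Rmult_1_r.
  generalize (sin2_cos2 t); unfold Rsqr; intros H.
  replace (_ + _) with 1 by lra. apply sqrt_1.
Qed.

Lemma Cconj_Cexpi (t : R) : Cconj (Cexpi t) = Cexpi (- t).
Proof. unfold Cexpi, Cconj; simpl. rewrite cos_neg, sin_neg; reflexivity. Qed.

Lemma Cscale_RtoC (r : R) (z : C) : Cscale r z = (RtoC r * z)%C.
Proof. apply C_eq; simpl; ring. Qed.

Lemma Cmod_scal (r : R) (z : C) : 0 <= r -> Cmod (RtoC r * z) = r * Cmod z.
Proof. intros Hr; rewrite Cmod_mult, Cmod_R, Rabs_pos_eq; trivial. Qed.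

Lemma Cmod_fst (z : C) : Rabs (fst z) <= Cmod z.
Proof. eapply Rle_trans; [|apply Rmax_Cmod]; apply Rmax_l. Qed.

Lemma Cmod_snd (z : C) : Rabs (snd z) <= Cmod z.
Proof. eapply Rle_trans; [|apply Rmax_Cmod]; apply Rmax_r. Qed.

Lemma Cmod_le_sum (z : C) : Cmod z <= Rabs (fst z) + Rabs (snd z).
Proof.
  replace z with (RtoC (fst z) + Ci * RtoC (snd z))%C at 1 by (apply C_eq; simpl; ring).
  eapply Rle_trans; [apply Cmod_triangle|].
  rewrite Cmod_mult, Cmod_Ci, !Cmod_R; lra.
Qed.

Lemma Cmod_minus_triangle (x y z : C) : Cmod (x - z) <= Cmod (x - y) + Cmod (y - z).
Proof.
  replace (x - z)%C with ((x - y) + (y - z))%C by ring. apply Cmod_triangle.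
Qed.

Lemma Cmod_minus_sym (x y : C) : Cmod (x - y) = Cmod (y - x).
Proof. replace (x - y)%C with (- (y - x))%C by ring. apply Cmod_opp. Qed.

Lemma Cmod_minus_le (x y : C) : Cmod (x - y) <= Cmod x + Cmod y.
Proof. unfold Cminus. eapply Rle_trans; [apply Cmod_triangle|]. rewrite Cmod_opp; lra. Qed.

Lemma Cmod_le_minus (x y : C) : Cmod x <= Cmod y + Cmod (x - y).
Proof. replace x with (y + (x - y))%C at 1 by ring. apply Cmod_triangle. Qed.

Lemma Ceq_of_arbitrarily_close (x y : C) :
  (forall eps, 0 < eps -> Cmod (x - y) <= eps) -> x = y.
Proof.
  intros H.
  assert (E : Cmod (x - y) = 0).
  { apply Rle_antisym; [|apply Cmod_ge_0].
    apply le_epsilon; intros eps He; rewrite Rplus_0_l; auto. }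
  apply Cmod_eq_0 in E. replace x with (x - y + y)%C by ring. rewrite E; ring.
Qed.

(** * Continuity of complex-valued functions *)

Lemma Ccontinuous_const (c : C) : Ccontinuous (fun _ => c).
Proof. split; intros x; apply continuity_pt_const; intros ? ?; reflexivity. Qed.

Lemma Ccontinuous_RtoC (h : R -> R) : continuity h -> Ccontinuous (fun x => RtoC (h x)).
Proof.
  intros H; split; [exact H|]. intros x; apply continuity_pt_const; intros ? ?; reflexivity.
Qed.

Lemma Ccontinuous_plus (f g : R -> C) :
  Ccontinuous f -> Ccontinuous g -> Ccontinuous (fun x => (f x + g x)%C).
Proof.
  intros [F1 F2] [G1 G2]; split; [exact (continuity_plus _ _ F1 G1)|exact (continuity_plus _ _ F2 G2)].
Qed.

Lemma Ccontinuous_opp (f : R -> C) : Ccontinuous f -> Ccontinuous (fun x => (- f x)%C).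
Proof. intros [F1 F2]; split; [exact (continuity_opp _ F1)|exact (continuity_opp _ F2)]. Qed.

Lemma Ccontinuous_minus (f g : R -> C) :
  Ccontinuous f -> Ccontinuous g -> Ccontinuous (fun x => (f x - g x)%C).
Proof. intros F G; apply Ccontinuous_plus; [|apply Ccontinuous_opp]; trivial. Qed.

Lemma Ccontinuous_mult (f g : R -> C) :
  Ccontinuous f -> Ccontinuous g -> Ccontinuous (fun x => (f x * g x)%C).
Proof.
  intros [F1 F2] [G1 G2]; split.
  - exact (continuity_minus _ _ (continuity_mult _ _ F1 G1) (continuity_mult _ _ F2 G2)).
  - exact (continuity_plus _ _ (continuity_mult _ _ F1 G2) (continuity_mult _ _ F2 G1)).
Qed.

Lemma Ccontinuous_conj (f : R -> C) : Ccontinuous f -> Ccontinuous (fun x => Cconj (f x)).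
Proof. intros [F1 F2]; split; [exact F1|exact (continuity_opp _ F2)]. Qed.

Lemma Ccontinuous_comp (f : R -> C) (h : R -> R) :
  continuity h -> Ccontinuous f -> Ccontinuous (fun x => f (h x)).
Proof.
  intros H [F1 F2]; split; [exact (continuity_comp _ _ H F1)|exact (continuity_comp _ _ H F2)].
Qed.

Lemma Ccontinuous_expi : Ccontinuous Cexpi.
Proof. split; [exact continuity_cos|exact continuity_sin]. Qed.

Lemma Ccontinuous_Cexpi (h : R -> R) : continuity h -> Ccontinuous (fun x => Cexpi (h x)).
Proof. intros H; apply Ccontinuous_comp; [exact H|apply Ccontinuous_expi]. Qed.

Lemma continuity_id : continuity (fun x => x).
Proof. intros x; apply continuity_pt_id. Qed.

Lemma continuity_cst (c : R) : continuity (fun _ => c).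
Proof. apply continuity_const; intros ? ?; reflexivity. Qed.

Lemma continuity_Rplus (f g : R -> R) :
  continuity f -> continuity g -> continuity (fun x => f x + g x).
Proof. exact (continuity_plus f g). Qed.

Lemma continuity_Rminus (f g : R -> R) :
  continuity f -> continuity g -> continuity (fun x => f x - g x).
Proof. exact (continuity_minus f g). Qed.

Lemma continuity_Ropp (f : R -> R) : continuity f -> continuity (fun x => - f x).
Proof. exact (continuity_opp f). Qed.

Lemma continuity_Rmult (f g : R -> R) :
  continuity f -> continuity g -> continuity (fun x => f x * g x).
Proof. exact (continuity_mult f g). Qed.

Lemma continuity_Rdiv (f g : R -> R) :
  continuity f -> continuity g -> (forall x, g x <> 0) -> continuity (fun x => f x / g x).
Proof. exact (continuity_div f g). Qed.

Lemma continuity_Rabs_comp (f : R -> R) : continuity f -> continuity (fun x => Rabs (f x)).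
Proof. intros H; exact (continuity_comp f Rabs H Rcontinuity_abs). Qed.

Lemma continuity_exp_comp (f : R -> R) : continuity f -> continuity (fun x => exp (f x)).
Proof. intros H; exact (continuity_comp f exp H (derivable_continuous _ derivable_exp)). Qed.

Lemma continuity_Rpow (f : R -> R) (n : nat) : continuity f -> continuity (fun x => f x ^ n).
Proof.
  intros H; exact (continuity_comp f (fun y => y ^ n) H (derivable_continuous _ (derivable_pow n))).
Qed.

Lemma continuity_Cmod (f : R -> C) : Ccontinuous f -> continuity (fun x => Cmod (f x)).
Proof.
  intros [F1 F2] x. unfold Cmod.
  apply (continuity_pt_comp (fun x => fst (f x) ^ 2 + snd (f x) ^ 2) sqrt).
  - apply continuity_Rplus; apply continuity_Rpow; trivial.
  - apply continuity_pt_sqrt. nra.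
Qed.

Create HintDb cont.
#[global] Hint Resolve Ccontinuous_const Ccontinuous_RtoC Ccontinuous_plus Ccontinuous_minus
  Ccontinuous_mult Ccontinuous_Cexpi Ccontinuous_conj continuity_id continuity_cst continuity_Rplus
  continuity_Rminus continuity_Ropp continuity_Rmult continuity_Rabs_comp continuity_exp_comp
  continuity_Rpow continuity_Cmod : cont.

(** * Joint continuity in two variables, parameter integrals, and Fubini on rectangles *)

Definition continuity2 (f : R -> R -> R) : Prop := forall x y, continuity_2d_pt f x y.

Definition Ccontinuous2 (f : R -> R -> C) : Prop :=
  continuity2 (fun x y => fst (f x y)) /\ continuity2 (fun x y => snd (f x y)).

Lemma continuity2_comp (h : R -> R) (g : R -> R -> R) :
  continuity h -> continuity2 g -> continuity2 (fun x y => h (g x y)).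
Proof. intros H G x y; apply continuity_1d_2d_pt_comp; [apply H|apply G]. Qed.

Lemma continuity2_plus (f g : R -> R -> R) :
  continuity2 f -> continuity2 g -> continuity2 (fun x y => f x y + g x y).
Proof. intros F G x y; apply continuity_2d_pt_plus; [apply F|apply G]. Qed.

Lemma continuity2_minus (f g : R -> R -> R) :
  continuity2 f -> continuity2 g -> continuity2 (fun x y => f x y - g x y).
Proof. intros F G x y; apply continuity_2d_pt_minus; [apply F|apply G]. Qed.

Lemma continuity2_opp (f : R -> R -> R) : continuity2 f -> continuity2 (fun x y => - f x y).
Proof. intros F x y; apply continuity_2d_pt_opp; apply F. Qed.

Lemma continuity2_mult (f g : R -> R -> R) :
  continuity2 f -> continuity2 g -> continuity2 (fun x y => f x y * g x y).
Proof. intros F G x y; apply continuity_2d_pt_mult; [apply F|apply G]. Qed.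

Lemma continuity2_fst : continuity2 (fun x _ => x).
Proof. intros x y; apply continuity_2d_pt_id1. Qed.

Lemma continuity2_snd : continuity2 (fun _ y => y).
Proof. intros x y; apply continuity_2d_pt_id2. Qed.

Lemma continuity2_const (c : R) : continuity2 (fun _ _ => c).
Proof. intros x y; apply continuity_2d_pt_const. Qed.

Lemma Ccontinuous2_comp (f : R -> C) (h : R -> R -> R) :
  Ccontinuous f -> continuity2 h -> Ccontinuous2 (fun x y => f (h x y)).
Proof.
  intros [F1 F2] H; split; [exact (continuity2_comp _ _ F1 H)|exact (continuity2_comp _ _ F2 H)].
Qed.

Lemma Ccontinuous2_fst (f : R -> C) : Ccontinuous f -> Ccontinuous2 (fun x _ => f x).
Proof. intros F; apply (Ccontinuous2_comp f (fun x _ => x)); [exact F|apply continuity2_fst]. Qed.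

Lemma Ccontinuous2_snd (f : R -> C) : Ccontinuous f -> Ccontinuous2 (fun _ y => f y).
Proof. intros F; apply (Ccontinuous2_comp f (fun _ y => y)); [exact F|apply continuity2_snd]. Qed.

Lemma Ccontinuous2_mult (f g : R -> R -> C) :
  Ccontinuous2 f -> Ccontinuous2 g -> Ccontinuous2 (fun x y => (f x y * g x y)%C).
Proof.
  intros [F1 F2] [G1 G2]; split.
  - exact (continuity2_minus _ _ (continuity2_mult _ _ F1 G1) (continuity2_mult _ _ F2 G2)).
  - exact (continuity2_plus _ _ (continuity2_mult _ _ F1 G2) (continuity2_mult _ _ F2 G1)).
Qed.

Lemma Ccontinuous2_Cexpi (h : R -> R -> R) :
  continuity2 h -> Ccontinuous2 (fun x y => Cexpi (h x y)).
Proof. apply Ccontinuous2_comp, Ccontinuous_expi. Qed.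

#[global] Hint Resolve continuity2_plus continuity2_minus continuity2_opp continuity2_mult
  continuity2_fst continuity2_snd continuity2_const Ccontinuous2_mult Ccontinuous2_Cexpi : cont.

Lemma continuity_ex_RInt (f : R -> R) (u v : R) : continuity f -> ex_RInt f u v.
Proof.
  intros H. apply (ex_RInt_continuous (V := R_CompleteNormedModule)).
  intros z _; apply continuity_pt_filterlim, H.
Qed.
#[global] Hint Resolve continuity_ex_RInt : cont.

Lemma continuity2_slice (f : R -> R -> R) (x : R) : continuity2 f -> continuity (f x).
Proof.
  intros H y eps He. destruct (H x y (mkposreal eps He)) as [d Hd].
  exists d; split; [apply cond_pos|]. intros z [_ Hz].
  apply Hd; [rewrite Rminus_diag, Rabs_R0; apply cond_pos|exact Hz].
Qed.

Lemma continuity2_swap (f : R -> R -> R) : continuity2 f -> continuity2 (fun x y => f y x).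
Proof.
  intros H x y eps. destruct (H y x eps) as [d Hd]. exists d; intros u v Hu Hv. apply Hd; trivial.
Qed.

(** Uniform continuity on [x0 - 1, x0 + 1] x [c, d] moves the integrand by less than
    [eps / (Rabs (d - c) + 1)] for all y at once; the [+ 1] covers c = d. *)
Lemma continuity_RInt_param (f : R -> R -> R) (c d : R) :
  continuity2 f -> continuity (fun x => RInt (f x) c d).
Proof.
  intros H x0 eps He.
  assert (He' : 0 < eps / (Rabs (d - c) + 1)).
  { apply Rdiv_lt_0_compat; [exact He|]. generalize (Rabs_pos (d - c)); lra. }
  destruct (uniform_continuity_2d f (x0 - 1) (x0 + 1) (Rmin c d) (Rmax c d)
    (fun x y _ _ => H x y) (mkposreal _ He')) as [del Hdel]; simpl in Hdel.
  exists (Rmin del 1); split; [apply Rmin_pos; [apply cond_pos|lra]|].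
  intros x [_ Hx]. unfold R_met, Rdist in *; simpl in *. unfold Rdist in *.
  assert (Hx1 := Rlt_le_trans _ _ _ Hx (Rmin_l _ _)).
  assert (Hx2 := Rlt_le_trans _ _ _ Hx (Rmin_r _ _)).
  apply Rabs_def2 in Hx2.
  assert (E : is_RInt (fun y => f x y - f x0 y) c d (RInt (f x) c d - RInt (f x0) c d)).
  { apply (is_RInt_minus (V := R_NormedModule));
      apply (RInt_correct (V := R_CompleteNormedModule)), continuity_ex_RInt, continuity2_slice, H. }
  apply (norm_RInt_le_const_abs (V := R_NormedModule)) with (M := eps / (Rabs (d - c) + 1)) in E.
  - eapply Rle_lt_trans; [exact E|].
    assert (Hq : eps / (Rabs (d - c) + 1) * (Rabs (d - c) + 1) = eps).
    { field. generalize (Rabs_pos (d - c)); lra. }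
    lra.
  - intros y Hy. left. apply Hdel; try lra.
    rewrite Rminus_diag, Rabs_R0; apply cond_pos.
Qed.

Lemma is_derive_RInt_upper (f : R -> R) (u t : R) :
  continuity f -> is_derive (fun s => RInt f u s) t (f t).
Proof.
  intros H. apply (is_derive_RInt (V := R_NormedModule)) with (a := u).
  - apply filter_forall; intros s. apply (RInt_correct (V := R_CompleteNormedModule)); auto with cont.
  - apply continuity_pt_filterlim, H.
Qed.

Lemma zero_derivative_constant (f : R -> R) :
  (forall x, is_derive f x 0) -> forall x y, f x = f y.
Proof.
  intros H x y.
  destruct (MVT_gen f y x (fun _ => 0)) as [c [_ Hc]].
  - intros; apply H.
  - intros z _. apply derivable_continuous_pt. exists 0. apply is_derive_Reals, H.
  - lra.
Qed.

(* Both sides vanish at [v = u] and have the same derivative in [v]. *)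
Lemma RInt_Fubini (f : R -> R -> R) (u v c d : R) :
  continuity2 f ->
  RInt (fun x => RInt (fun y => f x y) c d) u v = RInt (fun y => RInt (fun x => f x y) u v) c d.
Proof.
  intros H.
  set (Phi := fun t => RInt (fun x => RInt (fun y => f x y) c d) u t
                       - RInt (fun y => RInt (fun x => f x y) u t) c d).
  assert (Hs := continuity2_swap f H).
  assert (HD : forall y t, is_derive (fun s => RInt (fun x => f x y) u s) t (f t y)).
  { intros y t. apply (is_derive_RInt_upper (fun x => f x y)). exact (continuity2_slice _ y Hs). }
  assert (E : Phi v = Phi u).
  { apply zero_derivative_constant. intros t. unfold Phi.
    replace 0 with (RInt (fun y => f t y) c d - RInt (fun y => f t y) c d) by ring.
    apply (is_derive_minus (K := R_AbsRing) (V := R_NormedModule)).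
    - apply (is_derive_RInt_upper (fun x => RInt (fun y => f x y) c d)).
      apply continuity_RInt_param, H.
    (* [is_derive_RInt_param] expects as integrand the derivative in [t] of the inner integral, so
       [f t y] is first rewritten as that derivative. *)
    - rewrite (RInt_ext (fun y => f t y)
        (fun y => Derive (fun s => RInt (fun x => f x y) u s) t))
        by (intros y _; symmetry; apply is_derive_unique, HD).
      apply (is_derive_RInt_param (fun t y => RInt (fun x => f x y) u t)).
      + apply filter_forall; intros s y _. eexists; apply HD.
      + intros y _. apply continuity_2d_pt_ext with f; [|apply H].
        intros a b; symmetry; apply is_derive_unique, HD.
      + apply filter_forall; intros s. apply continuity_ex_RInt.
        exact (continuity_RInt_param (fun y x => f x y) u s Hs). }
  unfold Phi in E. rewrite RInt_point in E.
  rewrite (RInt_ext (fun y => RInt (fun x => f x y) u u) (fun _ => 0) c d) in E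
    by (intros y _; apply (RInt_point (V := R_CompleteNormedModule))).
  rewrite (RInt_const (V := R_CompleteNormedModule)) in E.
  unfold zero, scal, mult in E; simpl in E; unfold mult in E; simpl in E. lra.
Qed.

(** * Integrals of complex-valued functions over segments *)

Definition CInt (f : R -> C) (u v : R) : C :=
  (RInt (fun x => fst (f x)) u v, RInt (fun x => snd (f x)) u v).

(** Identifies the componentwise integral with the one in the normed module of complex numbers,
    whose norm is [Cmod]. Estimates of [Cmod (CInt f u v)] then hold with constant 1, which bounds
    on real and imaginary parts would lose. *)
Lemma CInt_correct (f : R -> C) (u v : R) :
  Ccontinuous f -> is_RInt (V := C_R_NormedModule) f u v (CInt f u v).
Proof.
  intros [F1 F2].
  apply (is_RInt_fct_extend_pair (U := R_NormedModule) (V := R_NormedModule));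
    apply (RInt_correct (V := R_CompleteNormedModule)); auto with cont.
Qed.

Lemma CInt_is_RInt (f : R -> C) (u v : R) (l : C) :
  is_RInt (V := C_R_NormedModule) f u v l -> CInt f u v = l.
Proof.
  intros H. apply C_eq; simpl; apply is_RInt_unique.
  - exact (is_RInt_fct_extend_fst (U := R_NormedModule) (V := R_NormedModule) f u v l H).
  - exact (is_RInt_fct_extend_snd (U := R_NormedModule) (V := R_NormedModule) f u v l H).
Qed.

Lemma Cmod_CInt_le (f : R -> C) (g : R -> R) (u v : R) :
  u <= v -> Ccontinuous f -> continuity g ->
  (forall x, u <= x <= v -> Cmod (f x) <= g x) -> Cmod (CInt f u v) <= RInt g u v.
Proof.
  intros Huv Hf Hg H. rewrite Cmod_norm.
  apply (norm_RInt_le (V := C_R_NormedModule) f g u v).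
  - exact Huv.
  - intros x Hx. eapply Rle_trans; [right; symmetry; exact (Cmod_norm (f x))|auto].
  - apply CInt_correct, Hf.
  - apply (RInt_correct (V := R_CompleteNormedModule)); auto with cont.
Qed.

Lemma Cmod_CInt_le_const (f : R -> C) (M u v : R) :
  u <= v -> Ccontinuous f ->
  (forall x, u <= x <= v -> Cmod (f x) <= M) -> Cmod (CInt f u v) <= (v - u) * M.
Proof.
  intros Huv Hf H. rewrite Cmod_norm.
  apply (norm_RInt_le_const (V := C_R_NormedModule) f u v).
  - exact Huv.
  - intros x Hx. eapply Rle_trans; [right; symmetry; exact (Cmod_norm (f x))|auto].
  - apply CInt_correct, Hf.
Qed.

Lemma CInt_ext (f g : R -> C) (u v : R) :
  (forall x, f x = g x) -> CInt f u v = CInt g u v.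
Proof. intros H; unfold CInt; f_equal; apply RInt_ext; intros x _; rewrite H; reflexivity. Qed.

Lemma CInt_zero (f : R -> C) (u v : R) :
  u <= v -> (forall x, u < x < v -> f x = RtoC 0) -> CInt f u v = RtoC 0.
Proof.
  intros Huv H; apply C_eq; simpl.
  - rewrite (RInt_ext _ (fun _ => 0)).
    + rewrite RInt_const. apply Rmult_0_r.
    + rewrite Rmin_left, Rmax_right by exact Huv. intros x Hx; rewrite H; trivial.
  - rewrite (RInt_ext _ (fun _ => 0)).
    + rewrite RInt_const. apply Rmult_0_r.
    + rewrite Rmin_left, Rmax_right by exact Huv. intros x Hx; rewrite H; trivial.
Qed.

Lemma CInt_plus (f g : R -> C) (u v : R) :
  Ccontinuous f -> Ccontinuous g ->
  CInt (fun x => (f x + g x)%C) u v = (CInt f u v + CInt g u v)%C.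
Proof.
  intros Hf Hg. apply CInt_is_RInt.
  apply (is_RInt_plus (V := C_R_NormedModule)); apply CInt_correct; trivial.
Qed.

Lemma CInt_minus (f g : R -> C) (u v : R) :
  Ccontinuous f -> Ccontinuous g ->
  CInt (fun x => (f x - g x)%C) u v = (CInt f u v - CInt g u v)%C.
Proof.
  intros Hf Hg. apply CInt_is_RInt.
  apply (is_RInt_minus (V := C_R_NormedModule)); apply CInt_correct; trivial.
Qed.

Lemma RInt_lin2 (f g : R -> R) (a b u v : R) :
  continuity f -> continuity g ->
  RInt (fun x => a * f x + b * g x) u v = a * RInt f u v + b * RInt g u v.
Proof.
  intros Hf Hg. apply is_RInt_unique.
  apply (is_RInt_plus (V := R_NormedModule));
    apply (is_RInt_scal (V := R_NormedModule)), (RInt_correct (V := R_CompleteNormedModule)); auto with cont.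
Qed.

Lemma CInt_mult_l (c : C) (f : R -> C) (u v : R) :
  Ccontinuous f -> CInt (fun x => (c * f x)%C) u v = (c * CInt f u v)%C.
Proof.
  intros [F1 F2]. apply C_eq; simpl.
  - rewrite (RInt_ext _ (fun x => fst c * fst (f x) + (- snd c) * snd (f x)))
      by (intros; simpl; ring).
    rewrite RInt_lin2 by assumption. ring.
  - apply RInt_lin2; assumption.
Qed.

Lemma CInt_mult_r (c : C) (f : R -> C) (u v : R) :
  Ccontinuous f -> CInt (fun x => (f x * c)%C) u v = (CInt f u v * c)%C.
Proof.
  intros Hf. rewrite (CInt_ext _ (fun x => (c * f x)%C)) by (intros; ring).
  rewrite CInt_mult_l by exact Hf. ring.
Qed.

Lemma CInt_conj (f : R -> C) (u v : R) :
  Ccontinuous f -> CInt (fun x => Cconj (f x)) u v = Cconj (CInt f u v).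
Proof.
  intros [F1 F2]. apply C_eq; simpl; [reflexivity|].
  apply (RInt_opp (V := R_CompleteNormedModule)). auto with cont.
Qed.

Lemma CInt_Chasles (f : R -> C) (u v w : R) :
  Ccontinuous f -> (CInt f u v + CInt f v w)%C = CInt f u w.
Proof.
  intros [F1 F2]. apply C_eq; simpl;
    apply (RInt_Chasles (V := R_CompleteNormedModule)); auto with cont.
Qed.

Lemma CInt_shift (f : R -> C) (c u v : R) :
  Ccontinuous f -> CInt (fun x => f (x - c)) u v = CInt f (u - c) (v - c).
Proof.
  assert (K : forall g, continuity g -> RInt (fun x => g (x - c)) u v = RInt g (u - c) (v - c)).
  { intros g Hg. replace (u - c) with (1 * u + - c) by ring. replace (v - c) with (1 * v + - c) by ring.
    rewrite <- (RInt_comp_lin (V := R_CompleteNormedModule)) by auto with cont.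
    apply RInt_ext; intros x _. unfold scal; simpl; unfold mult; simpl.
    rewrite Rmult_1_l. f_equal; ring. }
  intros [F1 F2]. apply C_eq; simpl.
  - exact (K (fun x => fst (f x)) F1).
  - exact (K (fun x => snd (f x)) F2).
Qed.

Lemma Ccontinuous_CInt_param (f : R -> R -> C) (c d : R) :
  Ccontinuous2 f -> Ccontinuous (fun x => CInt (f x) c d).
Proof.
  intros [F1 F2]; split.
  - exact (continuity_RInt_param _ c d F1).
  - exact (continuity_RInt_param _ c d F2).
Qed.

Lemma CInt_Fubini (f : R -> R -> C) (u v c d : R) :
  Ccontinuous2 f ->
  CInt (fun x => CInt (fun y => f x y) c d) u v = CInt (fun y => CInt (fun x => f x y) u v) c d.
Proof.
  intros [F1 F2]; apply C_eq; simpl.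
  - exact (RInt_Fubini _ u v c d F1).
  - exact (RInt_Fubini _ u v c d F2).
Qed.

(** * Integrals over the real line *)

Lemma RInt_nonneg_mono (g : R -> R) (u' u v v' : R) :
  continuity g -> (forall x, 0 <= g x) -> u' <= u -> u <= v -> v <= v' ->
  RInt g u v <= RInt g u' v'.
Proof.
  intros Hg H0 H1 H2 H3.
  assert (P : forall a b, a <= b -> 0 <= RInt g a b).
  { intros a b Hab. apply RInt_ge_0; auto with cont. }
  generalize (RInt_Chasles (V := R_CompleteNormedModule) g u' u v)
    (RInt_Chasles (V := R_CompleteNormedModule) g u' v v').
  intros E1 E2. rewrite <- E2, <- E1 by auto with cont.
  generalize (P u' u H1) (P v v' H3). unfold plus; simpl. lra.
Qed.

(** The improper integral in terms of the total function [RInt] instead of [Riemann_integrable]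
    witnesses; both forms agree for continuous [f]. *)
Definition convergent_integral (f : R -> R) (l : R) : Prop :=
  forall eps, 0 < eps -> exists M, forall u v, u <= - M -> M <= v -> Rabs (RInt f u v - l) < eps.

Lemma improper_integral_iff (f : R -> R) (l : R) :
  continuity f -> (improper_integral f l <-> convergent_integral f l).
Proof.
  intros Hf; split.
  - intros [_ H] eps He. destruct (H eps He) as [M HM]. exists M; intros u v Hu Hv.
    rewrite (RInt_Reals f u v (ex_RInt_Reals_0 f u v (continuity_ex_RInt f u v Hf))). auto.
  - intros H; split.
    + intros u v; constructor. apply ex_RInt_Reals_0; auto with cont.
    + intros eps He. destruct (H eps He) as [M HM]. exists M; intros u v Hu Hv pr.
      rewrite <- RInt_Reals. auto.
Qed.

(** Widening the interval increases the integral of a nonnegative function, so the limit is the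
    supremum over the symmetric intervals [-N, N]. *)
Lemma nonneg_bounded_integral (g : R -> R) (K : R) :
  continuity g -> (forall x, 0 <= g x) -> (forall N, 0 <= N -> RInt g (- N) N <= K) ->
  exists l, l <= K /\ (forall u v, u <= v -> RInt g u v <= l) /\ convergent_integral g l.
Proof.
  intros Hg H0 HK.
  destruct (completeness (fun z => exists N, 0 <= N /\ z = RInt g (- N) N)) as [l [Hub Hlub]].
  - exists K. intros z [N [HN ->]]; auto.
  - exists (RInt g (- 0) 0), 0; split; [lra|reflexivity].
  - assert (Hl : forall u v, u <= v -> RInt g u v <= l).
    { intros u v Huv. set (N := Rmax (Rabs u) (Rabs v)).
      assert (HN1 := Rmax_l (Rabs u) (Rabs v)). assert (HN2 := Rmax_r (Rabs u) (Rabs v)).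
      fold N in HN1, HN2.
      assert (HN : 0 <= N) by (generalize (Rabs_pos u); lra).
      apply Rabs_le_between in HN1. apply Rabs_le_between in HN2.
      apply Rle_trans with (RInt g (- N) N).
      - apply RInt_nonneg_mono; trivial; lra.
      - apply Hub. exists N; auto. }
    exists l; split; [|split; [exact Hl|]].
    + apply Hlub. intros z [N [HN ->]]; auto.
    + intros eps He.
      destruct (classic (exists N, 0 <= N /\ l - eps < RInt g (- N) N)) as [[N [HN H]]|H].
      * exists N. intros u v Hu Hv. apply Rabs_def1.
        -- generalize (Hl u v ltac:(lra)); lra.
        -- apply Rlt_le_trans with (RInt g (- N) N - l); [lra|].
           apply Rplus_le_compat_r, RInt_nonneg_mono; trivial; lra.
      * exfalso. assert (l <= l - eps); [|lra]. apply Hlub. intros z [N [HN ->]].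
        apply Rnot_lt_le; intros H'; apply H; exists N; auto.
Qed.

Lemma convergent_nonneg_upper (g : R -> R) (l : R) :
  continuity g -> (forall x, 0 <= g x) -> convergent_integral g l ->
  forall u v, u <= v -> RInt g u v <= l.
Proof.
  intros Hg H0 H u v Huv. apply le_epsilon; intros eps He.
  destruct (H eps He) as [M HM].
  assert (B1 := Rmin_l u (- M)). assert (B2 := Rmin_r u (- M)).
  assert (B3 := Rmax_l v M). assert (B4 := Rmax_r v M).
  generalize (HM (Rmin u (- M)) (Rmax v M) B2 B4); intros B. apply Rabs_def2 in B.
  apply Rle_trans with (RInt g (Rmin u (- M)) (Rmax v M)); [|lra].
  apply RInt_nonneg_mono; trivial; lra.
Qed.

Lemma convergent_integral_unique (f : R -> R) (l l' : R) :
  convergent_integral f l -> convergent_integral f l' -> l = l'.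
Proof.
  intros H H'. apply cond_eq. intros eps He.
  destruct (H (eps / 2) ltac:(lra)) as [M HM]. destruct (H' (eps / 2) ltac:(lra)) as [M' HM'].
  specialize (HM (- Rmax M M') (Rmax M M') ltac:(generalize (Rmax_l M M'); lra) (Rmax_l _ _)).
  specialize (HM' (- Rmax M M') (Rmax M M') ltac:(generalize (Rmax_r M M'); lra) (Rmax_r _ _)).
  apply Rabs_def2 in HM. apply Rabs_def2 in HM'. apply Rabs_def1; lra.
Qed.

Definition Iint (F : R -> C) (z : C) : Prop :=
  forall eps, 0 < eps ->
    exists M, forall u v, u <= - M -> M <= v -> Cmod (CInt F u v - z) < eps.

Lemma Iint_components (F : R -> C) (z : C) :
  Iint F z <-> convergent_integral (fun x => fst (F x)) (fst z) /\
               convergent_integral (fun x => snd (F x)) (snd z).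
Proof.
  split.
  - intros H; split; intros eps He; destruct (H eps He) as [M HM]; exists M; intros u v Hu Hv.
    + exact (Rle_lt_trans _ _ _ (Cmod_fst (CInt F u v - z)%C) (HM u v Hu Hv)).
    + exact (Rle_lt_trans _ _ _ (Cmod_snd (CInt F u v - z)%C) (HM u v Hu Hv)).
  - intros [H1 H2] eps He.
    destruct (H1 (eps / 2) ltac:(lra)) as [M1 HM1]. destruct (H2 (eps / 2) ltac:(lra)) as [M2 HM2].
    exists (Rmax M1 M2); intros u v Hu Hv.
    assert (B1 := Rmax_l M1 M2). assert (B2 := Rmax_r M1 M2).
    eapply Rle_lt_trans; [apply Cmod_le_sum|].
    specialize (HM1 u v ltac:(lra) ltac:(lra)). specialize (HM2 u v ltac:(lra) ltac:(lra)).
    unfold CInt; simpl. unfold Rminus in *. lra.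
Qed.

Lemma Iint_Cintegral (F : R -> C) (z : C) : Ccontinuous F -> (Cintegral F z <-> Iint F z).
Proof.
  intros [F1 F2]. rewrite Iint_components. unfold Cintegral.
  rewrite !improper_integral_iff by assumption. reflexivity.
Qed.

Lemma Iint_ext (F G : R -> C) (z : C) : (forall x, F x = G x) -> Iint F z -> Iint G z.
Proof.
  intros E H eps He. destruct (H eps He) as [M HM]. exists M; intros u v Hu Hv.
  rewrite <- (CInt_ext F G) by exact E. auto.
Qed.

Lemma Iint_unique (F : R -> C) (z z' : C) : Iint F z -> Iint F z' -> z = z'.
Proof.
  rewrite !Iint_components. intros [H1 H2] [H1' H2'].
  apply C_eq; eapply convergent_integral_unique; eauto.
Qed.

Lemma Iint_plus (F G : R -> C) (z w : C) :
  Ccontinuous F -> Ccontinuous G -> Iint F z -> Iint G w ->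
  Iint (fun x => (F x + G x)%C) (z + w)%C.
Proof.
  intros HF HG Hz Hw eps He.
  destruct (Hz (eps / 2) ltac:(lra)) as [M HM]. destruct (Hw (eps / 2) ltac:(lra)) as [M' HM'].
  exists (Rmax M M'); intros u v Hu Hv.
  assert (B1 := Rmax_l M M'). assert (B2 := Rmax_r M M').
  rewrite CInt_plus by assumption.
  replace (_ - _)%C with ((CInt F u v - z) + (CInt G u v - w))%C by ring.
  eapply Rle_lt_trans; [apply Cmod_triangle|].
  specialize (HM u v ltac:(lra) ltac:(lra)). specialize (HM' u v ltac:(lra) ltac:(lra)). lra.
Qed.

Lemma Iint_mult_l (c : C) (F : R -> C) (z : C) :
  Ccontinuous F -> Iint F z -> Iint (fun x => (c * F x)%C) (c * z)%C.
Proof.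
  intros HF Hz eps He. assert (Hc := Cmod_ge_0 c).
  destruct (Hz (eps / (Cmod c + 1))) as [M HM]; [apply Rdiv_lt_0_compat; lra|].
  exists M; intros u v Hu Hv. specialize (HM u v Hu Hv).
  rewrite CInt_mult_l by assumption.
  replace (_ - _)%C with (c * (CInt F u v - z))%C by ring. rewrite Cmod_mult.
  assert (E : eps / (Cmod c + 1) * (Cmod c + 1) = eps) by (field; lra).
  generalize (Cmod_ge_0 (CInt F u v - z)); intros. nra.
Qed.

Lemma Iint_minus (F G : R -> C) (z w : C) :
  Ccontinuous F -> Ccontinuous G -> Iint F z -> Iint G w ->
  Iint (fun x => (F x - G x)%C) (z - w)%C.
Proof.
  intros HF HG Hz Hw.
  apply (Iint_ext (fun x => (F x + (- (1)) * G x)%C)); [intros; ring|].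
  replace (z - w)%C with (z + (- (1)) * w)%C by ring.
  apply Iint_plus; auto with cont. apply Iint_mult_l; trivial.
Qed.

(** [h] is the difference of [h + g] and [g], both nonnegative with bounded integrals, so the
    monotone case applies to each. *)
Lemma dominated_convergent (h g : R -> R) (K : R) :
  continuity h -> continuity g -> (forall x, Rabs (h x) <= g x) ->
  (forall u v, u <= v -> RInt g u v <= K) -> exists l, convergent_integral h l.
Proof.
  intros Hh Hg Hle HK.
  assert (Hg0 : forall x, 0 <= g x) by (intros x; generalize (Hle x) (Rabs_pos (h x)); lra).
  destruct (nonneg_bounded_integral g K Hg Hg0) as [l1 [_ [_ H1]]];
    [intros; apply HK; lra|].
  destruct (nonneg_bounded_integral (fun x => 1 * h x + 1 * g x) (2 * K)) as [l2 [_ [_ H2]]].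
  - auto with cont.
  - intros x; generalize (Hle x); intros B; apply Rabs_le_between in B; lra.
  - intros N HN. rewrite RInt_lin2 by assumption.
    assert (RInt h (- N) N <= RInt g (- N) N).
    { apply RInt_le; auto with cont; [lra|].
      intros x _; generalize (Hle x); intros B; apply Rabs_le_between in B; lra. }
    generalize (HK (- N) N ltac:(lra)); lra.
  - exists (l2 - l1). intros eps He.
    destruct (H1 (eps / 2) ltac:(lra)) as [M1 HM1]. destruct (H2 (eps / 2) ltac:(lra)) as [M2 HM2].
    exists (Rmax M1 M2); intros u v Hu Hv.
    assert (B1 := Rmax_l M1 M2). assert (B2 := Rmax_r M1 M2).
    specialize (HM1 u v ltac:(lra) ltac:(lra)). specialize (HM2 u v ltac:(lra) ltac:(lra)).
    rewrite RInt_lin2 in HM2 by assumption.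
    apply Rabs_def2 in HM1. apply Rabs_def2 in HM2. apply Rabs_def1; lra.
Qed.

Lemma dominated_Iint (F : R -> C) (g : R -> R) (K : R) :
  Ccontinuous F -> continuity g -> (forall x, Cmod (F x) <= g x) ->
  (forall u v, u <= v -> RInt g u v <= K) -> exists z, Iint F z.
Proof.
  intros [F1 F2] Hg Hle HK.
  destruct (dominated_convergent (fun x => fst (F x)) g K) as [l1 H1]; trivial.
  { intros x; eapply Rle_trans; [apply Cmod_fst|apply Hle]. }
  destruct (dominated_convergent (fun x => snd (F x)) g K) as [l2 H2]; trivial.
  { intros x; eapply Rle_trans; [apply Cmod_snd|apply Hle]. }
  exists (l1, l2). apply Iint_components; split; trivial.
Qed.

Lemma Iint_le (F : R -> C) (g : R -> R) (K : R) (z : C) :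
  Ccontinuous F -> continuity g -> (forall x, Cmod (F x) <= g x) ->
  (forall u v, u <= v -> RInt g u v <= K) -> Iint F z -> Cmod z <= K.
Proof.
  intros HF Hg Hle HK Hz. apply le_epsilon; intros eps He.
  destruct (Hz eps He) as [M HM].
  assert (B := Rmax_l M 0). assert (B' := Rmax_r M 0).
  specialize (HM (- Rmax M 0) (Rmax M 0) ltac:(lra) B).
  eapply Rle_trans; [apply (Cmod_le_minus z (CInt F (- Rmax M 0) (Rmax M 0)))|].
  rewrite Cmod_minus_sym. apply Rplus_le_compat; [|lra].
  eapply Rle_trans; [apply (Cmod_CInt_le F g); auto; lra|]. apply HK; lra.
Qed.

(** [g] has integral at most [l] over every interval and at least [l - tau] over [-A, A], so at most
    [tau] remains outside, and this dominates the tail of [F]. *)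
Lemma Iint_tail (F : R -> C) (g : R -> R) (l tau A : R) (z : C) :
  Ccontinuous F -> continuity g -> (forall x, Cmod (F x) <= g x) ->
  (forall u v, u <= v -> RInt g u v <= l) -> 0 <= A -> l - tau <= RInt g (- A) A ->
  Iint F z -> Cmod (z - CInt F (- A) A) <= tau.
Proof.
  intros HF Hg Hle Hl HA Htau Hz. apply le_epsilon; intros eps He.
  destruct (Hz eps He) as [M HM].
  assert (B1 := Rmax_l M A). assert (B2 := Rmax_r M A). set (N := Rmax M A) in *.
  specialize (HM (- N) N ltac:(lra) B1).
  eapply Rle_trans; [apply (Cmod_minus_triangle z (CInt F (- N) N))|].
  rewrite (Cmod_minus_sym z). rewrite Rplus_comm. apply Rplus_le_compat; [|lra].
  replace (CInt F (- N) N - CInt F (- A) A)%C with (CInt F (- N) (- A) + CInt F A N)%C.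
  2:{ rewrite <- (CInt_Chasles F (- N) (- A) N), <- (CInt_Chasles F (- A) A N) by assumption. ring. }
  eapply Rle_trans; [apply Cmod_triangle|].
  eapply Rle_trans; [apply Rplus_le_compat; apply (Cmod_CInt_le F g); auto; lra|].
  generalize (RInt_Chasles (V := R_CompleteNormedModule) g (- N) (- A) N)
    (RInt_Chasles (V := R_CompleteNormedModule) g (- A) A N). intros E1 E2.
  assert (E3 := Hl (- N) N ltac:(lra)).
  rewrite <- E1, <- E2 in E3 by auto with cont. unfold plus in E3; simpl in E3. lra.
Qed.

(** * Exponentially decaying functions *)

(** It has two uses: with rate [a] it measures decay on the Fourier side, with a small rate [eps] it
    is the Abel summation factor. *)
Definition weight (a x : R) : R := exp (- (a * Rabs x)).

Lemma weight_pos (a x : R) : 0 < weight a x.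
Proof. apply exp_pos. Qed.

Lemma continuity_weight (a : R) : continuity (weight a).
Proof. unfold weight; auto with cont. Qed.
#[global] Hint Resolve continuity_weight : cont.

Lemma exp_mono (x y : R) : x <= y -> exp x <= exp y.
Proof. intros [H|H]; [left; apply exp_increasing, H|right; rewrite H; reflexivity]. Qed.

Lemma weight_le_1 (a x : R) : 0 <= a -> weight a x <= 1.
Proof.
  intros Ha. rewrite <- exp_0. apply exp_mono. generalize (Rabs_pos x). nra.
Qed.

Lemma weight_mult_le (a x y : R) : 0 <= a -> weight a y * weight a (x - y) <= weight a x.
Proof.
  intros Ha. unfold weight. rewrite <- exp_plus. apply exp_mono.
  generalize (Rabs_triang y (x - y)). replace (y + (x - y)) with x by ring. nra.
Qed.

Lemma RInt_exp_linear (c u v : R) :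
  c <> 0 -> RInt (fun x => exp (c * x)) u v = (exp (c * v) - exp (c * u)) / c.
Proof.
  intros Hc. apply is_RInt_unique.
  replace (_ / c) with (minus (exp (c * v) / c) (exp (c * u) / c))
    by (unfold minus, plus, opp; simpl; field; exact Hc).
  apply (is_RInt_derive (V := R_CompleteNormedModule) (fun x => exp (c * x) / c)).
  - intros x _. auto_derive; trivial. field; exact Hc.
  - intros x _. apply continuity_pt_filterlim.
    apply (continuity_exp_comp (fun x => c * x)); auto with cont.
Qed.

Lemma RInt_weight (a u v : R) : 0 < a -> u <= v -> RInt (weight a) u v <= 2 / a.
Proof.
  intros Ha Huv. set (N := Rmax (Rabs u) (Rabs v)).
  assert (HN1 := Rmax_l (Rabs u) (Rabs v)). assert (HN2 := Rmax_r (Rabs u) (Rabs v)).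
  fold N in HN1, HN2.
  assert (HN : 0 <= N) by (generalize (Rabs_pos u); lra).
  apply Rabs_le_between in HN1. apply Rabs_le_between in HN2.
  apply Rle_trans with (RInt (weight a) (- N) N).
  { apply RInt_nonneg_mono; auto with cont; try lra. intros x; left; apply weight_pos. }
  rewrite <- (RInt_Chasles (V := R_CompleteNormedModule) (weight a) (- N) 0 N) by auto with cont.
  rewrite (RInt_ext (weight a) (fun x => exp (a * x)) (- N) 0).
  2:{ intros x Hx. rewrite Rmin_left, Rmax_right in Hx by lra. unfold weight.
      rewrite Rabs_left by lra. f_equal; ring. }
  rewrite (RInt_ext (weight a) (fun x => exp (- a * x)) 0 N).
  2:{ intros x Hx. rewrite Rmin_left, Rmax_right in Hx by lra. unfold weight.
      rewrite Rabs_pos_eq by lra. f_equal; ring. }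
  rewrite !RInt_exp_linear by lra. unfold plus; simpl.
  rewrite !Rmult_0_r, exp_0. replace (a * - N) with (- a * N) by ring.
  generalize (exp_pos (- a * N)). intros H.
  replace (_ + _) with (2 / a - 2 * (exp (- a * N) / a)) by (field; lra).
  assert (0 < exp (- a * N) / a) by (apply Rdiv_lt_0_compat; lra). lra.
Qed.

Lemma RInt_scal_weight (a A u v : R) :
  0 < a -> 0 <= A -> u <= v -> RInt (fun x => A * weight a x) u v <= A * (2 / a).
Proof.
  intros Ha HA Huv.
  rewrite (RInt_scal (V := R_CompleteNormedModule)) by auto with cont.
  apply Rmult_le_compat_l; [exact HA|]. apply RInt_weight; trivial.
Qed.

Definition decay (a A : R) (F : R -> C) : Prop :=
  Ccontinuous F /\ forall x, Cmod (F x) <= A * weight a x.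

Lemma decay_nonneg (a A : R) (F : R -> C) : decay a A F -> 0 <= A.
Proof.
  intros [_ H]. specialize (H 0). generalize (Cmod_ge_0 (F 0)) (weight_pos a 0). nra.
Qed.

Lemma decay_bounded (a A : R) (F : R -> C) (x : R) : 0 <= a -> decay a A F -> Cmod (F x) <= A.
Proof.
  intros Ha H. assert (HA := decay_nonneg a A F H). destruct H as [_ H].
  generalize (H x) (weight_le_1 a x Ha) (weight_pos a x). nra.
Qed.

(** * The inverse Fourier transform *)

Definition fkernel (x : R) (F : R -> C) (xi : R) : C :=
  (RtoC (/ (2 * PI)) * (F xi * Cexpi (x * xi)))%C.

Definition iFT (F f : R -> C) : Prop := forall x, Iint (fkernel x F) (f x).

Lemma inv_2PI_pos : 0 < / (2 * PI).
Proof. apply Rinv_0_lt_compat. generalize PI_RGT_0; lra. Qed.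

Lemma Ccontinuous_fkernel (x : R) (F : R -> C) : Ccontinuous F -> Ccontinuous (fkernel x F).
Proof. intros HF. unfold fkernel. auto 7 with cont. Qed.
#[global] Hint Resolve Ccontinuous_fkernel : cont.

Lemma Cmod_fkernel (x : R) (F : R -> C) (xi : R) :
  Cmod (fkernel x F xi) = / (2 * PI) * Cmod (F xi).
Proof.
  unfold fkernel. rewrite Cmod_scal by (left; apply inv_2PI_pos).
  rewrite Cmod_mult, Cmod_Cexpi; ring.
Qed.

Lemma iFT_is_invFT (F f : R -> C) : Ccontinuous F -> (iFT F f <-> is_invFT F f).
Proof.
  intros HF.
  assert (E : forall x, (fun xi => Cscale (/ (2 * PI)) (Defs.Cmult (F xi) (Cexpi (x * xi))))
                        = fkernel x F).
  { intros x; apply functional_extensionality; intros xi. apply Cscale_RtoC. }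
  unfold iFT, is_invFT. split; intros H x; specialize (H x).
  - rewrite E. apply Iint_Cintegral; auto with cont.
  - rewrite E in H. apply Iint_Cintegral in H; auto with cont.
Qed.

Lemma Cmod_fkernel_decay (a A : R) (F : R -> C) (x xi : R) :
  decay a A F -> Cmod (fkernel x F xi) <= / (2 * PI) * A * weight a xi.
Proof.
  intros [_ H]. rewrite Cmod_fkernel, Rmult_assoc.
  apply Rmult_le_compat_l; [left; apply inv_2PI_pos|apply H].
Qed.

Lemma RInt_fkernel_weight (a A u v : R) :
  0 < a -> 0 <= A -> u <= v ->
  RInt (fun xi => / (2 * PI) * A * weight a xi) u v <= A / (PI * a).
Proof.
  intros Ha HA Huv. generalize inv_2PI_pos; intros HP.
  eapply Rle_trans; [apply RInt_scal_weight; trivial; nra|].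
  right; field. split; [lra|apply PI_neq0].
Qed.

Lemma iFT_exists (a A : R) (F : R -> C) : 0 < a -> decay a A F -> exists f, iFT F f.
Proof.
  intros Ha HF.
  assert (E : forall x, exists z, Iint (fkernel x F) z).
  { intros x. apply dominated_Iint with (g := fun xi => / (2 * PI) * A * weight a xi) (K := A / (PI * a)).
    - apply Ccontinuous_fkernel, HF.
    - auto with cont.
    - intros xi; apply Cmod_fkernel_decay, HF.
    - intros u v; apply RInt_fkernel_weight; trivial. eapply decay_nonneg; eauto. }
  exists (fun x => proj1_sig (constructive_indefinite_description _ (E x))).
  intros x. exact (proj2_sig (constructive_indefinite_description _ (E x))).
Qed.

Lemma iFT_bound (a A : R) (F f : R -> C) :
  0 < a -> decay a A F -> iFT F f -> forall x, Cmod (f x) <= A / (PI * a).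
Proof.
  intros Ha HF Hf x.
  apply Iint_le with (F := fkernel x F) (g := fun xi => / (2 * PI) * A * weight a xi).
  - apply Ccontinuous_fkernel, HF.
  - auto with cont.
  - intros xi; apply Cmod_fkernel_decay, HF.
  - intros u v; apply RInt_fkernel_weight; trivial. eapply decay_nonneg; eauto.
  - apply Hf.
Qed.

Lemma iFT_unique (F f g : R -> C) : iFT F f -> iFT F g -> forall x, f x = g x.
Proof. intros Hf Hg x; exact (Iint_unique _ _ _ (Hf x) (Hg x)). Qed.

Lemma iFT_ext (F G f g : R -> C) :
  (forall xi, F xi = G xi) -> (forall x, f x = g x) -> iFT F f -> iFT G g.
Proof.
  intros E E' H x. rewrite <- E'. apply (Iint_ext (fkernel x F)); [|apply H].
  intros xi; unfold fkernel; rewrite E; reflexivity.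
Qed.

Lemma iFT_plus (F G f g : R -> C) :
  Ccontinuous F -> Ccontinuous G -> iFT F f -> iFT G g ->
  iFT (fun xi => (F xi + G xi)%C) (fun x => (f x + g x)%C).
Proof.
  intros HF HG Hf Hg x.
  apply (Iint_ext (fun xi => (fkernel x F xi + fkernel x G xi)%C)).
  - intros xi; unfold fkernel; ring.
  - apply Iint_plus; auto with cont.
Qed.

Lemma iFT_mult_l (c : C) (F f : R -> C) :
  Ccontinuous F -> iFT F f -> iFT (fun xi => (c * F xi)%C) (fun x => (c * f x)%C).
Proof.
  intros HF Hf x. apply (Iint_ext (fun xi => (c * fkernel x F xi)%C)).
  - intros xi; unfold fkernel; ring.
  - apply Iint_mult_l; auto with cont.
Qed.

Lemma iFT_minus (F G f g : R -> C) :
  Ccontinuous F -> Ccontinuous G -> iFT F f -> iFT G g ->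
  iFT (fun xi => (F xi - G xi)%C) (fun x => (f x - g x)%C).
Proof.
  intros HF HG Hf Hg x.
  apply (Iint_ext (fun xi => (fkernel x F xi - fkernel x G xi)%C)).
  - intros xi; unfold fkernel; ring.
  - apply Iint_minus; auto with cont.
Qed.

Lemma iFT_zero : iFT (fun _ => RtoC 0) (fun _ => RtoC 0).
Proof.
  intros x eps He. exists 0; intros u v Hu Hv.
  rewrite CInt_zero; [|lra|intros; unfold fkernel; ring].
  replace (0 - 0)%C with (RtoC 0) by ring. rewrite Cmod_0; exact He.
Qed.

(** The integral for [F] converges because [F - G] decays and [G] has an inverse transform. Its
    value at x differs from [g x] by at most [eps / (PI * a)], hence from [f x] by at most that plus
    [eps]. The pair [G], [g] may depend on x, so [f] need only be approximated pointwise. *)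
Lemma iFT_closed (a : R) (F f : R -> C) :
  0 < a -> Ccontinuous F ->
  (forall x eps, 0 < eps -> exists G g, Ccontinuous G /\ iFT G g /\
     (forall xi, Cmod (F xi - G xi) <= eps * weight a xi) /\ Cmod (g x - f x) <= eps) ->
  iFT F f.
Proof.
  intros Ha HF H x.
  assert (Hz : exists z, Iint (fkernel x F) z).
  { destruct (H x 1 ltac:(lra)) as [G [g [HG [Hg [Hd _]]]]].
    assert (HD : decay a 1 (fun xi => (F xi - G xi)%C)) by (split; auto with cont).
    destruct (iFT_exists a 1 _ Ha HD) as [d Hd'].
    exists (d x + g x)%C.
    apply (Iint_ext (fun xi => (fkernel x (fun xi => (F xi - G xi)%C) xi + fkernel x G xi)%C)).
    - intros xi; unfold fkernel; ring.
    - apply Iint_plus; auto with cont. }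
  destruct Hz as [z Hz]. replace (f x) with z; [exact Hz|].
  apply Ceq_of_arbitrarily_close; intros eps He.
  assert (HPa : 0 < / (PI * a)).
  { apply Rinv_0_lt_compat, Rmult_lt_0_compat; [apply PI_RGT_0|exact Ha]. }
  assert (He' : 0 < eps / (/ (PI * a) + 1)) by (apply Rdiv_lt_0_compat; lra).
  (* Chosen so that the total error [e / (PI * a) + e] equals [eps]. *)
  set (e := eps / (/ (PI * a) + 1)) in *.
  destruct (H x e He') as [G [g [HG [Hg [Hd Hgf]]]]].
  assert (HD : decay a e (fun xi => (F xi - G xi)%C)) by (split; auto with cont).
  destruct (iFT_exists a _ _ Ha HD) as [d Hd'].
  assert (E : z = (d x + g x)%C).
  { apply (Iint_unique (fkernel x F)); [exact Hz|].
    apply (Iint_ext (fun xi => (fkernel x (fun xi => (F xi - G xi)%C) xi + fkernel x G xi)%C)).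
    - intros xi; unfold fkernel; ring.
    - apply Iint_plus; auto with cont. }
  rewrite E. replace (d x + g x - f x)%C with (d x + (g x - f x))%C by ring.
  eapply Rle_trans; [apply Cmod_triangle|].
  assert (B := iFT_bound a e _ d Ha HD Hd' x). unfold Rdiv in B.
  assert (Ee : forall P, 0 < P -> eps / (P + 1) * (P + 1) = eps) by (intros; field; lra).
  specialize (Ee _ HPa). fold e in Ee.
  lra.
Qed.

(** * Differentiation of inverse Fourier transforms *)

Lemma sin_Rabs_le (x : R) : Rabs (sin x) <= Rabs x.
Proof.
  destruct (MVT_gen sin 0 x cos) as [c [_ Hc]].
  - intros; apply is_derive_Reals, derivable_pt_lim_sin.
  - intros y _; apply continuity_sin.
  - rewrite sin_0, !Rminus_0_r in Hc. rewrite Hc, Rabs_mult.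
    generalize (COS_bound c) (Rabs_pos x); intros [B1 B2] B3.
    assert (Rabs (cos c) <= 1) by (apply Rabs_le; lra). nra.
Qed.

Lemma one_minus_cos (x : R) : 1 - cos x = 2 * sin (x / 2) ^ 2.
Proof.
  replace x with (2 * (x / 2)) at 1 by field. rewrite cos_2a_sin. ring.
Qed.

Lemma sin_sub_id_bound (x : R) : Rabs (sin x - x) <= x ^ 2.
Proof.
  destruct (MVT_gen (fun s => sin s - s) 0 x (fun s => cos s - 1)) as [c [Hc E]].
  - intros y _. auto_derive; trivial; ring.
  - intros y _; apply continuity_Rminus; auto with cont. apply continuity_sin.
  - rewrite sin_0 in E. replace (sin x - x) with ((cos c - 1) * (x - 0)) by lra.
    rewrite Rminus_0_r, Rabs_mult, <- pow2_abs.
    assert (Hcx : Rabs c <= Rabs x).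
    { unfold Rmin, Rmax in Hc. destruct (Rle_dec 0 x).
      - rewrite !Rabs_pos_eq; lra.
      - rewrite !Rabs_left1; lra. }
    assert (Rabs (cos c - 1) <= Rabs c).
    { rewrite Rabs_minus_sym, one_minus_cos, Rabs_pos_eq by (generalize (pow2_ge_0 (sin (c / 2))); lra).
      rewrite <- pow2_abs.
      generalize (sin_Rabs_le (c / 2)) (Rabs_pos (sin (c / 2))) (SIN_bound (c / 2)); intros B1 B2 [B3 B4].
      assert (Rabs (sin (c / 2)) <= 1) by (apply Rabs_le; lra).
      unfold Rdiv in B1 at 2. rewrite Rabs_mult, (Rabs_pos_eq (/ 2)) in B1 by lra. nra. }
    generalize (Rabs_pos x); intros. simpl. rewrite Rmult_1_r. apply Rmult_le_compat_r; lra.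
Qed.

(** The real part contributes 1 - cos t <= t^2 and the imaginary part |sin t - t| <= t^2. Only the
    quadratic order matters, for the remainder in [iFT_derivative]. *)
Lemma Cexpi_taylor (t : R) : Cmod (Cexpi t - RtoC 1 - Ci * RtoC t) <= 2 * t ^ 2.
Proof.
  eapply Rle_trans; [apply Cmod_le_sum|]. simpl.
  replace (cos t + - (1) + - (0 * t - 1 * 0)) with (- (1 - cos t)) by ring.
  replace (sin t + - 0 + - (0 * 0 + 1 * t)) with (sin t - t) by ring.
  generalize (sin_sub_id_bound t); intros B1. simpl in B1.
  assert (Rabs (- (1 - cos t)) <= t ^ 2); [|simpl in *; lra].
  rewrite Rabs_Ropp, one_minus_cos, Rabs_pos_eq by (generalize (pow2_ge_0 (sin (t / 2))); lra).
  rewrite <- (pow2_abs (sin _)), <- (pow2_abs t).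
  generalize (sin_Rabs_le (t / 2)) (Rabs_pos (sin (t / 2))); intros B2 B3.
  unfold Rdiv in B2 at 2. rewrite Rabs_mult, (Rabs_pos_eq (/ 2)) in B2 by lra. nra.
Qed.

Definition times_ixi (F : R -> C) (xi : R) : C := (Ci * RtoC xi * F xi)%C.

Lemma Ccontinuous_times_ixi (F : R -> C) : Ccontinuous F -> Ccontinuous (times_ixi F).
Proof. intros HF; unfold times_ixi; auto with cont. Qed.
#[global] Hint Resolve Ccontinuous_times_ixi : cont.

Lemma Cmod_times_ixi (F : R -> C) (xi : R) : Cmod (times_ixi F xi) = Rabs xi * Cmod (F xi).
Proof. unfold times_ixi. rewrite !Cmod_mult, Cmod_Ci, Cmod_R; ring. Qed.

(** With t = a |x| / 2 this is t <= exp t: half of the decay rate pays for the factor |x|. *)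
Lemma Rabs_weight_le (a x : R) : 0 < a -> Rabs x * weight a x <= 2 / a * weight (a / 2) x.
Proof.
  intros Ha. unfold weight.
  replace (- (a * Rabs x)) with (- (a / 2 * Rabs x) + - (a / 2 * Rabs x)) by field.
  rewrite exp_plus, <- Rmult_assoc. apply Rmult_le_compat_r; [left; apply exp_pos|].
  set (t := a / 2 * Rabs x).
  replace (Rabs x) with (2 / a * t) by (unfold t; field; lra).
  rewrite Rmult_assoc. rewrite <- (Rmult_1_r (2 / a)) at 2.
  apply Rmult_le_compat_l; [apply Rlt_le, Rdiv_lt_0_compat; lra|].
  rewrite exp_Ropp. apply Rmult_le_reg_r with (exp t); [apply exp_pos|].
  rewrite Rmult_assoc, Rinv_l by (apply Rgt_not_eq, exp_pos).
  generalize (exp_ineq1_le t). lra.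
Qed.

Lemma decay_times_ixi (a A : R) (F : R -> C) :
  0 < a -> decay a A F -> decay (a / 2) (2 / a * A) (times_ixi F).
Proof.
  intros Ha HF. assert (HA := decay_nonneg _ _ _ HF). destruct HF as [HF HB].
  split; [auto with cont|]. intros xi. rewrite Cmod_times_ixi.
  apply Rle_trans with (Rabs xi * (A * weight a xi)).
  - apply Rmult_le_compat_l; [apply Rabs_pos|apply HB].
  - generalize (Rabs_weight_le a xi Ha). nra.
Qed.

(** The remainder f(x + h) - f(x) - h g(x) is the inversion integral of F(xi) (exp(i h xi) - 1 - i h
    xi), whose second factor is at most 2 h^2 xi^2. Since xi^2 F(xi) still decays, the remainder is
    at most a constant times h^2. *)
Lemma iFT_derivative (a A : R) (F f g : R -> C) :
  0 < a -> decay a A F -> iFT F f -> iFT (times_ixi F) g -> forall x, Cderiv f x (g x).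
Proof.
  intros Ha HF Hf Hg x.
  (* Multiplying twice by i xi brings in the factor xi^2 and leaves the rate a / 4. *)
  assert (HF2 := decay_times_ixi (a / 2) _ _ ltac:(lra) (decay_times_ixi a A F Ha HF)).
  set (a' := a / 2 / 2) in *. set (A' := 2 / (a / 2) * (2 / a * A)) in *.
  assert (HA' := decay_nonneg _ _ _ HF2).
  assert (Ha' : 0 < a') by (unfold a'; lra).
  assert (HC : Ccontinuous F) by apply HF.
  set (K := 2 * A' / (PI * a')).
  assert (HK : 0 <= K).
  { unfold K. apply Rdiv_le_0_compat; [lra|]. generalize PI_RGT_0; nra. }
  assert (B : forall h, Cmod (f (x + h)%R - f x - RtoC h * g x) <= h ^ 2 * K).
  { intros h.
    replace (h ^ 2 * K) with (h ^ 2 * (2 * A') / (PI * a'))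
      by (unfold K; field; split; [lra|apply PI_neq0]).
    assert (Hh := pow2_ge_0 h).
    apply Iint_le with
      (F := fun xi => (fkernel (x + h) F xi - fkernel x F xi - RtoC h * fkernel x (times_ixi F) xi)%C)
      (g := fun xi => / (2 * PI) * (h ^ 2 * (2 * A')) * weight a' xi).
    - auto 8 with cont.
    - auto with cont.
    - intros xi.
      replace (_ - _ - _)%C with
        (fkernel x F xi * (Cexpi (h * xi) - RtoC 1 - Ci * RtoC (h * xi)))%C.
      2:{ unfold fkernel, times_ixi. rewrite Rmult_plus_distr_r, Cexpi_plus, RtoC_mult. ring. }
      rewrite Cmod_mult, Cmod_fkernel, !Rmult_assoc.
      apply Rmult_le_compat_l; [left; apply inv_2PI_pos|].
      destruct HF2 as [_ HF2]. specialize (HF2 xi). rewrite !Cmod_times_ixi in HF2.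
      apply Rle_trans with (Cmod (F xi) * (2 * (h * xi) ^ 2)).
      + apply Rmult_le_compat_l; [apply Cmod_ge_0|apply Cexpi_taylor].
      + rewrite <- Rmult_assoc in HF2.
        replace (Rabs xi * Rabs xi) with (xi ^ 2) in HF2 by (rewrite <- (pow2_abs xi); ring).
        replace (Cmod (F xi) * (2 * (h * xi) ^ 2)) with (h ^ 2 * (2 * (xi ^ 2 * Cmod (F xi)))) by ring.
        apply Rmult_le_compat_l; [exact Hh|]. lra.
    - intros u v Huv. apply RInt_fkernel_weight; trivial. nra.
    - apply Iint_minus; auto with cont; [|apply Iint_mult_l; auto with cont].
      apply Iint_minus; auto with cont. }
  (* [pr] stands for [fst] or [snd], so the difference quotient is estimated once for both
     components. *)
  assert (D : forall pr : C -> R, (forall z, Rabs (pr z) <= Cmod z) ->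
    (forall h, pr (f (x + h)%R - f x - RtoC h * g x)%C = pr (f (x + h)) - pr (f x) - h * pr (g x)) ->
    derivable_pt_lim (fun t => pr (f t)) x (pr (g x))).
  { intros pr Hpr Hlin eps He.
    assert (Hd : 0 < eps / (K + 1)) by (apply Rdiv_lt_0_compat; lra).
    exists (mkposreal _ Hd); simpl; intros h Hh0 Hh.
    assert (Hh' : 0 < Rabs h) by (apply Rabs_pos_lt, Hh0).
    specialize (B h). assert (B1 := Hpr (f (x + h)%R - f x - RtoC h * g x)%C). rewrite Hlin in B1.
    apply Rmult_lt_reg_r with (Rabs h); [exact Hh'|].
    rewrite <- Rabs_mult.
    replace (_ * h) with (pr (f (x + h)) - pr (f x) - h * pr (g x)) by (field; exact Hh0).
    eapply Rle_lt_trans; [exact B1|]. eapply Rle_lt_trans; [exact B|].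
    rewrite <- (pow2_abs h).
    assert (E : eps / (K + 1) * (K + 1) = eps) by (field; lra).
    set (q := eps / (K + 1)) in *. replace (Rabs h ^ 2 * K) with (Rabs h * K * Rabs h) by ring.
    apply Rmult_lt_compat_r; [exact Hh'|]. nra. }
  split; apply D.
  - apply Cmod_fst.
  - intros h; simpl; ring.
  - apply Cmod_snd.
  - intros h; simpl; ring.
Qed.

(** Each factor i xi halves the decay rate but keeps it positive, so every derivative is again an
    inverse transform. *)
Lemma iFT_smooth (a A : R) (F f : R -> C) : 0 < a -> decay a A F -> iFT F f -> Csmooth f.
Proof.
  intros Ha HF Hf.
  set (G := fun n => Nat.iter n times_ixi F).
  assert (HG : forall n, exists a' A', 0 < a' /\ decay a' A' (G n)).
  { intros n; induction n as [|n [a' [A' [Ha' HG]]]].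
    - exists a, A; auto.
    - exists (a' / 2), (2 / a' * A'); split; [lra|]. apply decay_times_ixi; trivial. }
  assert (Hex : forall n, exists g, iFT (G n) g).
  { intros n; destruct (HG n) as [a' [A' [Ha' H]]]. eapply iFT_exists; eauto. }
  (* Index 0 is [f] itself, since [smooth] asks for the equality [d O = f]; the other values are
     chosen inverse transforms. *)
  set (d := fun n => match n with O => f | _ => proj1_sig (constructive_indefinite_description _ (Hex n)) end).
  assert (Hd : forall n, iFT (G n) (d n)).
  { intros [|n]; [exact Hf|].
    exact (proj2_sig (constructive_indefinite_description _ (Hex (S n)))). }
  assert (HD : forall n x, Cderiv (d n) x (d (S n) x)).
  { intros n. destruct (HG n) as [a' [A' [Ha' H]]].
    apply (iFT_derivative a' A' (G n)); trivial. exact (Hd (S n)). }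
  split.
  - exists (fun n x => fst (d n x)); split; [reflexivity|]. intros n x; apply HD.
  - exists (fun n x => snd (d n x)); split; [reflexivity|]. intros n x; apply HD.
Qed.

Lemma Cderiv_continuous (f g : R -> C) : (forall x, Cderiv f x (g x)) -> Ccontinuous f.
Proof.
  intros H; split; intros x; apply derivable_continuous_pt.
  - exists (fst (g x)); apply H.
  - exists (snd (g x)); apply H.
Qed.

(** * Convolution with a compactly supported function *)

(** When [k] vanishes outside [-L, L] this is the convolution over the whole line, yet it involves a
    segment integral only. With the factor 1/(2 pi) it corresponds to a product under the given
    transform convention. *)
Definition conv (L : R) (k F : R -> C) (xi : R) : C :=
  (RtoC (/ (2 * PI)) * CInt (fun eta => k eta * F (xi - eta)%R) (- L) L)%C.

Lemma Ccontinuous_conv (L : R) (k F : R -> C) :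
  Ccontinuous k -> Ccontinuous F -> Ccontinuous (conv L k F).
Proof.
  intros Hk HF. apply Ccontinuous_mult; [auto with cont|].
  apply (Ccontinuous_CInt_param (fun xi eta => (k eta * F (xi - eta)%R)%C)).
  apply Ccontinuous2_mult; [apply Ccontinuous2_snd, Hk|].
  apply Ccontinuous2_comp; auto with cont.
Qed.

Lemma Ccontinuous_reflect (F : R -> C) (x : R) : Ccontinuous F -> Ccontinuous (fun y => F (x - y)).
Proof. intros HF; apply (Ccontinuous_comp F (fun y => x - y)); auto with cont. Qed.
#[global] Hint Resolve Ccontinuous_conv Ccontinuous_reflect : cont.

Lemma conv_decay (L a A B : R) (k F : R -> C) :
  0 <= L -> 0 <= a -> decay a A k -> decay a B F -> decay a (A * B * (L / PI)) (conv L k F).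
Proof.
  intros HL Ha Hk HF.
  assert (HA := decay_nonneg _ _ _ Hk). assert (HB := decay_nonneg _ _ _ HF).
  destruct Hk as [Hk Bk]. destruct HF as [HF BF].
  split; [auto with cont|]. intros xi. unfold conv.
  rewrite Cmod_scal by (left; apply inv_2PI_pos).
  apply Rle_trans with (/ (2 * PI) * ((L - - L) * (A * B * weight a xi))).
  - apply Rmult_le_compat_l; [left; apply inv_2PI_pos|].
    apply Cmod_CInt_le_const; [lra|auto with cont|].
    intros eta _. rewrite Cmod_mult.
    apply Rle_trans with ((A * weight a eta) * (B * weight a (xi - eta))).
    + apply Rmult_le_compat; try apply Cmod_ge_0; auto.
    + replace (A * weight a eta * (B * weight a (xi - eta)))
        with (A * B * (weight a eta * weight a (xi - eta))) by ring.
      apply Rmult_le_compat_l; [nra|]. apply weight_mult_le, Ha.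
  - right; field; apply PI_neq0.
Qed.

Lemma conv_minus_l (L : R) (k k' F : R -> C) (xi : R) :
  Ccontinuous k -> Ccontinuous k' -> Ccontinuous F ->
  (conv L k F xi - conv L k' F xi)%C = conv L (fun eta => (k eta - k' eta)%C) F xi.
Proof.
  intros Hk Hk' HF. unfold conv.
  rewrite (CInt_ext (fun eta => ((k eta - k' eta) * F (xi - eta)%R)%C)
    (fun eta => (k eta * F (xi - eta)%R - k' eta * F (xi - eta)%R)%C)) by (intros; ring).
  rewrite CInt_minus by auto with cont. ring.
Qed.

Lemma conv_minus_r (L : R) (k F F' : R -> C) (xi : R) :
  Ccontinuous k -> Ccontinuous F -> Ccontinuous F' ->
  (conv L k F xi - conv L k F' xi)%C = conv L k (fun eta => (F eta - F' eta)%C) xi.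
Proof.
  intros Hk HF HF'. unfold conv.
  rewrite (CInt_ext (fun eta => (k eta * (F (xi - eta)%R - F' (xi - eta)%R))%C)
    (fun eta => (k eta * F (xi - eta)%R - k eta * F' (xi - eta)%R)%C)) by (intros; ring).
  rewrite CInt_minus by auto with cont. ring.
Qed.

Lemma iFT_compact_support (L : R) (k f : R -> C) :
  0 <= L -> Ccontinuous k -> (forall eta, L <= Rabs eta -> k eta = RtoC 0) -> iFT k f ->
  forall x, f x = CInt (fkernel x k) (- L) L.
Proof.
  intros HL Hk Hs Hf x. apply (Iint_unique (fkernel x k)); [apply Hf|].
  intros eps He. exists L; intros u v Hu Hv.
  rewrite <- (CInt_Chasles _ u (- L) v), <- (CInt_Chasles _ (- L) L v) by auto with cont.
  rewrite (CInt_zero _ u (- L)), (CInt_zero _ L v); try lra.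
  - replace (_ - _)%C with (RtoC 0) by ring. rewrite Cmod_0; exact He.
  - intros y Hy; unfold fkernel; rewrite Hs; [ring|]. rewrite Rabs_pos_eq; lra.
  - intros y Hy; unfold fkernel; rewrite Hs; [ring|]. rewrite Rabs_left1; lra.
Qed.

(** The character splits as exp(i x eta) exp(i x (xi - eta)), and the factors 1/(2 pi) of [conv] and
    of [fkernel] are shared between the two kernels. *)
Lemma fkernel_conv (L x xi : R) (k F : R -> C) :
  Ccontinuous k -> Ccontinuous F ->
  fkernel x (conv L k F) xi = CInt (fun eta => (fkernel x k eta * fkernel x F (xi - eta)%R)%C) (- L) L.
Proof.
  intros Hk HF. unfold fkernel, conv.
  rewrite (CInt_ext (fun eta => (_ * (k eta * _) * _)%C)
    (fun eta => ((RtoC (/ (2 * PI)) * RtoC (/ (2 * PI)) * Cexpi (x * xi)) * (k eta * F (xi - eta)%R))%C)).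
  - rewrite CInt_mult_l by auto with cont. ring.
  - intros eta. replace (x * xi) with (x * eta + x * (xi - eta)) by ring. rewrite Cexpi_plus. ring.
Qed.

(** By Fubini on [u, v] x [-L, L], the integral for the convolution over [u, v] is a combination,
    weighted by the kernel of [k], of integrals for [F] over the shifted intervals
    [u - eta, v - eta] with |eta| <= L. All of these are close to [g x] once [u, v] is large,
    whatever the decay of [F]. *)
Lemma iFT_conv (L A : R) (k F f g : R -> C) :
  0 <= L -> Ccontinuous k -> (forall eta, Cmod (k eta) <= A) ->
  (forall eta, L <= Rabs eta -> k eta = RtoC 0) -> Ccontinuous F ->
  iFT k f -> iFT F g -> iFT (conv L k F) (fun x => (f x * g x)%C).
Proof.
  intros HL Hk HA Hs HF Hf Hg x.
  assert (HA0 : 0 <= A) by (eapply Rle_trans; [apply Cmod_ge_0|apply (HA 0)]).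
  rewrite (iFT_compact_support L k f HL Hk Hs Hf x).
  intros eps He.
  set (B := 2 * L * (/ (2 * PI) * A)).
  assert (HB : 0 <= B) by (generalize inv_2PI_pos; intros; unfold B; apply Rmult_le_pos; nra).
  destruct (Hg x (eps / (B + 1))) as [M HM]; [apply Rdiv_lt_0_compat; lra|].
  (* A shift by eta with |eta| <= L still leaves the endpoints beyond -M and M. *)
  exists (M + L); intros u v Hu Hv.
  assert (Hc2 : Ccontinuous2 (fun xi eta => (fkernel x k eta * fkernel x F (xi - eta)%R)%C)).
  { apply Ccontinuous2_mult; [apply Ccontinuous2_snd; auto with cont|].
    apply Ccontinuous2_comp; auto with cont. }
  assert (E : CInt (fkernel x (conv L k F)) u v
              = CInt (fun eta => (fkernel x k eta * CInt (fun xi => fkernel x F (xi - eta)%R) u v)%C) (- L) L).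
  { rewrite (CInt_ext _ (fun xi => CInt (fun eta => (fkernel x k eta * fkernel x F (xi - eta)%R)%C) (- L) L))
      by (intros; apply fkernel_conv; trivial).
    rewrite (CInt_Fubini (fun xi eta => (fkernel x k eta * fkernel x F (xi - eta)%R)%C)) by exact Hc2.
    apply CInt_ext; intros eta. apply CInt_mult_l.
    apply (Ccontinuous_comp (fkernel x F) (fun xi => xi - eta)); auto with cont. }
  rewrite E.
  assert (Hci : Ccontinuous (fun eta => CInt (fun xi => fkernel x F (xi - eta)%R) u v)).
  { apply (Ccontinuous_CInt_param (fun eta xi => fkernel x F (xi - eta)%R)).
    apply (Ccontinuous2_comp (fkernel x F) (fun eta xi => xi - eta)); auto with cont. }
  rewrite <- CInt_mult_r, <- CInt_minus by auto with cont.
  eapply Rle_lt_trans.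
  - apply Cmod_CInt_le_const with (M := / (2 * PI) * A * (eps / (B + 1))); [lra|auto with cont|].
    intros eta Heta.
    replace (_ - _)%C with (fkernel x k eta * (CInt (fun xi => fkernel x F (xi - eta)%R) u v - g x))%C by ring.
    rewrite Cmod_mult, Cmod_fkernel. apply Rmult_le_compat; try apply Cmod_ge_0.
    + apply Rmult_le_pos; [left; apply inv_2PI_pos|apply Cmod_ge_0].
    + apply Rmult_le_compat_l; [left; apply inv_2PI_pos|apply HA].
    + left. rewrite CInt_shift by auto with cont. apply HM; lra.
  - replace (_ * _) with (eps / (B + 1) * B) by (unfold B; ring).
    assert (Ee : eps / (B + 1) * (B + 1) = eps) by (field; lra).
    assert (0 < eps / (B + 1)) by (apply Rdiv_lt_0_compat; lra). lra.
Qed.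

(** * Limits of geometrically convergent sequences *)

(** Total by convention: [Lim_seq] always returns a value, and [real] sends infinite ones to 0. It
    is the limit whenever the sequence converges. *)
Definition Clim (s : nat -> C) : C :=
  (real (Lim_seq (fun n => fst (s n))), real (Lim_seq (fun n => snd (s n)))).

(** The factor [1 - (/ 2) ^ m] comes from the exact geometric sum and lets the induction on [m]
    close. *)
Lemma geometric_cauchy (s : nat -> C) (c : R) :
  0 <= c -> (forall n, Cmod (s (S n) - s n) <= c * (/ 2) ^ n) ->
  forall n m, Cmod (s (n + m)%nat - s n) <= 2 * c * (/ 2) ^ n * (1 - (/ 2) ^ m).
Proof.
  intros Hc H n m. induction m as [|m IH].
  - rewrite Nat.add_0_r. replace (s n - s n)%C with (RtoC 0) by ring. rewrite Cmod_0. simpl; lra.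
  - eapply Rle_trans; [apply (Cmod_minus_triangle _ (s (n + m)%nat))|].
    rewrite Nat.add_succ_r. specialize (H (n + m)%nat). rewrite pow_add in H.
    rewrite <- tech_pow_Rmult. nra.
Qed.

Lemma pow_half_small (eps c : R) :
  0 < eps -> 0 <= c -> exists N, forall n, (N <= n)%nat -> c * (/ 2) ^ n <= eps.
Proof.
  intros He Hc.
  destruct (pow_lt_1_zero (/ 2) ltac:(rewrite Rabs_pos_eq; lra) (eps / (c + 1))) as [N HN].
  { apply Rdiv_lt_0_compat; lra. }
  exists N; intros n Hn. specialize (HN n Hn).
  rewrite Rabs_pos_eq in HN by (apply pow_le; lra).
  assert (E : eps / (c + 1) * (c + 1) = eps) by (field; lra).
  assert (0 <= (/ 2) ^ n) by (apply pow_le; lra). nra.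
Qed.

Lemma geometric_limit (s : nat -> C) (c : R) :
  0 <= c -> (forall n, Cmod (s (S n) - s n) <= c * (/ 2) ^ n) ->
  forall n, Cmod (Clim s - s n) <= 2 * c * (/ 2) ^ n.
Proof.
  intros Hc H.
  assert (Hcau : forall n m, Cmod (s (n + m)%nat - s n) <= 2 * c * (/ 2) ^ n).
  { intros n m. eapply Rle_trans; [apply (geometric_cauchy s c Hc H)|].
    assert (0 <= (/ 2) ^ n) by (apply pow_le; lra).
    assert (0 <= (/ 2) ^ m) by (apply pow_le; lra).
    assert (0 <= 2 * c * (/ 2) ^ n) by (apply Rmult_le_pos; lra). nra. }
  assert (Hlim : forall pr : C -> R, (forall z w, Rabs (pr z - pr w) <= Cmod (z - w)) ->
    is_lim_seq (fun n => pr (s n)) (Finite (real (Lim_seq (fun n => pr (s n)))))).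
  { intros pr Hpr. apply Lim_seq_correct', ex_lim_seq_cauchy_corr. intros eps.
    destruct (pow_half_small (eps / 4) (2 * c)) as [N HN]; [generalize (cond_pos eps); lra|lra|].
    exists N; intros n m Hn Hm.
    specialize (HN N (le_n N)).
    assert (B : forall k, (N <= k)%nat -> Rabs (pr (s k) - pr (s N)) <= eps / 4).
    { intros k Hk. eapply Rle_trans; [apply Hpr|].
      replace k with (N + (k - N))%nat by lia. eapply Rle_trans; [apply Hcau|exact HN]. }
    generalize (B n Hn) (B m Hm) (cond_pos eps); intros B1 B2 He.
    apply Rabs_le_between in B1. apply Rabs_le_between in B2. apply Rabs_def1; lra. }
  assert (H1 := Hlim fst (fun z w => Cmod_fst (z - w)%C)).
  assert (H2 := Hlim snd (fun z w => Cmod_snd (z - w)%C)).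
  intros n. apply le_epsilon; intros eps He.
  apply is_lim_seq_spec in H1. apply is_lim_seq_spec in H2.
  destruct (H1 (mkposreal (eps / 2) ltac:(lra))) as [N1 HN1].
  destruct (H2 (mkposreal (eps / 2) ltac:(lra))) as [N2 HN2]. simpl in HN1, HN2.
  set (m := (N1 + N2)%nat).
  specialize (HN1 (n + m)%nat ltac:(lia)). specialize (HN2 (n + m)%nat ltac:(lia)).
  eapply Rle_trans; [apply (Cmod_minus_triangle _ (s (n + m)%nat))|].
  rewrite Rplus_comm. apply Rplus_le_compat; [apply Hcau|].
  rewrite Cmod_minus_sym. eapply Rle_trans; [apply Cmod_le_sum|].
  unfold Clim; simpl. unfold Rminus in HN1, HN2. lra.
Qed.

Lemma Ccontinuous_uniform_limit (F : R -> C) :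
  (forall eps, 0 < eps -> exists G, Ccontinuous G /\ forall x, Cmod (F x - G x) <= eps) ->
  Ccontinuous F.
Proof.
  intros H.
  assert (K : forall pr : C -> R, (forall z w, Rabs (pr z - pr w) <= Cmod (z - w)) ->
    (forall G, Ccontinuous G -> continuity (fun x => pr (G x))) -> continuity (fun x => pr (F x))).
  { intros pr Hpr Hc x eps He. destruct (H (eps / 4) ltac:(lra)) as [G [HG HFG]].
    destruct (Hc G HG x (eps / 4) ltac:(lra)) as [d [Hd Hy]].
    exists d; split; [exact Hd|]. intros y Hyd. specialize (Hy y Hyd).
    simpl in *. unfold Rdist in *.
    generalize (Rle_trans _ _ _ (Hpr (F x) (G x)) (HFG x)) (Rle_trans _ _ _ (Hpr (F y) (G y)) (HFG y)).
    intros B1 B2. apply Rabs_le_between in B1. apply Rabs_le_between in B2.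
    apply Rabs_def2 in Hy. apply Rabs_def1; lra. }
  split.
  - apply (K fst (fun z w => Cmod_fst (z - w)%C)). intros G HG; apply HG.
  - apply (K snd (fun z w => Cmod_snd (z - w)%C)). intros G HG; apply HG.
Qed.

(** * The complex exponential and its power series *)

Lemma CInt_derivative (f g : R -> C) (u v : R) :
  (forall x, Cderiv f x (g x)) -> Ccontinuous g -> CInt g u v = (f v - f u)%C.
Proof.
  intros H [G1 G2]. apply C_eq; simpl; apply is_RInt_unique.
  - apply (is_RInt_derive (V := R_CompleteNormedModule) (fun x => fst (f x))).
    + intros x _; apply is_derive_Reals, H.
    + intros x _; apply continuity_pt_filterlim, G1.
  - apply (is_RInt_derive (V := R_CompleteNormedModule) (fun x => snd (f x))).
    + intros x _; apply is_derive_Reals, H.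
    + intros x _; apply continuity_pt_filterlim, G2.
Qed.

Lemma Cderiv_plus (f g : R -> C) (x : R) (l m : C) :
  Cderiv f x l -> Cderiv g x m -> Cderiv (fun t => (f t + g t)%C) x (l + m)%C.
Proof. intros [F1 F2] [G1 G2]; split; apply derivable_pt_lim_plus; trivial. Qed.

Lemma Cderiv_minus (f g : R -> C) (x : R) (l m : C) :
  Cderiv f x l -> Cderiv g x m -> Cderiv (fun t => (f t - g t)%C) x (l - m)%C.
Proof. intros [F1 F2] [G1 G2]; split; apply derivable_pt_lim_minus; trivial. Qed.

Lemma Cderiv_scal (h : R -> R) (w : C) (x l : R) :
  is_derive h x l -> Cderiv (fun t => (RtoC (h t) * w)%C) x (RtoC l * w)%C.
Proof.
  intros H; split; apply is_derive_Reals; simpl.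
  - replace (l * fst w - 0 * snd w) with (fst w * l) by ring.
    apply is_derive_ext with (fun t => fst w * h t); [intros; simpl; ring|].
    apply (is_derive_scal h x (fst w) l H).
  - replace (l * snd w + 0 * fst w) with (snd w * l) by ring.
    apply is_derive_ext with (fun t => snd w * h t); [intros; simpl; ring|].
    apply (is_derive_scal h x (snd w) l H).
Qed.

Lemma Cderiv_Cexp (z : C) (t : R) :
  Cderiv (fun s => Cexp (RtoC s * z)%C) t (z * Cexp (RtoC t * z)%C)%C.
Proof. split; apply is_derive_Reals; simpl; auto_derive; trivial; unfold Rminus; ring. Qed.

(** The first [N] terms of the series of exp(t z), kept as a function of a real [t] so that the
    remainder can be estimated by integration in [t]. *)
Fixpoint exp_taylor (z : C) (N : nat) (t : R) : C :=
  match N with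
  | O => RtoC 0
  | S n => (exp_taylor z n t + RtoC (t ^ n / INR (fact n)) * z ^ n)%C
  end.

Lemma is_derive_pow_div_fact (n : nat) (t : R) :
  is_derive (fun s => s ^ S n / INR (fact (S n))) t (t ^ n / INR (fact n)).
Proof.
  assert (Hf := INR_fact_neq_0 n). assert (Hn := not_0_INR (S n) ltac:(lia)).
  replace (t ^ n / INR (fact n)) with (INR (S n) * t ^ n / INR (fact (S n))).
  - auto_derive; trivial.
    change (1 * (INR (S n) * t ^ n) * / INR (fact (S n)) = INR (S n) * t ^ n / INR (fact (S n))).
    unfold Rdiv; ring.
  - rewrite fact_simpl, mult_INR. field; auto.
Qed.

Lemma Cderiv_exp_taylor (z : C) (N : nat) (t : R) :
  Cderiv (exp_taylor z (S N)) t (z * exp_taylor z N t)%C.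
Proof.
  induction N as [|n IH].
  - simpl.
    replace (z * 0)%C with (RtoC 0 + RtoC 0 * z ^ 0)%C by (simpl; ring).
    apply Cderiv_plus.
    + split; apply derivable_pt_lim_const.
    + apply (Cderiv_scal (fun _ => 1 / 1)). apply @is_derive_const.
  - replace (z * exp_taylor z (S n) t)%C
      with (z * exp_taylor z n t + RtoC (t ^ n / INR (fact n)) * z ^ (S n))%C by (simpl; ring).
    apply Cderiv_plus; [exact IH|].
    apply (Cderiv_scal (fun s => s ^ S n / INR (fact (S n)))). apply is_derive_pow_div_fact.
Qed.

Lemma Cmod_Cexp_le (z : C) : Cmod (Cexp z) <= exp (Cmod z).
Proof.
  replace (Cexp z) with (RtoC (exp (fst z)) * Cexpi (snd z))%C by (apply C_eq; simpl; ring).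
  rewrite Cmod_scal, Cmod_Cexpi, Rmult_1_r by (left; apply exp_pos).
  apply exp_mono. eapply Rle_trans; [apply Rle_abs|apply Cmod_fst].
Qed.

(** The remainder with [S N] terms vanishes at t = 0 and has as derivative z times the remainder
    with [N] terms. Integrating the inductive bound over [0, t] raises the power of t and completes
    the factorial. *)
Lemma exp_taylor_bound (z : C) (N : nat) (t : R) :
  0 <= t <= 1 ->
  Cmod (Cexp (RtoC t * z)%C - exp_taylor z N t) <= exp (Cmod z) * Cmod z ^ N * (t ^ N / INR (fact N)).
Proof.
  revert t; induction N as [|N IH]; intros t Ht.
  - simpl. replace (Cexp (RtoC t * z)%C - 0)%C with (Cexp (RtoC t * z)%C) by cring.
    eapply Rle_trans; [apply Cmod_Cexp_le|].
    replace (exp (Cmod z) * 1 * (1 / 1)) with (exp (Cmod z)) by field.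
    apply exp_mono. rewrite Cmod_scal by lra. generalize (Cmod_ge_0 z). nra.
  - assert (HD : forall s, Cderiv (fun s => Cexp (RtoC s * z)%C - exp_taylor z (S N) s)%C s
      (z * (Cexp (RtoC s * z)%C - exp_taylor z N s))%C).
    { intros s.
      replace (z * (Cexp (RtoC s * z)%C - exp_taylor z N s))%C
        with (z * Cexp (RtoC s * z)%C - z * exp_taylor z N s)%C by cring.
      apply Cderiv_minus; [apply Cderiv_Cexp|apply Cderiv_exp_taylor]. }
    assert (Hc : Ccontinuous (fun s => z * (Cexp (RtoC s * z)%C - exp_taylor z N s))%C).
    { apply Ccontinuous_mult; [auto with cont|]. apply Ccontinuous_minus.
      - exact (Cderiv_continuous _ _ (Cderiv_Cexp z)).
      (* Continuity is read off the derivative, which is known for sums with at least one term; the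
         empty sum is constant. *)
      - destruct N; [apply Ccontinuous_const|exact (Cderiv_continuous _ _ (Cderiv_exp_taylor z N))]. }
    assert (E0 : (Cexp (RtoC 0 * z)%C - exp_taylor z (S N) 0)%C = RtoC 0).
    { assert (ET : forall n, exp_taylor z (S n) 0 = RtoC 1).
      { induction n as [|n IHn]; [apply C_eq; simpl; field|].
        replace (exp_taylor z (S (S n)) 0)
          with (exp_taylor z (S n) 0 + RtoC (0 ^ S n / INR (fact (S n))) * z ^ S n)%C by reflexivity.
        rewrite IHn, pow_i by lia. unfold Rdiv; rewrite Rmult_0_l. ring. }
      rewrite ET. apply C_eq; simpl; rewrite !Rmult_0_l, ?Rminus_0_r, ?Rplus_0_r, exp_0, ?cos_0, ?sin_0; ring. }
    assert (E := CInt_derivative _ _ 0 t HD Hc). cbv beta in E. rewrite E0 in E.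
    replace (Cexp (RtoC t * z)%C - exp_taylor z (S N) t)%C
      with (Cexp (RtoC t * z)%C - exp_taylor z (S N) t - 0)%C by cring.
    rewrite <- E.
    assert (ER : is_RInt (fun s => exp (Cmod z) * Cmod z ^ S N * (s ^ N / INR (fact N))) 0 t
       (exp (Cmod z) * Cmod z ^ S N * (t ^ S N / INR (fact (S N))))).
    { replace (exp (Cmod z) * Cmod z ^ S N * (t ^ S N / INR (fact (S N)))) with
        (minus (exp (Cmod z) * Cmod z ^ S N * (t ^ S N / INR (fact (S N))))
               (exp (Cmod z) * Cmod z ^ S N * (0 ^ S N / INR (fact (S N))))).
      2:{ rewrite (pow_i (S N)) by lia. unfold minus, plus, opp; simpl. field. exact (INR_fact_neq_0 (S N)). }
      apply (is_RInt_derive (V := R_CompleteNormedModule)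
        (fun s => exp (Cmod z) * Cmod z ^ S N * (s ^ S N / INR (fact (S N))))).
      - intros s _. apply (is_derive_scal (fun s => s ^ S N / INR (fact (S N)))), is_derive_pow_div_fact.
      - intros s _. apply continuity_pt_filterlim. unfold Rdiv.
        apply continuity_Rmult; [auto with cont|]. auto with cont. }
    rewrite <- (is_RInt_unique _ _ _ _ ER).
    apply Cmod_CInt_le; [lra|exact Hc|unfold Rdiv; auto 6 with cont|].
    intros s Hs. rewrite Cmod_mult. specialize (IH s ltac:(lra)).
    rewrite <- tech_pow_Rmult. generalize (Cmod_ge_0 z). intros Hz. nra.
Qed.

(** The terms start in degree 2, so these are the partial sums of exp z - 1 - z. *)
Fixpoint exp_tail_sum (z : C) (N : nat) : C :=
  match N with
  | O => RtoC 0
  | S n => (exp_tail_sum z n + RtoC (/ INR (fact (S (S n)))) * z ^ (S (S n)))%C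
  end.

Lemma exp_tail_sum_taylor (z : C) (N : nat) :
  exp_taylor z (S (S N)) 1 = (RtoC 1 + z + exp_tail_sum z N)%C.
Proof.
  induction N as [|N IH].
  - apply C_eq; simpl; field.
  - replace (exp_taylor z (S (S (S N))) 1)
      with (exp_taylor z (S (S N)) 1 + RtoC (1 ^ S (S N) / INR (fact (S (S N)))) * z ^ S (S N))%C
      by reflexivity.
    rewrite IH, pow1. unfold Rdiv; rewrite Rmult_1_l. cbn [exp_tail_sum]. ring.
Qed.

Lemma exp_tail_sum_converges (z : C) (eps : R) :
  0 < eps -> exists N, forall n, (N <= n)%nat ->
    Cmod (exp_tail_sum z n - (Cexp z - RtoC 1 - z)) <= eps.
Proof.
  intros He. assert (Hp := exp_pos (Cmod z)).
  destruct (cv_speed_pow_fact (Cmod z) (eps / exp (Cmod z))) as [N HN].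
  { apply Rdiv_lt_0_compat; trivial. }
  exists N; intros n Hn. rewrite Cmod_minus_sym.
  assert (B := exp_taylor_bound z (S (S n)) 1 ltac:(lra)).
  rewrite exp_tail_sum_taylor, pow1 in B.
  replace (RtoC 1 * z)%C with z in B by cring.
  replace (Cexp z - RtoC 1 - z - exp_tail_sum z n)%C
    with (Cexp z - (RtoC 1 + z + exp_tail_sum z n))%C by cring.
  eapply Rle_trans; [exact B|].
  specialize (HN (S (S n)) ltac:(lia)). unfold Rdist in HN. rewrite Rminus_0_r in HN.
  assert (B2 := Rle_lt_trans _ _ _ (Rle_abs _) HN).
  replace (exp (Cmod z) * Cmod z ^ S (S n) * (1 / INR (fact (S (S n)))))
    with (exp (Cmod z) * (Cmod z ^ S (S n) / INR (fact (S (S n))))) by (field; apply INR_fact_neq_0).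
  apply Rle_trans with (exp (Cmod z) * (eps / exp (Cmod z))).
  - apply Rmult_le_compat_l; lra.
  - right; field; lra.
Qed.

(** * The convolution exponential *)

(** Index [n] means n + 1 factors: the unit of convolution is a point mass and not a function, so
    the powers start at [k] itself. *)
Fixpoint conv_pow (L : R) (k : R -> C) (n : nat) : R -> C :=
  match n with
  | O => k
  | S m => conv L k (conv_pow L k m)
  end.

Fixpoint conv_exp_sum (L : R) (k : R -> C) (N : nat) (xi : R) : C :=
  match N with
  | O => RtoC 0
  | S n => (conv_exp_sum L k n xi + RtoC (/ INR (fact (S (S n)))) * conv_pow L k (S n) xi)%C
  end.

(* Fourier counterpart of [exp f - 1 - f], where [k] is the transform of [f]. *)
Definition conv_exp (L : R) (k : R -> C) (xi : R) : C := Clim (fun N => conv_exp_sum L k N xi).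

(** The first bound controls the size of the series terms. The second absorbs the factor n + 2 that
    arises when a power with n + 2 factors is varied. *)
Lemma inv_fact_le (n : nat) : / INR (fact (S (S n))) <= / 2 /\ INR (S (S n)) * / INR (fact (S (S n))) <= 1.
Proof.
  assert (H1 : 1 <= INR (fact (S n))).
  { apply (le_INR 1). generalize (lt_O_fact (S n)); lia. }
  assert (H2 : 2 <= INR (S (S n))) by (apply (le_INR 2); lia).
  rewrite fact_simpl, mult_INR. split.
  - apply Rinv_le_contravar; nra.
  - rewrite Rinv_mult, <- Rmult_assoc, Rinv_r, Rmult_1_l by lra.
    rewrite <- Rinv_1. apply Rinv_le_contravar; lra.
Qed.

Section ConvExp.

Variables (a L A : R).
Hypotheses (Ha : 0 < a) (HL : 0 <= L).
(** Convolution with a function of decay constant [A] multiplies decay constants by [q]. The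
    condition [q <= / 2] gives the series the ratio required by [geometric_limit]. *)
Let q := A * (L / PI).
Hypothesis Hq : q <= / 2.

Lemma L_div_PI_nonneg : 0 <= L / PI.
Proof. apply Rdiv_le_0_compat; [exact HL|apply PI_RGT_0]. Qed.

Lemma conv_pow_decay (k : R -> C) (n : nat) :
  decay a A k -> decay a (A * q ^ n) (conv_pow L k n).
Proof.
  intros Hk. induction n as [|n IH]; [simpl; rewrite Rmult_1_r; exact Hk|].
  replace (A * q ^ S n) with (A * (A * q ^ n) * (L / PI)) by (unfold q; simpl; ring).
  apply conv_decay; trivial; lra.
Qed.

Lemma q_nonneg (k : R -> C) : decay a A k -> 0 <= q.
Proof.
  intros Hk. apply Rmult_le_pos; [eapply decay_nonneg; eauto|apply L_div_PI_nonneg].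
Qed.

Lemma pow_q_le (k : R -> C) (n : nat) : decay a A k -> 0 <= q ^ S n <= q * (/ 2) ^ n.
Proof.
  intros Hk. assert (H := q_nonneg k Hk). split; [apply pow_le, H|]. simpl.
  apply Rmult_le_compat_l; [exact H|]. apply pow_incr; lra.
Qed.

Lemma Ccontinuous_conv_exp_sum (k : R -> C) (N : nat) :
  decay a A k -> Ccontinuous (conv_exp_sum L k N).
Proof.
  intros Hk. induction N as [|n IH]; cbn [conv_exp_sum]; [apply Ccontinuous_const|].
  apply Ccontinuous_plus; [exact IH|]. apply Ccontinuous_mult; [auto with cont|].
  apply (conv_pow_decay k (S n) Hk).
Qed.

Lemma conv_exp_sum_step (k : R -> C) (N : nat) (xi : R) :
  decay a A k ->
  Cmod (conv_exp_sum L k (S N) xi - conv_exp_sum L k N xi) <= A * q / 2 * weight a xi * (/ 2) ^ N.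
Proof.
  intros Hk. cbn [conv_exp_sum].
  replace (_ - _)%C with (RtoC (/ INR (fact (S (S N)))) * conv_pow L k (S N) xi)%C by ring.
  assert (HA := decay_nonneg _ _ _ Hk).
  destruct (inv_fact_le N) as [H1 _].
  assert (H0 : 0 < / INR (fact (S (S N)))) by (apply Rinv_0_lt_compat, INR_fact_lt_0).
  rewrite Cmod_scal by lra.
  destruct (conv_pow_decay k (S N) Hk) as [_ B]. specialize (B xi).
  assert (W := weight_pos a xi). assert (Q := pow_q_le k N Hk).
  apply Rle_trans with (/ 2 * (A * (q * (/ 2) ^ N) * weight a xi)).
  - apply Rmult_le_compat; [lra|apply Cmod_ge_0|exact H1|].
    eapply Rle_trans; [exact B|]. apply Rmult_le_compat_r; [lra|].
    apply Rmult_le_compat_l; lra.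
  - right; field.
Qed.

Lemma conv_exp_approx (k : R -> C) (N : nat) (xi : R) :
  decay a A k ->
  Cmod (conv_exp L k xi - conv_exp_sum L k N xi) <= A * q * weight a xi * (/ 2) ^ N.
Proof.
  intros Hk. eapply Rle_trans.
  - apply (geometric_limit (fun N => conv_exp_sum L k N xi)).
    2:{ intros n; apply conv_exp_sum_step, Hk. }
    assert (HA := decay_nonneg _ _ _ Hk). assert (H := q_nonneg k Hk). assert (W := weight_pos a xi).
    apply Rmult_le_pos; [|lra]. apply Rmult_le_pos; [|lra]. apply Rmult_le_pos; lra.
  - right; field.
Qed.

Lemma conv_exp_approx_eventually (k : R -> C) (eps : R) :
  0 < eps -> decay a A k -> exists N, forall n, (N <= n)%nat ->
  forall xi, Cmod (conv_exp L k xi - conv_exp_sum L k n xi) <= eps * weight a xi.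
Proof.
  intros He Hk. assert (HA := decay_nonneg _ _ _ Hk). assert (H := q_nonneg k Hk).
  destruct (pow_half_small eps (A * q) He) as [N HN]; [apply Rmult_le_pos; lra|].
  exists N; intros n Hn xi. eapply Rle_trans; [apply conv_exp_approx, Hk|].
  specialize (HN n Hn). generalize (weight_pos a xi). nra.
Qed.

(** The bound is the case N = 0 of [conv_exp_approx], where the partial sum is empty. The factor [q]
    reflects that the series starts in degree two; together with the smallness of [A] it later makes
    up for the coefficient 4 lam^2. *)
Lemma conv_exp_decay (k : R -> C) : decay a A k -> decay a (A * q) (conv_exp L k).
Proof.
  intros Hk. split.
  - apply Ccontinuous_uniform_limit. intros eps He.
    destruct (conv_exp_approx_eventually k eps He Hk) as [N HN].
    exists (conv_exp_sum L k N); split; [apply Ccontinuous_conv_exp_sum, Hk|].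
    intros x. eapply Rle_trans; [apply HN; lia|].
    generalize (weight_le_1 a x ltac:(lra)). nra.
  - intros xi. generalize (conv_exp_approx k 0 xi Hk). simpl.
    replace (conv_exp L k xi - 0)%C with (conv_exp L k xi) by ring. lra.
Qed.

Lemma iFT_conv_pow (k f : R -> C) (n : nat) :
  decay a A k -> (forall eta, L <= Rabs eta -> k eta = RtoC 0) -> iFT k f ->
  iFT (conv_pow L k n) (fun x => (f x ^ S n)%C).
Proof.
  intros Hk Hs Hf. induction n as [|n IH].
  - apply (iFT_ext k k f); trivial. intros x; simpl; ring.
  - cbn [conv_pow]. apply (iFT_ext (conv L k (conv_pow L k n)) _ (fun x => (f x * f x ^ S n)%C)); trivial.
    apply (iFT_conv L A); trivial.
    + apply Hk.
    + intros eta. apply (decay_bounded a); trivial; lra.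
    + apply (conv_pow_decay k n Hk).
Qed.

Lemma iFT_conv_exp_sum (k f : R -> C) (N : nat) :
  decay a A k -> (forall eta, L <= Rabs eta -> k eta = RtoC 0) -> iFT k f ->
  iFT (conv_exp_sum L k N) (fun x => exp_tail_sum (f x) N).
Proof.
  intros Hk Hs Hf. induction N as [|n IH]; [apply iFT_zero|].
  cbn [conv_exp_sum exp_tail_sum].
  assert (HC := conv_pow_decay k (S n) Hk).
  apply iFT_plus; [apply Ccontinuous_conv_exp_sum, Hk| |exact IH|].
  - apply Ccontinuous_mult; [auto with cont|apply HC].
  - apply (iFT_mult_l _ (conv_pow L k (S n)) (fun x => (f x ^ S (S n))%C)); [apply HC|].
    apply iFT_conv_pow; trivial.
Qed.

(** Partial sums converge uniformly relative to the weight on the Fourier side and pointwise on the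
    other, which is what [iFT_closed] asks for; the index [N1 + N2] serves both. *)
Lemma iFT_conv_exp (k f : R -> C) :
  decay a A k -> (forall eta, L <= Rabs eta -> k eta = RtoC 0) -> iFT k f ->
  iFT (conv_exp L k) (fun x => (Cexp (f x) - RtoC 1 - f x)%C).
Proof.
  intros Hk Hs Hf. apply (iFT_closed a); [exact Ha|apply conv_exp_decay, Hk|].
  intros x eps He.
  destruct (conv_exp_approx_eventually k eps He Hk) as [N1 HN1].
  destruct (exp_tail_sum_converges (f x) eps He) as [N2 HN2].
  exists (conv_exp_sum L k (N1 + N2)), (fun x => exp_tail_sum (f x) (N1 + N2)).
  split; [apply Ccontinuous_conv_exp_sum, Hk|].
  split; [apply iFT_conv_exp_sum; trivial|].
  split; [intros xi; apply HN1; lia|apply HN2; lia].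
Qed.

Variables (k k' : R -> C) (delta : R).
Hypotheses (Hk : decay a A k) (Hk' : decay a A k')
  (Hkk : decay a delta (fun xi => (k xi - k' xi)%C)).

(** Write P and P' for the powers of [k] and [k'] at index n. The difference at the next index is
    the convolution of k - k' with P plus that of k' with P - P'. The first costs [delta * q ^ S n],
    the second, by induction, n + 1 times as much. *)
Lemma conv_pow_lipschitz (n : nat) :
  decay a (INR (S n) * delta * q ^ n) (fun xi => (conv_pow L k n xi - conv_pow L k' n xi)%C).
Proof.
  induction n as [|n IH].
  - simpl conv_pow. replace (INR 1 * delta * q ^ 0) with delta by (simpl; ring). exact Hkk.
  - assert (HC := conv_pow_decay k n Hk). assert (HC' := conv_pow_decay k' n Hk').
    assert (D1 := conv_decay L a delta (A * q ^ n) _ _ HL ltac:(lra) Hkk HC).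
    assert (D2 := conv_decay L a A _ _ _ HL ltac:(lra) Hk' IH).
    destruct D1 as [D1 B1]. destruct D2 as [D2 B2].
    split.
    + apply Ccontinuous_minus; [apply (conv_pow_decay k (S n) Hk)|apply (conv_pow_decay k' (S n) Hk')].
    + intros xi. cbn [conv_pow].
      replace (conv L k (conv_pow L k n) xi - conv L k' (conv_pow L k' n) xi)%C with
        ((conv L k (conv_pow L k n) xi - conv L k' (conv_pow L k n) xi) +
         (conv L k' (conv_pow L k n) xi - conv L k' (conv_pow L k' n) xi))%C by ring.
      rewrite conv_minus_l, conv_minus_r by (apply Hk || apply Hk' || apply HC || apply HC').
      eapply Rle_trans; [apply Cmod_triangle|].
      specialize (B1 xi). specialize (B2 xi). rewrite (S_INR (S n)).
      replace ((INR (S n) + 1) * delta * q ^ S n * weight a xi)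
        with (delta * (A * q ^ n) * (L / PI) * weight a xi
              + A * (INR (S n) * delta * q ^ n) * (L / PI) * weight a xi)
        by (unfold q; simpl; ring).
      lra.
Qed.

(** The factor n + 2 from [conv_pow_lipschitz] is cancelled by the factorial. What is left is
    dominated by a geometric series of ratio 1/2, with [1 - (/ 2) ^ N] from its exact partial
    sum. *)
Lemma conv_exp_sum_lipschitz (N : nat) (xi : R) :
  Cmod (conv_exp_sum L k N xi - conv_exp_sum L k' N xi)
  <= 2 * delta * q * (1 - (/ 2) ^ N) * weight a xi.
Proof.
  assert (Hd := decay_nonneg _ _ _ Hkk). assert (Hq0 := q_nonneg k Hk). assert (W := weight_pos a xi).
  induction N as [|n IH].
  - simpl. replace (0 - 0)%C with (RtoC 0) by ring. rewrite Cmod_0. lra.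
  - cbn [conv_exp_sum].
    replace (_ - _)%C with ((conv_exp_sum L k n xi - conv_exp_sum L k' n xi)
      + RtoC (/ INR (fact (S (S n)))) * (conv_pow L k (S n) xi - conv_pow L k' (S n) xi))%C by ring.
    eapply Rle_trans; [apply Cmod_triangle|].
    destruct (conv_pow_lipschitz (S n)) as [_ B]. specialize (B xi).
    destruct (inv_fact_le n) as [_ H1].
    assert (H0 : 0 < / INR (fact (S (S n)))) by (apply Rinv_0_lt_compat, INR_fact_lt_0).
    rewrite Cmod_scal by lra.
    assert (Q := pow_q_le k n Hk).
    assert (B' : / INR (fact (S (S n))) * Cmod (conv_pow L k (S n) xi - conv_pow L k' (S n) xi)
                 <= delta * (q * (/ 2) ^ n) * weight a xi).
    { apply Rle_trans with (/ INR (fact (S (S n))) * (INR (S (S n)) * delta * q ^ S n * weight a xi)).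
      - apply Rmult_le_compat_l; lra.
      - replace (_ * (_ * _ * _ * _))
          with ((INR (S (S n)) * / INR (fact (S (S n)))) * (delta * q ^ S n * weight a xi)) by ring.
        rewrite <- (Rmult_1_l (delta * (q * _) * _)).
        assert (0 <= delta * q ^ S n) by (apply Rmult_le_pos; lra).
        apply Rmult_le_compat; [|apply Rmult_le_pos; lra|exact H1|].
        + apply Rmult_le_pos; [apply pos_INR|lra].
        + apply Rmult_le_compat_r; [lra|]. apply Rmult_le_compat_l; lra. }
    replace (2 * delta * q * (1 - (/ 2) ^ S n) * weight a xi)
      with (2 * delta * q * (1 - (/ 2) ^ n) * weight a xi + delta * (q * (/ 2) ^ n) * weight a xi)
      by (simpl; field).
    lra.
Qed.

Lemma conv_exp_lipschitz (xi : R) :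
  Cmod (conv_exp L k xi - conv_exp L k' xi) <= 2 * delta * q * weight a xi.
Proof.
  assert (Hd := decay_nonneg _ _ _ Hkk). assert (Hq0 := q_nonneg k Hk). assert (W := weight_pos a xi).
  apply le_epsilon; intros eps He.
  assert (HA := decay_nonneg _ _ _ Hk).
  destruct (conv_exp_approx_eventually k (eps / 2) ltac:(lra) Hk) as [N1 HN1].
  destruct (conv_exp_approx_eventually k' (eps / 2) ltac:(lra) Hk') as [N2 HN2].
  set (N := (N1 + N2)%nat).
  specialize (HN1 N ltac:(lia) xi). specialize (HN2 N ltac:(lia) xi).
  replace (conv_exp L k xi - conv_exp L k' xi)%C with
    ((conv_exp L k xi - conv_exp_sum L k N xi) + (conv_exp_sum L k N xi - conv_exp_sum L k' N xi)
     - (conv_exp L k' xi - conv_exp_sum L k' N xi))%C by ring.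
  eapply Rle_trans; [apply Cmod_minus_le|].
  eapply Rle_trans; [apply Rplus_le_compat_r, Cmod_triangle|].
  assert (B := conv_exp_sum_lipschitz N xi).
  assert (HW := weight_le_1 a xi ltac:(lra)).
  assert (0 <= (/ 2) ^ N) by (apply pow_le; lra).
  assert (0 <= 2 * delta * q * weight a xi) by (apply Rmult_le_pos; [apply Rmult_le_pos|]; lra).
  assert (eps / 2 * weight a xi <= eps / 2) by nra.
  assert (2 * delta * q * (1 - (/ 2) ^ N) * weight a xi <= 2 * delta * q * weight a xi) by nra.
  lra.
Qed.

End ConvExp.

(** * The fixed point on the Fourier side *)

Section FixedPoint.

(** The multiplier [m] stays abstract: the contraction rests on its continuity and on the bounds for
    m and xi m, and its support enters in [iFT_Phi]. *)
Variables (lam Gam a : R) (m : R -> R) (ph : R -> C).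
Hypotheses (Hlam : 0 < lam) (HGam : 0 < Gam) (Ha : 0 < a) (Hlg : 6 * Gam < lam)
  (Hm : continuity m) (Hm0 : forall xi, Rabs (m xi) <= / (2 * lam ^ 2))
  (Hm1 : forall xi, Rabs xi * Rabs (m xi) <= 3 / (4 * lam))
  (Hph : decay a Gam ph).

(** A rational multiple of [lam] above [sqrt 2 * lam]; with pi > 3 it makes [L / PI] at most
    [lam / 2]. *)
Let L := 3 / 2 * lam.

Definition mul_symbol (F : R -> C) (xi : R) : C := (RtoC (m xi) * F xi)%C.

(* If [F] is the transform of [sigma] and [ph] that of [p], this is the transform of
   [S[T_b sigma] + p]. *)
Definition Phi (F : R -> C) (xi : R) : C :=
  (ph xi + (RtoC (/ 4) * conv L (times_ixi (mul_symbol F)) (times_ixi (mul_symbol F)) xi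
            - RtoC (4 * lam ^ 2) * conv_exp L (mul_symbol F) xi))%C.

Lemma L_nonneg : 0 <= L.
Proof. unfold L; lra. Qed.

Lemma L_div_PI_le : 0 <= L / PI <= lam / 2.
Proof.
  split; [apply L_div_PI_nonneg, L_nonneg|].
  unfold L. generalize PI2_3_2; intros HP.
  apply Rmult_le_reg_r with PI; [lra|]. unfold Rdiv at 1.
  rewrite Rmult_assoc, Rinv_l by lra. nra.
Qed.

Lemma mul_symbol_decay (B : R) (F : R -> C) :
  decay a B F -> decay a (/ (2 * lam ^ 2) * B) (mul_symbol F).
Proof.
  intros [HF BF]. split; [unfold mul_symbol; auto with cont|].
  intros xi. unfold mul_symbol. rewrite Cmod_mult, Cmod_R, Rmult_assoc.
  apply Rmult_le_compat; [apply Rabs_pos|apply Cmod_ge_0|apply Hm0|apply BF].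
Qed.

Lemma times_ixi_mul_symbol_decay (B : R) (F : R -> C) :
  decay a B F -> decay a (3 / (4 * lam) * B) (times_ixi (mul_symbol F)).
Proof.
  intros HF. split.
  - apply Ccontinuous_times_ixi, (mul_symbol_decay B F HF).
  - destruct HF as [HF BF]. intros xi. rewrite Cmod_times_ixi. unfold mul_symbol.
    rewrite Cmod_mult, Cmod_R, <- Rmult_assoc, (Rmult_assoc (3 / (4 * lam))).
    apply Rmult_le_compat; [|apply Cmod_ge_0|apply Hm1|apply BF].
    apply Rmult_le_pos; apply Rabs_pos.
Qed.

(** The second quantity is the ratio [q] of the exponential series for [mul_symbol F] on the ball of
    radius 2 Gam. It is at most (Gam / lam^2) (lam / 2) = Gam / (2 lam) <= 1/12, well below the
    required 1/2. *)
Lemma symbol_constants :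
  0 < Gam / lam < / 6 /\ / (2 * lam ^ 2) * (2 * Gam) * (L / PI) <= / 12.
Proof.
  assert (H1 : 0 < Gam / lam) by (apply Rdiv_lt_0_compat; lra).
  assert (H2 : Gam / lam < / 6).
  { apply Rmult_lt_reg_r with lam; [exact Hlam|].
    unfold Rdiv; rewrite Rmult_assoc, Rinv_l; lra. }
  split; [lra|].
  apply Rle_trans with (/ (2 * lam ^ 2) * (2 * Gam) * (lam / 2)).
  - apply Rmult_le_compat_l; [|apply L_div_PI_le].
    apply Rmult_le_pos; [|lra]. left; apply Rinv_0_lt_compat; nra.
  - replace (_ * _) with (Gam / lam / 2) by (field; lra). lra.
Qed.

Lemma Ccontinuous_Phi (F : R -> C) : decay a (2 * Gam) F -> Ccontinuous (Phi F).
Proof.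
  intros HF. destruct symbol_constants as [_ Hq].
  assert (HD := times_ixi_mul_symbol_decay _ _ HF).
  assert (HE := conv_exp_decay a L (/ (2 * lam ^ 2) * (2 * Gam)) Ha L_nonneg ltac:(lra) _ (mul_symbol_decay _ _ HF)).
  unfold Phi. apply Ccontinuous_plus; [apply Hph|].
  apply Ccontinuous_minus; apply Ccontinuous_mult; auto with cont; [|apply HE].
  apply Ccontinuous_conv; apply HD.
Qed.

(** Relative to the weight, the square contributes at most Gam / 4 and the exponential at most Gam /
    3. This serves twice: it keeps the ball of radius 2 Gam invariant, and it bounds the first
    increment of the iteration started at [ph]. *)
Lemma Phi_near_source (F : R -> C) (xi : R) :
  decay a (2 * Gam) F -> Cmod (Phi F xi - ph xi) <= Gam * weight a xi.
Proof.
  intros HF. destruct symbol_constants as [Hgl Hq].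
  assert (HD := times_ixi_mul_symbol_decay _ _ HF).
  assert (HE := conv_exp_decay a L (/ (2 * lam ^ 2) * (2 * Gam)) Ha L_nonneg ltac:(lra) _ (mul_symbol_decay _ _ HF)).
  assert (HC := conv_decay L a _ _ _ _ L_nonneg ltac:(lra) HD HD).
  destruct HE as [_ HE]. specialize (HE xi). destruct HC as [_ HC]. specialize (HC xi).
  assert (W := weight_pos a xi). assert (HL := L_div_PI_le).
  unfold Phi. replace (_ - ph xi)%C with
    (RtoC (/ 4) * conv L (times_ixi (mul_symbol F)) (times_ixi (mul_symbol F)) xi
            - RtoC (4 * lam ^ 2) * conv_exp L (mul_symbol F) xi)%C by ring.
  eapply Rle_trans; [apply Cmod_minus_le|]. rewrite !Cmod_scal by nra.
  assert (B1 : Cmod (conv L (times_ixi (mul_symbol F)) (times_ixi (mul_symbol F)) xi)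
               <= Gam * weight a xi).
  { eapply Rle_trans; [exact HC|]. apply Rmult_le_compat_r; [lra|].
    apply Rle_trans with (3 / (4 * lam) * (2 * Gam) * (3 / (4 * lam) * (2 * Gam)) * (lam / 2)).
    - apply Rmult_le_compat_l; [|apply HL].
      replace (_ * _) with ((3 / 2 * (Gam / lam)) ^ 2) by (field; lra). apply pow2_ge_0.
    - replace (_ * _) with (9 / 8 * (Gam / lam) * Gam) by (field; lra). nra. }
  assert (B2 : 4 * lam ^ 2 * Cmod (conv_exp L (mul_symbol F) xi) <= Gam / 3 * weight a xi).
  { set (q := / (2 * lam ^ 2) * (2 * Gam) * (L / PI)) in *.
    apply Rle_trans with (4 * lam ^ 2 * (/ (2 * lam ^ 2) * (2 * Gam) * q * weight a xi)).
    - apply Rmult_le_compat_l; [nra|exact HE].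
    - replace (_ * (_ * _)) with (4 * Gam * q * weight a xi) by (field; lra).
      apply Rmult_le_compat_r; nra. }
  assert (0 <= Gam * weight a xi) by (apply Rmult_le_pos; lra). lra.
Qed.

Lemma Phi_decay (F : R -> C) : decay a (2 * Gam) F -> decay a (2 * Gam) (Phi F).
Proof.
  intros HF. split; [apply Ccontinuous_Phi, HF|]. intros xi.
  eapply Rle_trans; [apply (Cmod_le_minus _ (ph xi))|].
  generalize (Phi_near_source F xi HF) (proj2 Hph xi). lra.
Qed.

(** The square is bilinear, so its difference splits into two convolutions with one factor built
    from F - F', each at most delta / 10; the coefficient 1/4 turns them into delta / 20. The
    exponential part is at most 4 delta q <= delta / 3. The sum stays below delta / 2. *)
Lemma Phi_contraction (delta : R) (F F' : R -> C) :
  decay a (2 * Gam) F -> decay a (2 * Gam) F' -> decay a delta (fun xi => (F xi - F' xi)%C) ->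
  forall xi, Cmod (Phi F xi - Phi F' xi) <= delta / 2 * weight a xi.
Proof.
  intros HF HF' Hd xi. destruct symbol_constants as [Hgl Hq].
  assert (Hd0 := decay_nonneg _ _ _ Hd).
  assert (W := weight_pos a xi). assert (HL := L_div_PI_le).
  assert (M1 := mul_symbol_decay _ _ HF). assert (M1' := mul_symbol_decay _ _ HF').
  assert (M2 := times_ixi_mul_symbol_decay _ _ HF). assert (M2' := times_ixi_mul_symbol_decay _ _ HF').
  assert (E1 : (fun xi => (mul_symbol F xi - mul_symbol F' xi)%C) = mul_symbol (fun xi => (F xi - F' xi)%C)).
  { apply functional_extensionality; intros y; unfold mul_symbol; ring. }
  assert (E2 : (fun xi => (times_ixi (mul_symbol F) xi - times_ixi (mul_symbol F') xi)%C)
               = times_ixi (mul_symbol (fun xi => (F xi - F' xi)%C))).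
  { apply functional_extensionality; intros y; unfold times_ixi, mul_symbol; ring. }
  assert (D1 := mul_symbol_decay _ _ Hd). rewrite <- E1 in D1.
  assert (D2 := times_ixi_mul_symbol_decay _ _ Hd). rewrite <- E2 in D2.
  assert (BE := conv_exp_lipschitz a L (/ (2 * lam ^ 2) * (2 * Gam)) Ha L_nonneg ltac:(lra) _ _ _ M1 M1' D1 xi).
  destruct (conv_decay L a _ _ _ _ L_nonneg ltac:(lra) D2 M2) as [_ C1]. specialize (C1 xi).
  destruct (conv_decay L a _ _ _ _ L_nonneg ltac:(lra) M2' D2) as [_ C2]. specialize (C2 xi).
  rewrite <- conv_minus_l in C1 by (apply M2 || apply M2').
  rewrite <- conv_minus_r in C2 by (apply M2 || apply M2').
  set (DF := times_ixi (mul_symbol F)) in *. set (DF' := times_ixi (mul_symbol F')) in *.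
  unfold Phi. fold DF. fold DF'.
  replace (_ - _)%C with
    (RtoC (/ 4) * ((conv L DF DF xi - conv L DF' DF xi) + (conv L DF' DF xi - conv L DF' DF' xi))
     - RtoC (4 * lam ^ 2) * (conv_exp L (mul_symbol F) xi - conv_exp L (mul_symbol F') xi))%C by ring.
  eapply Rle_trans; [apply Cmod_minus_le|]. rewrite !Cmod_scal by nra.
  assert (Hc : 3 / (4 * lam) * delta * (3 / (4 * lam) * (2 * Gam)) * (L / PI) <= delta / 10).
  { apply Rle_trans with (3 / (4 * lam) * delta * (3 / (4 * lam) * (2 * Gam)) * (lam / 2)).
    - apply Rmult_le_compat_l; [|apply HL].
      assert (0 < 3 / (4 * lam)) by (apply Rdiv_lt_0_compat; lra).
      repeat apply Rmult_le_pos; lra.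
    - replace (_ * _) with (9 / 16 * (Gam / lam) * delta) by (field; lra). nra. }
  replace (3 / (4 * lam) * (2 * Gam) * (3 / (4 * lam) * delta) * (L / PI))
    with (3 / (4 * lam) * delta * (3 / (4 * lam) * (2 * Gam)) * (L / PI)) in C2 by ring.
  set (c := 3 / (4 * lam) * delta * (3 / (4 * lam) * (2 * Gam)) * (L / PI)) in *.
  assert (Hc' : c * weight a xi <= delta / 10 * weight a xi) by (apply Rmult_le_compat_r; lra).
  assert (B1 := Rle_trans _ _ _ (Cmod_triangle _ _) (Rplus_le_compat _ _ _ _ C1 C2)).
  assert (B2 : 4 * lam ^ 2 * Cmod (conv_exp L (mul_symbol F) xi - conv_exp L (mul_symbol F') xi)
               <= delta / 3 * weight a xi).
  { set (q := / (2 * lam ^ 2) * (2 * Gam) * (L / PI)) in *.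
    apply Rle_trans with (4 * lam ^ 2 * (2 * (/ (2 * lam ^ 2) * delta) * q * weight a xi)).
    - apply Rmult_le_compat_l; [nra|exact BE].
    - replace (_ * (_ * _)) with (4 * delta * q * weight a xi) by (field; lra).
      apply Rmult_le_compat_r; nra. }
  assert (0 <= delta * weight a xi) by (apply Rmult_le_pos; lra). lra.
Qed.

(** In the iteration started at [ph], successive differences are at most Gam / 2^n times the weight,
    so a pointwise limit F exists and is approached uniformly relative to the weight. F is fixed
    because it is close to u (n + 1) = Phi (u n), which is close to Phi F. *)
Lemma Phi_fixed_point : exists F, decay a (2 * Gam) F /\ forall xi, F xi = Phi F xi.
Proof.
  set (u := fun n => Nat.iter n Phi ph).
  assert (Hu : forall n, decay a (2 * Gam) (u n)).
  { induction n as [|n IH]; [|apply Phi_decay, IH].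
    split; [apply Hph|]. intros xi. generalize (proj2 Hph xi) (weight_pos a xi); simpl; nra. }
  assert (Hs : forall n, decay a (Gam * (/ 2) ^ n) (fun xi => (u (S n) xi - u n xi)%C)).
  { induction n as [|n IH].
    - split; [apply Ccontinuous_minus; apply Hu|]. intros xi. simpl. rewrite Rmult_1_r.
      apply Phi_near_source, (Hu 0%nat).
    - split; [apply Ccontinuous_minus; apply Hu|]. intros xi.
      replace (Gam * (/ 2) ^ S n) with (Gam * (/ 2) ^ n / 2) by (simpl; field).
      exact (Phi_contraction _ _ _ (Hu (S n)) (Hu n) IH xi). }
  set (F := fun xi => Clim (fun n => u n xi)).
  assert (HF : forall n xi, Cmod (F xi - u n xi) <= 2 * Gam * (/ 2) ^ n * weight a xi).
  { intros n xi. assert (W := weight_pos a xi).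
    eapply Rle_trans; [apply (geometric_limit (fun n => u n xi) (Gam * weight a xi)); [nra|]|right; ring].
    intros k. destruct (Hs k) as [_ B]. specialize (B xi). simpl in *. lra. }
  assert (Happ : forall eps, 0 < eps -> exists n, forall xi, Cmod (F xi - u n xi) <= eps * weight a xi).
  { intros eps He. destruct (pow_half_small eps (2 * Gam) He ltac:(lra)) as [n Hn].
    exists n; intros xi. eapply Rle_trans; [apply HF|].
    apply Rmult_le_compat_r; [left; apply weight_pos|apply Hn; lia]. }
  assert (HFc : Ccontinuous F).
  { apply Ccontinuous_uniform_limit. intros eps He. destruct (Happ eps He) as [n Hn].
    exists (u n); split; [apply Hu|]. intros x. eapply Rle_trans; [apply Hn|].
    generalize (weight_le_1 a x ltac:(lra)). nra. }
  assert (HFd : decay a (2 * Gam) F).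
  { split; [exact HFc|]. intros xi. apply le_epsilon; intros eps He.
    destruct (Happ eps He) as [n Hn]. specialize (Hn xi).
    eapply Rle_trans; [apply (Cmod_le_minus _ (u n xi))|].
    generalize (proj2 (Hu n) xi) (weight_le_1 a xi ltac:(lra)). nra. }
  exists F; split; [exact HFd|]. intros xi.
  apply Ceq_of_arbitrarily_close; intros eps He.
  destruct (pow_half_small eps (2 * Gam) He ltac:(lra)) as [n Hn]. specialize (Hn n (le_n n)).
  assert (Hd : decay a (2 * Gam * (/ 2) ^ n) (fun xi => (F xi - u n xi)%C)).
  { split; [apply Ccontinuous_minus; [exact HFc|apply Hu]|apply HF]. }
  assert (B := Phi_contraction _ _ _ HFd (Hu n) Hd xi).
  assert (B' := HF (S n) xi). change (u (S n)) with (Phi (u n)) in B'. simpl pow in B'.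
  eapply Rle_trans; [apply (Cmod_minus_triangle _ (Phi (u n) xi))|].
  rewrite (Cmod_minus_sym (Phi (u n) xi)).
  assert (W := weight_pos a xi). assert (W1 := weight_le_1 a xi ltac:(lra)).
  assert (0 <= (/ 2) ^ n) by (apply pow_le; lra). nra.
Qed.

(** The support of [m] is what makes the convolutions over [-L, L] transforms of products; the terms
    of [Phi] are then inverted one by one. *)
Lemma iFT_Phi (F p g dg : R -> C) :
  decay a (2 * Gam) F -> (forall xi, L <= Rabs xi -> m xi = 0) -> iFT ph p ->
  iFT (mul_symbol F) g -> iFT (times_ixi (mul_symbol F)) dg ->
  iFT (Phi F) (fun x => (S_op lam (g x) (dg x) + p x)%C).
Proof.
  intros HF Hs Hp Hg Hdg. destruct symbol_constants as [_ Hq].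
  assert (M1 := mul_symbol_decay _ _ HF). assert (M2 := times_ixi_mul_symbol_decay _ _ HF).
  assert (S1 : forall xi, L <= Rabs xi -> mul_symbol F xi = RtoC 0).
  { intros xi H; unfold mul_symbol; rewrite Hs by exact H; ring. }
  assert (S2 : forall xi, L <= Rabs xi -> times_ixi (mul_symbol F) xi = RtoC 0).
  { intros xi H; unfold times_ixi; rewrite S1 by exact H; ring. }
  assert (HE := conv_exp_decay a L (/ (2 * lam ^ 2) * (2 * Gam)) Ha L_nonneg ltac:(lra) _ M1).
  assert (I1 := iFT_conv_exp a L (/ (2 * lam ^ 2) * (2 * Gam)) Ha L_nonneg ltac:(lra) _ _ M1 S1 Hg).
  assert (I2 := iFT_conv L _ _ _ _ _ L_nonneg (proj1 M2)
    (fun eta => decay_bounded a _ _ eta ltac:(lra) M2) S2 (proj1 M2) Hdg Hdg).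
  apply (iFT_ext (Phi F) _ (fun x => p x + (RtoC (/ 4) * (dg x * dg x)
    - RtoC (4 * lam ^ 2) * (Cexp (g x) - RtoC 1 - g x)))%C).
  - reflexivity.
  - intros x. unfold S_op. rewrite !Cscale_RtoC. unfold Csub, Defs.Cmult, C1.
    apply C_eq; simpl; ring.
  - unfold Phi. apply iFT_plus; [apply Hph| |exact Hp|].
    + apply Ccontinuous_minus; apply Ccontinuous_mult; auto with cont; [|apply HE].
      apply Ccontinuous_conv; apply M2.
    + apply iFT_minus.
      * apply Ccontinuous_mult; [auto with cont|apply Ccontinuous_conv; apply M2].
      * apply Ccontinuous_mult; [auto with cont|apply HE].
      * apply (iFT_mult_l _ _ (fun x => (dg x * dg x)%C)); [apply Ccontinuous_conv; apply M2|exact I2].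
      * apply (iFT_mult_l _ _ (fun x => (Cexp (g x) - RtoC 1 - g x)%C)); [apply HE|exact I1].
Qed.

End FixedPoint.

(** * Abel summation and the Poisson kernel *)

(** The Poisson kernel normalised to total mass pi. Twice this function is the Fourier transform of
    the Abel factor [weight eps]. *)
Definition cauchy (eps t : R) : R := eps / (eps ^ 2 + t ^ 2).

Lemma cauchy_denominator_pos (eps t : R) : 0 < eps -> 0 < eps ^ 2 + t ^ 2.
Proof. intros He. assert (0 < eps ^ 2) by (apply pow_lt, He). generalize (pow2_ge_0 t); lra. Qed.

Lemma cauchy_pos (eps t : R) : 0 < eps -> 0 < cauchy eps t.
Proof. intros He. apply Rdiv_lt_0_compat; [exact He|apply cauchy_denominator_pos, He]. Qed.

Lemma continuity_cauchy (eps x : R) : 0 < eps -> continuity (fun y => cauchy eps (x - y)).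
Proof.
  intros He. unfold cauchy. apply continuity_Rdiv; auto with cont.
  intros y. apply Rgt_not_eq, cauchy_denominator_pos, He.
Qed.

Lemma RInt_cauchy (eps x u v : R) :
  0 < eps ->
  RInt (fun y => cauchy eps (x - y)) u v = atan ((x - u) / eps) - atan ((x - v) / eps).
Proof.
  intros He. apply is_RInt_unique.
  replace (_ - _) with (minus (- atan ((x - v) / eps)) (- atan ((x - u) / eps)))
    by (unfold minus, plus, opp; simpl; ring).
  apply (is_RInt_derive (V := R_CompleteNormedModule) (fun y => - atan ((x - y) / eps))).
  - intros y _. auto_derive; trivial. unfold cauchy.
    assert (H := cauchy_denominator_pos eps (x - y) He).
    field. simpl in *; repeat split; nra.
  - intros y _. apply continuity_pt_filterlim, continuity_cauchy, He.
Qed.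

Lemma RInt_cauchy_le (eps x u v : R) :
  0 < eps -> RInt (fun y => cauchy eps (x - y)) u v <= PI.
Proof.
  intros He. rewrite RInt_cauchy by exact He.
  generalize (atan_bound ((x - u) / eps)) (atan_bound ((x - v) / eps)); lra.
Qed.

Lemma atan_near_PI2 (kappa : R) : 0 < kappa -> exists T, forall t, T <= t -> PI / 2 - kappa <= atan t.
Proof.
  intros Hk. assert (HP := PI_RGT_0).
  (* The cap [PI / 4] keeps [PI / 2 - k] in the range where [atan] inverts [tan]. *)
  set (k := Rmin kappa (PI / 4)).
  assert (K1 := Rmin_l kappa (PI / 4)). assert (K2 := Rmin_r kappa (PI / 4)).
  assert (K0 : 0 < k) by (apply Rmin_pos; lra). fold k in K1, K2.
  exists (tan (PI / 2 - k)); intros t Ht.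
  apply Rle_trans with (atan (tan (PI / 2 - k))).
  - rewrite atan_tan by lra. lra.
  - destruct Ht as [Ht|Ht]; [left; apply atan_increasing, Ht|right; rewrite Ht; reflexivity].
Qed.

Lemma weight_small (eps kappa : R) :
  0 < eps -> 0 < kappa -> exists N0, 0 <= N0 /\ forall N, N0 <= N -> weight eps N <= kappa.
Proof.
  intros He Hk. assert (Hn : 0 < / (kappa * eps)) by (apply Rinv_0_lt_compat; nra).
  (* Beyond this point exp(eps N) >= eps N >= 1 / kappa. *)
  exists (/ (kappa * eps)); split; [lra|]. intros N HN.
  unfold weight. rewrite Rabs_pos_eq, exp_Ropp by lra.
  rewrite <- (Rinv_inv kappa). apply Rinv_le_contravar; [apply Rinv_0_lt_compat, Hk|].
  eapply Rle_trans; [|apply exp_ineq1_le].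
  apply Rle_trans with (eps * / (kappa * eps)); [right; field; lra|nra].
Qed.

Lemma Cderiv_mult_l (w : C) (f : R -> C) (x : R) (l : C) :
  Cderiv f x l -> Cderiv (fun t => (w * f t)%C) x (w * l)%C.
Proof.
  intros [F1 F2]; split; simpl.
  - apply derivable_pt_lim_minus; apply derivable_pt_lim_scal; trivial.
  - apply derivable_pt_lim_plus; apply derivable_pt_lim_scal; trivial.
Qed.

Lemma CInt_Cexp (z : C) (u v : R) :
  z <> RtoC 0 ->
  CInt (fun x => Cexp (RtoC x * z)%C) u v = (/ z * (Cexp (RtoC v * z)%C - Cexp (RtoC u * z)%C))%C.
Proof.
  intros Hz.
  rewrite (CInt_derivative (fun x => / z * Cexp (RtoC x * z)%C)%C).
  - cring.
  - intros x.
    replace (Cexp (RtoC x * z)%C) with (/ z * (z * Cexp (RtoC x * z)%C))%C.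
    + apply Cderiv_mult_l, Cderiv_Cexp.
    + rewrite Cmult_assoc, Cinv_l by exact Hz. cring.
  - exact (Cderiv_continuous _ _ (Cderiv_Cexp z)).
Qed.

Lemma CInt_ext_segment (f g : R -> C) (u v : R) :
  u <= v -> (forall x, u < x < v -> f x = g x) -> CInt f u v = CInt g u v.
Proof.
  intros Huv H; unfold CInt; f_equal; apply RInt_ext; rewrite Rmin_left, Rmax_right by exact Huv;
    intros x Hx; rewrite H; trivial.
Qed.

(** On either side of 0 the integrand is the exponential of a linear function, with rates z = eps +
    i t and z' = - eps + i t. The boundary terms at 0 give 1/z - 1/z' = 2 eps / (eps^2 + t^2); those
    at -N and N have modulus at most exp(- eps N) / eps. *)
Lemma CInt_abel (eps t N : R) :
  0 < eps -> 0 <= N ->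
  Cmod (CInt (fun x => (RtoC (weight eps x) * Cexpi (x * t))%C) (- N) N - RtoC (2 * cauchy eps t))
  <= 2 * (weight eps N / eps).
Proof.
  intros He HN.
  assert (Hc : Ccontinuous (fun x => (RtoC (weight eps x) * Cexpi (x * t))%C)) by auto with cont.
  set (z := (eps, t) : C). set (z' := (- eps, t) : C).
  assert (Hz : z <> RtoC 0) by (intros E; apply (f_equal fst) in E; simpl in E; lra).
  assert (Hz' : z' <> RtoC 0) by (intros E; apply (f_equal fst) in E; simpl in E; lra).
  rewrite <- (CInt_Chasles _ (- N) 0 N) by exact Hc.
  rewrite (CInt_ext_segment _ (fun x => Cexp (RtoC x * z)%C) (- N) 0).
  2:{ lra. }
  2:{ intros x Hx. unfold weight. rewrite Rabs_left by lra.
      apply C_eq; simpl; replace (x * eps - 0 * t) with (- (eps * - x)) by ring;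
      rewrite !Rmult_0_l, !Rplus_0_r; ring. }
  rewrite (CInt_ext_segment _ (fun x => Cexp (RtoC x * z')%C) 0 N).
  2:{ lra. }
  2:{ intros x Hx. unfold weight. rewrite Rabs_pos_eq by lra.
      apply C_eq; simpl; replace (x * - eps - 0 * t) with (- (eps * x)) by ring;
      rewrite !Rmult_0_l, !Rplus_0_r; ring. }
  rewrite !CInt_Cexp by assumption.
  assert (E0 : forall w : C, Cexp (RtoC 0 * w)%C = RtoC 1).
  { intros w. replace (RtoC 0 * w)%C with (RtoC 0) by ring.
    unfold Cexp; simpl; rewrite exp_0, cos_0, sin_0. apply C_eq; simpl; ring. }
  rewrite !E0.
  assert (Ed : RtoC (2 * cauchy eps t) = (/ z - / z')%C).
  { unfold cauchy. apply C_eq; simpl; field; nra. }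
  rewrite Ed.
  match goal with |- Cmod ?w <= _ => replace w with
    (/ z' * Cexp (RtoC N * z')%C - / z * Cexp (RtoC (- N) * z)%C)%C by cring end.
  assert (B : forall (w : C) (s : R), w <> RtoC 0 -> Rabs (fst w) = eps -> fst (RtoC s * w)%C = - (eps * N) ->
     Cmod (/ w * Cexp (RtoC s * w)%C) <= weight eps N / eps).
  { intros w s Hw H1 H2. rewrite Cmod_mult, Cmod_inv by exact Hw.
    rewrite Rmult_comm. apply Rmult_le_compat.
    - apply Cmod_ge_0.
    - left; apply Rinv_0_lt_compat, Cmod_gt_0, Hw.
    - unfold Cexp. rewrite H2. unfold weight. rewrite (Rabs_pos_eq N) by exact HN.
      replace (_, _) with (RtoC (exp (- (eps * N))) * Cexpi (snd (RtoC s * w)%C))%C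
        by (apply C_eq; simpl; ring).
      rewrite Cmod_scal, Cmod_Cexpi by (left; apply exp_pos). lra.
    - apply Rinv_le_contravar; [exact He|]. rewrite <- H1. apply Cmod_fst. }
  eapply Rle_trans; [apply Cmod_minus_le|].
  assert (B1 := B z' N Hz'). assert (B2 := B z (- N) Hz).
  unfold z', z in B1, B2. simpl fst in B1, B2.
  rewrite Rabs_Ropp, Rabs_pos_eq in B1 by lra. rewrite Rabs_pos_eq in B2 by lra.
  unfold z, z'.
  specialize (B1 eq_refl ltac:(ring)). specialize (B2 eq_refl ltac:(ring)). lra.
Qed.

(** * Fourier inversion *)

(** The error has three parts, each at most eta: y near x, where p y - p x is small by continuity; y
    far from x, where the kernel is O(eps) relative to [cauchy 1]; and the kernel mass outside
    [-A, A], which multiplies p x. *)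
Lemma approximate_identity (p : R -> C) (l x eta : R) :
  Ccontinuous p -> (forall u v, u <= v -> RInt (fun y => Cmod (p y)) u v <= l) -> 0 < eta ->
  exists eps0, 0 < eps0 /\ forall eps, 0 < eps <= eps0 -> exists A0, forall A, A0 <= A -> 0 <= A ->
  Cmod (CInt (fun y => (RtoC (/ PI * cauchy eps (x - y)) * p y)%C) (- A) A - p x) <= 3 * eta.
Proof.
  intros Hp Hl Heta. assert (HP := PI_RGT_0). assert (HP' := Rinv_0_lt_compat _ HP).
  assert (HP1 : / PI * PI = 1) by (field; lra).
  assert (Hl0 : 0 <= l).
  { eapply Rle_trans; [|apply (Hl 0 0); lra]. rewrite RInt_point. right; reflexivity. }
  assert (Hloc : exists del, 0 < del /\ forall y, Rabs (x - y) < del -> Cmod (p y - p x) <= eta).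
  { destruct Hp as [P1 P2].
    destruct (P1 x (eta / 2) ltac:(lra)) as [d1 [Hd1 H1]].
    destruct (P2 x (eta / 2) ltac:(lra)) as [d2 [Hd2 H2]]. simpl in *. unfold Rdist in *.
    exists (Rmin d1 d2); split; [apply Rmin_pos; trivial|]. intros y Hy.
    rewrite Rabs_minus_sym in Hy.
    destruct (Req_dec y x) as [->|Hne].
    - replace (p x - p x)%C with (RtoC 0) by ring. rewrite Cmod_0; lra.
    - assert (Hd : no_cond y /\ y <> x) by (split; [exact I|exact Hne]).
      assert (Hd' : D_x no_cond x y) by (split; [exact I|auto]).
      specialize (H1 y (conj Hd' (Rlt_le_trans _ _ _ Hy (Rmin_l _ _)))).
      specialize (H2 y (conj Hd' (Rlt_le_trans _ _ _ Hy (Rmin_r _ _)))).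
      eapply Rle_trans; [apply Cmod_le_sum|]. simpl. unfold Rminus in *. lra. }
  destruct Hloc as [del [Hdel Hloc]].
  (* For s = (x - y)^2 >= del^2 one has (1 + s) / s <= D, hence [cauchy eps (x - y) <= eps * D *
     cauchy 1 (x - y)]. *)
  set (D := 1 + / del ^ 2).
  assert (HD : 0 < D) by (unfold D; assert (0 < / del ^ 2) by (apply Rinv_0_lt_compat; nra); lra).
  (* Up to the factor [eps * D], this bounds the integral of the far part of the majorant; the [+ 1]
     keeps it positive. *)
  set (S := l + Cmod (p x) * PI + 1).
  assert (HS : 0 < S) by (unfold S; generalize (Cmod_ge_0 (p x)); nra).
  exists (eta / (D * S)); split; [apply Rdiv_lt_0_compat; nra|].
  intros eps [He He0].
  assert (HeD : eps * D * S <= eta).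
  { apply Rle_trans with (eta / (D * S) * D * S); [|right; field; lra].
    apply Rmult_le_compat_r; [lra|]. apply Rmult_le_compat_r; lra. }
  set (kap := eta / (Cmod (p x) + 1)).
  assert (Hkap : 0 < kap) by (apply Rdiv_lt_0_compat; generalize (Cmod_ge_0 (p x)); lra).
  destruct (atan_near_PI2 kap Hkap) as [T HT].
  (* For such A both (x + A) / eps and (A - x) / eps are at least T, so the kernel mass on [-A, A]
     is within [kap] of 1. *)
  exists (eps * Rabs T + Rabs x). intros A HA0 HA.
  assert (HTt : T <= (x + A) / eps /\ T <= (A - x) / eps).
  { assert (B1 := Rle_abs T). assert (B2 := Rle_abs x). assert (B3 := Rle_abs (- x)).
    rewrite Rabs_Ropp in B3.
    split; apply Rmult_le_reg_r with eps; trivial; unfold Rdiv; rewrite Rmult_assoc, Rinv_l by lra; nra. }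
  set (mass := RInt (fun y => / PI * cauchy eps (x - y)) (- A) A).
  assert (Hcc := continuity_cauchy eps x He).
  assert (Hmass : Cmod (RtoC (mass - 1) * p x) <= eta).
  { rewrite Cmod_mult, Cmod_R.
    assert (Hm : Rabs (mass - 1) <= kap).
    { unfold mass. rewrite (RInt_scal (V := R_CompleteNormedModule)) by auto with cont.
      rewrite RInt_cauchy by exact He. unfold scal; simpl; unfold mult; simpl.
      replace (x - - A) with (x + A) by ring.
      replace ((x - A) / eps) with (- ((A - x) / eps)) by (field; lra). rewrite atan_opp.
      assert (B1 := HT _ (proj1 HTt)). assert (B2 := HT _ (proj2 HTt)).
      assert (C1 := atan_bound ((x + A) / eps)). assert (C2 := atan_bound ((A - x) / eps)).
      assert (HP2 : / PI <= / 2) by (apply Rinv_le_contravar; [lra|generalize PI2_3_2; lra]).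
      set (s := atan ((x + A) / eps) - - atan ((A - x) / eps)) in *.
      assert (PI - 2 * kap <= s <= PI) by (unfold s; lra).
      replace (/ PI * s - 1) with (/ PI * (s - PI)) by (field; lra).
      rewrite Rabs_mult, Rabs_pos_eq, Rabs_left1 by lra. nra. }
    assert (Ek : kap * (Cmod (p x) + 1) = eta).
    { unfold kap; field. generalize (Cmod_ge_0 (p x)); lra. }
    generalize (Cmod_ge_0 (p x)) (Rabs_pos (mass - 1)). nra. }
  assert (Hcp : Ccontinuous (fun y => RtoC (/ PI * cauchy eps (x - y)))) by auto with cont.
  assert (Emass : CInt (fun y => RtoC (/ PI * cauchy eps (x - y))) (- A) A = RtoC mass).
  { apply C_eq; simpl; [reflexivity|]. rewrite RInt_const. apply Rmult_0_r. }
  replace (CInt (fun y => (RtoC (/ PI * cauchy eps (x - y)) * p y)%C) (- A) A - p x)%C with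
    (CInt (fun y => (RtoC (/ PI * cauchy eps (x - y)) * (p y - p x))%C) (- A) A
     + RtoC (mass - 1) * p x)%C.
  2:{ rewrite (CInt_ext (fun y => (RtoC (/ PI * cauchy eps (x - y)) * (p y - p x))%C)
        (fun y => (RtoC (/ PI * cauchy eps (x - y)) * p y - RtoC (/ PI * cauchy eps (x - y)) * p x)%C))
        by (intros; ring).
      rewrite CInt_minus, CInt_mult_r, Emass, RtoC_minus by auto with cont. ring. }
  eapply Rle_trans; [apply Cmod_triangle|].
  replace (3 * eta) with (2 * eta + eta) by ring. apply Rplus_le_compat; [|exact Hmass].
  (* One continuous majorant, the sum of the near and the far bound, is used for all y; this avoids
     cutting the integral at distance [del] from x. *)
  set (g := fun y => / PI * eta * cauchy eps (x - y)
     + (eps * D) * (1 * Cmod (p y) + Cmod (p x) * cauchy 1 (x - y))).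
  assert (Hc1 := continuity_cauchy 1 x ltac:(lra)).
  eapply Rle_trans.
  - apply (Cmod_CInt_le _ g); [lra|auto with cont|unfold g; auto 8 with cont|].
    intros y _. unfold g.
    assert (Hcy := cauchy_pos eps (x - y) He).
    rewrite Cmod_scal by (apply Rmult_le_pos; lra).
    assert (Hp1 := Cmod_ge_0 (p y)). assert (Hp2 := Cmod_ge_0 (p x)).
    assert (H1y := cauchy_pos 1 (x - y) ltac:(lra)).
    destruct (Rlt_le_dec (Rabs (x - y)) del) as [Hy|Hy].
    + specialize (Hloc y Hy).
      assert (0 <= eps * D * (1 * Cmod (p y) + Cmod (p x) * cauchy 1 (x - y))).
      { apply Rmult_le_pos; [nra|]. apply Rplus_le_le_0_compat; nra. }
      assert (/ PI * cauchy eps (x - y) * Cmod (p y - p x) <= / PI * eta * cauchy eps (x - y)).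
      { replace (/ PI * eta * cauchy eps (x - y)) with (/ PI * cauchy eps (x - y) * eta) by ring.
        apply Rmult_le_compat_l; [apply Rmult_le_pos; lra|exact Hloc]. }
      lra.
    + assert (Hsq : del ^ 2 <= (x - y) ^ 2).
      { rewrite <- (pow2_abs (x - y)). apply pow_incr; lra. }
      assert (Hcmp : cauchy eps (x - y) <= eps * D * cauchy 1 (x - y)).
      { unfold cauchy. set (s := (x - y) ^ 2) in *.
        assert (Hs : 0 < s) by nra.
        assert (Hd2 : del ^ 2 * / del ^ 2 = 1) by (field; lra).
        assert (Hid : 0 < / del ^ 2) by (apply Rinv_0_lt_compat; nra).
        replace (eps * D * (1 / (1 ^ 2 + s))) with (eps * (D / (1 + s))) by (field; lra).
        unfold Rdiv. apply Rmult_le_compat_l; [lra|].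
        apply Rmult_le_reg_r with (eps ^ 2 + s); [nra|]. rewrite Rinv_l by nra.
        apply Rmult_le_reg_r with (1 + s); [lra|].
        replace (D * / (1 + s) * (eps ^ 2 + s) * (1 + s)) with (D * (eps ^ 2 + s)) by (field; lra).
        unfold D. nra. }
      assert (H1le : cauchy 1 (x - y) <= 1).
      { unfold cauchy. apply Rmult_le_reg_r with (1 ^ 2 + (x - y) ^ 2); [nra|].
        unfold Rdiv; rewrite Rmult_assoc, Rinv_l by nra. nra. }
      assert (HPle : / PI <= 1).
      { rewrite <- Rinv_1. apply Rinv_le_contravar; [lra|]. generalize PI2_3_2; lra. }
      assert (Hdiff := Cmod_minus_le (p y) (p x)).
      apply Rle_trans with (eps * D * cauchy 1 (x - y) * (Cmod (p y) + Cmod (p x))).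
      * apply Rmult_le_compat; [apply Rmult_le_pos; lra|apply Cmod_ge_0| |exact Hdiff].
        apply Rle_trans with (1 * cauchy eps (x - y)); [apply Rmult_le_compat_r; lra|lra].
      * assert (0 <= / PI * eta * cauchy eps (x - y)) by (apply Rmult_le_pos; [apply Rmult_le_pos|]; lra).
        assert (0 <= eps * D) by nra.
        assert (cauchy 1 (x - y) * (Cmod (p y) + Cmod (p x))
                <= 1 * Cmod (p y) + Cmod (p x) * cauchy 1 (x - y)) by nra.
        nra.
  - unfold g. rewrite RInt_lin2 by auto 6 with cont. rewrite RInt_lin2 by auto 6 with cont.
    assert (B1 := RInt_cauchy_le eps x (- A) A He).
    assert (B2 := RInt_cauchy_le 1 x (- A) A ltac:(lra)).
    assert (B3 := Hl (- A) A ltac:(lra)).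
    assert (B4 : / PI * eta * RInt (fun y => cauchy eps (x - y)) (- A) A <= / PI * eta * PI).
    { apply Rmult_le_compat_l; [apply Rmult_le_pos; lra|exact B1]. }
    replace (/ PI * eta * PI) with eta in B4 by (field; lra).
    assert (B5 : eps * D * (1 * RInt (fun y => Cmod (p y)) (- A) A
                 + Cmod (p x) * RInt (fun y => cauchy 1 (x - y)) (- A) A) <= eps * D * S).
    { apply Rmult_le_compat_l; [nra|]. unfold S.
      assert (Cmod (p x) * RInt (fun y => cauchy 1 (x - y)) (- A) A <= Cmod (p x) * PI)
        by (apply Rmult_le_compat_l; [apply Cmod_ge_0|exact B2]).
      lra. }
    lra.
Qed.

Definition truncated_FT (p : R -> C) (A xi : R) : C :=
  CInt (fun y => (p y * Cexpi (- (y * xi)))%C) (- A) A.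

Lemma Ccontinuous_truncated_FT (p : R -> C) (A : R) :
  Ccontinuous p -> Ccontinuous (truncated_FT p A).
Proof.
  intros Hp. apply (Ccontinuous_CInt_param (fun xi y => (p y * Cexpi (- (y * xi)))%C)).
  apply Ccontinuous2_mult; [apply Ccontinuous2_snd, Hp|auto with cont].
Qed.

(** The character has modulus 1, so |p| dominates the integrand for every xi and the truncation
    error is uniform in xi. *)
Lemma truncated_FT_approx (p ph : R -> C) :
  Ccontinuous p -> L1 p -> is_FT p ph ->
  exists l, 0 <= l /\ (forall u v, u <= v -> RInt (fun y => Cmod (p y)) u v <= l) /\
    forall tau, 0 < tau -> exists A0, 0 <= A0 /\
      forall A, A0 <= A -> forall xi, Cmod (ph xi - truncated_FT p A xi) <= tau.
Proof.
  intros Hp [_ [_ [l Hl]]] Hph.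
  assert (Hc : continuity (fun y => Cmod (p y))) by auto with cont.
  assert (Hl' : convergent_integral (fun y => Cmod (p y)) l) by (apply improper_integral_iff; trivial).
  assert (Hle := convergent_nonneg_upper _ l Hc (fun y => Cmod_ge_0 (p y)) Hl').
  exists l; split; [|split; [exact Hle|]].
  { eapply Rle_trans; [|apply (Hle 0 0); lra]. rewrite RInt_point. right; reflexivity. }
  intros tau Htau. destruct (Hl' tau Htau) as [M HM].
  exists (Rmax M 0); split; [apply Rmax_r|]. intros A HA xi.
  assert (B1 := Rmax_l M 0). assert (B2 := Rmax_r M 0).
  specialize (HM (- A) A ltac:(lra) ltac:(lra)). apply Rabs_def2 in HM.
  apply (Iint_tail _ (fun y => Cmod (p y)) l).
  - auto 7 with cont.
  - exact Hc.
  - intros y. rewrite Cmod_mult, Cmod_Cexpi. lra.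
  - exact Hle.
  - lra.
  - lra.
  - apply Iint_Cintegral; [auto 7 with cont|]. exact (Hph xi).
Qed.

Lemma Ccontinuous_FT (p ph : R -> C) : Ccontinuous p -> L1 p -> is_FT p ph -> Ccontinuous ph.
Proof.
  intros Hp Hp1 Hph. destruct (truncated_FT_approx p ph Hp Hp1 Hph) as [l [_ [_ H]]].
  apply Ccontinuous_uniform_limit. intros eps He. destruct (H eps He) as [A [_ HA]].
  exists (truncated_FT p A); split; [apply Ccontinuous_truncated_FT, Hp|]. apply HA; lra.
Qed.

Lemma one_minus_weight_le (eps x : R) :
  0 <= eps -> 0 <= 1 - weight eps x <= eps * Rabs x.
Proof.
  intros H. split; [generalize (weight_le_1 eps x H); lra|].
  unfold weight. generalize (exp_ineq1_le (- (eps * Rabs x))). lra.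
Qed.

(** Since 1 - exp(- eps |xi|) <= eps |xi| and xi F(xi) still decays, at rate a / 2, inserting the
    Abel factor costs O(eps) uniformly in N. *)
Lemma abel_mean_error (a B eps x N : R) (F : R -> C) :
  0 < a -> 0 < eps -> 0 <= N -> decay a B F ->
  Cmod (CInt (fkernel x F) (- N) N - CInt (fun xi => (RtoC (weight eps xi) * fkernel x F xi)%C) (- N) N)
  <= eps * (2 / a * B / (PI * (a / 2))).
Proof.
  intros Ha He HN HF. assert (HB := decay_nonneg _ _ _ HF).
  assert (HF2 := decay_times_ixi a B F Ha HF). assert (HC : Ccontinuous F) by apply HF.
  assert (HB2 := decay_nonneg _ _ _ HF2).
  rewrite <- CInt_minus by auto with cont.
  replace (eps * (2 / a * B / (PI * (a / 2)))) with (eps * (2 / a * B) / (PI * (a / 2)))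
    by (unfold Rdiv; ring).
  eapply Rle_trans.
  - apply (Cmod_CInt_le _ (fun xi => / (2 * PI) * (eps * (2 / a * B)) * weight (a / 2) xi));
      [lra|auto with cont|auto with cont|].
    intros xi _.
    replace (fkernel x F xi - RtoC (weight eps xi) * fkernel x F xi)%C
      with (RtoC (1 - weight eps xi) * fkernel x F xi)%C by (rewrite RtoC_minus; ring).
    assert (Hw := one_minus_weight_le eps xi ltac:(lra)).
    rewrite Cmod_scal, Cmod_fkernel by apply Hw.
    assert (B2 := proj2 HF2 xi). rewrite Cmod_times_ixi in B2.
    rewrite (Rmult_assoc (/ (2 * PI))), <- Rmult_assoc, (Rmult_comm _ (/ (2 * PI))), Rmult_assoc.
    apply Rmult_le_compat_l; [left; apply inv_2PI_pos|].
    apply Rle_trans with (eps * (Rabs xi * Cmod (F xi))); [|nra].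
    rewrite <- Rmult_assoc. apply Rmult_le_compat_r; [apply Cmod_ge_0|apply Hw].
  - apply RInt_fkernel_weight; nra.
Qed.

Lemma abel_mean_truncated (p : R -> C) (eps x N A : R) :
  Ccontinuous p ->
  CInt (fun xi => (RtoC (weight eps xi) * fkernel x (truncated_FT p A) xi)%C) (- N) N
  = CInt (fun y => (RtoC (/ (2 * PI)) * p y *
       CInt (fun xi => (RtoC (weight eps xi) * Cexpi (xi * (x - y)))%C) (- N) N)%C) (- A) A.
Proof.
  intros Hp.
  assert (Hc2 : Ccontinuous2 (fun xi y =>
    ((RtoC (/ (2 * PI)) * p y) * (RtoC (weight eps xi) * Cexpi (xi * (x - y))))%C)).
  { apply Ccontinuous2_mult; [apply Ccontinuous2_snd; auto with cont|].
    apply Ccontinuous2_mult; [apply (Ccontinuous2_fst (fun xi => RtoC (weight eps xi))); auto with cont|].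
    auto with cont. }
  rewrite (CInt_ext _ (fun xi => CInt (fun y =>
    ((RtoC (/ (2 * PI)) * p y) * (RtoC (weight eps xi) * Cexpi (xi * (x - y))))%C) (- A) A)).
  - rewrite (CInt_Fubini _ (- N) N (- A) A Hc2). apply CInt_ext; intros y.
    apply CInt_mult_l. auto 6 with cont.
  - intros xi. unfold fkernel, truncated_FT.
    rewrite (CInt_ext (fun y => ((RtoC (/ (2 * PI)) * p y) * (RtoC (weight eps xi) * Cexpi (xi * (x - y))))%C)
      (fun y => ((RtoC (weight eps xi) * (RtoC (/ (2 * PI)) * Cexpi (x * xi))) * (p y * Cexpi (- (y * xi))))%C)).
    + rewrite CInt_mult_l by auto 7 with cont. ring.
    + intros y. replace (xi * (x - y)) with (x * xi + - (y * xi)) by ring. rewrite Cexpi_plus. ring.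
Qed.

(** After Fubini the inner integral is, by [CInt_abel], the Poisson kernel up to a boundary error
    uniform in y, which is then integrated against |p|. *)
Lemma abel_mean_poisson (p : R -> C) (l eps x N A : R) :
  Ccontinuous p -> (forall u v, u <= v -> RInt (fun y => Cmod (p y)) u v <= l) -> 0 <= l ->
  0 < eps -> 0 <= N -> 0 <= A ->
  Cmod (CInt (fun xi => (RtoC (weight eps xi) * fkernel x (truncated_FT p A) xi)%C) (- N) N
        - CInt (fun y => (RtoC (/ PI * cauchy eps (x - y)) * p y)%C) (- A) A)
  <= l * (weight eps N / eps).
Proof.
  intros Hp Hl Hl0 He HN HA. assert (HP := PI_RGT_0).
  assert (Hcc := continuity_cauchy eps x He).
  rewrite abel_mean_truncated by exact Hp.
  assert (Hci : Ccontinuous (fun y => CInt (fun xi => (RtoC (weight eps xi) * Cexpi (xi * (x - y)))%C) (- N) N)).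
  { apply (Ccontinuous_CInt_param (fun y xi => (RtoC (weight eps xi) * Cexpi (xi * (x - y)))%C)).
    apply Ccontinuous2_mult; [apply (Ccontinuous2_snd (fun xi => RtoC (weight eps xi))); auto with cont|].
    auto with cont. }
  rewrite <- CInt_minus by auto with cont.
  assert (Hw : 0 < weight eps N / eps) by (apply Rdiv_lt_0_compat; [apply weight_pos|exact He]).
  eapply Rle_trans.
  - apply (Cmod_CInt_le _ (fun y => weight eps N / eps * Cmod (p y))); [lra|auto with cont|auto with cont|].
    intros y _.
    replace (_ - _)%C with (RtoC (/ (2 * PI)) * p y *
      (CInt (fun xi => (RtoC (weight eps xi) * Cexpi (xi * (x - y)))%C) (- N) N
       - RtoC (2 * cauchy eps (x - y))))%C.
    2:{ replace (/ PI * cauchy eps (x - y)) with (/ (2 * PI) * (2 * cauchy eps (x - y))) by (field; lra).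
        rewrite (RtoC_mult (/ (2 * PI))). ring. }
    rewrite !Cmod_mult, Cmod_R, Rabs_pos_eq by (left; apply inv_2PI_pos).
    assert (B := CInt_abel eps (x - y) N He HN).
    apply Rle_trans with (/ (2 * PI) * Cmod (p y) * (2 * (weight eps N / eps))).
    + apply Rmult_le_compat_l; [|exact B].
      apply Rmult_le_pos; [left; apply inv_2PI_pos|apply Cmod_ge_0].
    + replace (/ (2 * PI) * Cmod (p y) * (2 * (weight eps N / eps)))
        with (/ PI * (weight eps N / eps * Cmod (p y))) by (field; lra).
      rewrite <- (Rmult_1_l (weight eps N / eps * Cmod (p y))) at 2.
      apply Rmult_le_compat_r; [apply Rmult_le_pos; [lra|apply Cmod_ge_0]|].
      rewrite <- Rinv_1. apply Rinv_le_contravar; [lra|]. generalize PI2_3_2; lra.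
  - rewrite (RInt_scal (V := R_CompleteNormedModule)) by auto with cont.
    unfold scal; simpl; unfold mult; simpl.
    rewrite (Rmult_comm l). apply Rmult_le_compat_l; [lra|]. apply Hl; lra.
Qed.

(** The inverse transform [q] of [ph] exists by decay and has to be identified with [p]. Between q x
    and p x lie the truncated inversion integral, its Abel mean, the Abel mean for the truncated
    transform, and the Poisson integral of [p]. The parameters are chosen in the order eps, N, A,
    each depending on the earlier ones. *)
Lemma Fourier_inversion (a B : R) (p ph : R -> C) :
  0 < a -> Ccontinuous p -> L1 p -> is_FT p ph -> decay a B ph -> iFT ph p.
Proof.
  intros Ha Hp Hp1 Hph HB.
  destruct (truncated_FT_approx p ph Hp Hp1 Hph) as [l [Hl0 [Hl Htr]]].
  destruct (iFT_exists a B ph Ha HB) as [q Hq].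
  apply (iFT_ext ph ph q); trivial. intros x.
  apply Ceq_of_arbitrarily_close; intros eta0 Heta0.
  (* Four links of the chain cost [eta] each, and the approximate identity costs [3 * eta]. *)
  set (eta := eta0 / 7). assert (Heta : 0 < eta) by (unfold eta; lra).
  assert (HP := PI_RGT_0). assert (HB0 := decay_nonneg _ _ _ HB).
  destruct (approximate_identity p l x eta Hp Hl Heta) as [e0 [He0 Hid]].
  set (K := 2 / a * B / (PI * (a / 2))).
  assert (HK : 0 <= K).
  { unfold K. apply Rdiv_le_0_compat; [|nra]. apply Rmult_le_pos; [|exact HB0].
    left; apply Rdiv_lt_0_compat; lra. }
  set (eps := Rmin e0 (eta / (K + 1))).
  assert (E1 := Rmin_l e0 (eta / (K + 1))). assert (E2 := Rmin_r e0 (eta / (K + 1))).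
  assert (He : 0 < eps) by (apply Rmin_pos; [exact He0|apply Rdiv_lt_0_compat; lra]).
  fold eps in E1, E2.
  assert (HeK : eps * K <= eta).
  { assert (E : eta / (K + 1) * (K + 1) = eta) by (field; lra). nra. }
  destruct (Hid eps (conj He E1)) as [A1 HA1].
  destruct (Hq x eta Heta) as [N1 HN1].
  destruct (weight_small eps (eps * eta / (l + 1)) He) as [N2 [HN2 HW]].
  { apply Rdiv_lt_0_compat; nra. }
  set (N := Rmax (Rmax N1 N2) 0).
  assert (F1 := Rmax_l (Rmax N1 N2) 0). assert (F2 := Rmax_r (Rmax N1 N2) 0). fold N in F1, F2.
  assert (F3 := Rmax_l N1 N2). assert (F4 := Rmax_r N1 N2).
  specialize (HN1 (- N) N ltac:(lra) ltac:(lra)). specialize (HW N ltac:(lra)).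
  assert (HlW : l * (weight eps N / eps) <= eta).
  { apply Rle_trans with (l * (eps * eta / (l + 1) / eps)).
    - apply Rmult_le_compat_l; [exact Hl0|]. unfold Rdiv at 1 2.
      apply Rmult_le_compat_r; [left; apply Rinv_0_lt_compat, He|exact HW].
    - replace (eps * eta / (l + 1) / eps) with (eta / (l + 1)) by (field; lra).
      assert (E : eta / (l + 1) * (l + 1) = eta) by (field; lra).
      assert (0 < eta / (l + 1)) by (apply Rdiv_lt_0_compat; lra). lra. }
  (* The truncation error is integrated over xi in [-N, N], so it is taken small relative to N. *)
  destruct (Htr (eta / (N + 1))) as [A2 [HA2 Htau]]; [apply Rdiv_lt_0_compat; lra|].
  set (A := Rmax A1 A2).
  assert (G1 := Rmax_l A1 A2). assert (G2 := Rmax_r A1 A2). fold A in G1, G2.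
  specialize (HA1 A G1 ltac:(lra)). specialize (Htau A G2).
  assert (Hphc : Ccontinuous ph) by apply HB.
  assert (Htc := Ccontinuous_truncated_FT p A Hp).
  assert (S1 := abel_mean_error a B eps x N ph Ha He F2 HB). fold K in S1.
  assert (S2 : Cmod (CInt (fun xi => (RtoC (weight eps xi) * fkernel x ph xi)%C) (- N) N
     - CInt (fun xi => (RtoC (weight eps xi) * fkernel x (truncated_FT p A) xi)%C) (- N) N) <= eta).
  { rewrite <- CInt_minus by auto with cont.
    eapply Rle_trans.
    - apply Cmod_CInt_le_const with (M := / 2 * (eta / (N + 1))); [lra|auto with cont|].
      intros xi _.
      replace (_ - _)%C with (RtoC (weight eps xi) * fkernel x (fun xi => (ph xi - truncated_FT p A xi)%C) xi)%C
        by (unfold fkernel; ring).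
      rewrite Cmod_scal, Cmod_fkernel by (left; apply weight_pos).
      assert (W := weight_pos eps xi). assert (W1 := weight_le_1 eps xi ltac:(lra)).
      specialize (Htau xi). assert (H0 := Cmod_ge_0 (ph xi - truncated_FT p A xi)).
      assert (HP2 : / (2 * PI) <= / 2) by (apply Rinv_le_contravar; [lra|generalize PI2_3_2; lra]).
      assert (HP3 := inv_2PI_pos).
      apply Rle_trans with (1 * (/ (2 * PI) * Cmod (ph xi - truncated_FT p A xi))).
      + apply Rmult_le_compat_r; [|exact W1]. apply Rmult_le_pos; lra.
      + rewrite Rmult_1_l. apply Rmult_le_compat; lra.
    - assert (E : eta / (N + 1) * (N + 1) = eta) by (field; lra).
      assert (0 < eta / (N + 1)) by (apply Rdiv_lt_0_compat; lra). lra. }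
  assert (S3 := abel_mean_poisson p l eps x N A Hp Hl Hl0 He F2 ltac:(lra)).
  set (c1 := CInt (fkernel x ph) (- N) N) in *.
  set (c2 := CInt (fun xi => (RtoC (weight eps xi) * fkernel x ph xi)%C) (- N) N) in *.
  set (c3 := CInt (fun xi => (RtoC (weight eps xi) * fkernel x (truncated_FT p A) xi)%C) (- N) N) in *.
  set (c4 := CInt (fun y => (RtoC (/ PI * cauchy eps (x - y)) * p y)%C) (- A) A) in *.
  assert (T1 := Cmod_minus_triangle (q x) c1 (p x)).
  assert (T2 := Cmod_minus_triangle c1 c2 (p x)).
  assert (T3 := Cmod_minus_triangle c2 c3 (p x)).
  assert (T4 := Cmod_minus_triangle c3 c4 (p x)).
  rewrite (Cmod_minus_sym (q x) c1) in T1.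
  unfold eta in *. lra.
Qed.

(** * Square integrability of inverse Fourier transforms *)

Definition truncated_iFT (F : R -> C) (r x : R) : C := CInt (fkernel x F) (- r) r.

Lemma Ccontinuous_truncated_iFT (F : R -> C) (r : R) :
  Ccontinuous F -> Ccontinuous (truncated_iFT F r).
Proof.
  intros HF. apply (Ccontinuous_CInt_param (fun x xi => fkernel x F xi)).
  unfold fkernel. apply Ccontinuous2_mult; [apply (Ccontinuous2_fst (fun _ => RtoC (/ (2 * PI)))); auto with cont|].
  apply Ccontinuous2_mult; [apply Ccontinuous2_snd, HF|auto with cont].
Qed.

(** The function dominating the kernel does not involve x, so one [r] serves all x. *)
Lemma iFT_tail (a B : R) (F f : R -> C) (tau : R) :
  0 < a -> decay a B F -> iFT F f -> 0 < tau ->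
  exists r, 0 <= r /\ forall x, Cmod (f x - truncated_iFT F r x) <= tau.
Proof.
  intros Ha HF Hf Htau. assert (HB := decay_nonneg _ _ _ HF). assert (HP := inv_2PI_pos).
  set (g := fun xi => / (2 * PI) * B * weight a xi).
  assert (Hg0 : forall xi, 0 <= g xi).
  { intros xi; unfold g. apply Rmult_le_pos; [nra|left; apply weight_pos]. }
  destruct (nonneg_bounded_integral g (B / (PI * a))) as [l [_ [Hl Hc]]].
  - unfold g; auto with cont.
  - exact Hg0.
  - intros N HN. apply RInt_fkernel_weight; trivial; lra.
  - destruct (Hc tau Htau) as [M HM].
    assert (B1 := Rmax_l M 0). assert (B2 := Rmax_r M 0).
    specialize (HM (- Rmax M 0) (Rmax M 0) ltac:(lra) B1). apply Rabs_def2 in HM.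
    exists (Rmax M 0); split; [exact B2|]. intros x.
    apply (Iint_tail _ g l); trivial.
    + apply Ccontinuous_fkernel, HF.
    + unfold g; auto with cont.
    + intros xi; apply Cmod_fkernel_decay, HF.
    + lra.
Qed.

(* Testing against the Abel weight turns the double integral of [F] into one against the
   Poisson kernel, whose mass does not depend on [eps]. *)
Lemma abel_weighted_square (a B eps r N : R) (F : R -> C) :
  0 < a -> decay a B F -> 0 < eps -> 0 <= r -> 0 <= N -> 2 * r * (weight eps N / eps) <= 1 ->
  Cmod (CInt (fun x => (RtoC (weight eps x) * (truncated_iFT F r x * Cconj (truncated_iFT F r x)))%C) (- N) N)
  <= 2 * B * (B / (PI * a)).
Proof.
  intros Ha HF He Hr HN Hsmall. assert (HB := decay_nonneg _ _ _ HF). assert (HP := PI_RGT_0).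
  assert (HFc : Ccontinuous F) by apply HF.
  set (fr := truncated_iFT F r).
  assert (Hfr : Ccontinuous fr) by (apply Ccontinuous_truncated_iFT, HFc).
  (* [G] is the transform of the Abel-weighted [fr] on [-N, N], that is, up to a boundary error, [F]
     cut off to [-r, r] and smoothed by the Poisson kernel. Hence the bound below, free of [eps],
     [r] and [N]. *)
  set (G := fun xi => CInt (fun x => (RtoC (weight eps x) * fr x * Cexpi (- (x * xi)))%C) (- N) N).
  assert (HGc : Ccontinuous G).
  { apply (Ccontinuous_CInt_param (fun xi x => (RtoC (weight eps x) * fr x * Cexpi (- (x * xi)))%C)).
    apply Ccontinuous2_mult; [apply (Ccontinuous2_snd (fun x => (RtoC (weight eps x) * fr x)%C))|];
      auto with cont. }
  assert (HG : forall xi, Cmod (G xi) <= 2 * B).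
  { intros xi. unfold G.
    assert (Hc2 : Ccontinuous2 (fun x eta =>
      ((RtoC (/ (2 * PI)) * F eta) * (RtoC (weight eps x) * Cexpi (x * (eta - xi))))%C)).
    { apply Ccontinuous2_mult; [apply (Ccontinuous2_snd (fun eta => (RtoC (/ (2 * PI)) * F eta)%C)); auto with cont|].
      apply Ccontinuous2_mult; [apply (Ccontinuous2_fst (fun x => RtoC (weight eps x))); auto with cont|].
      auto with cont. }
    rewrite (CInt_ext _ (fun x => CInt (fun eta =>
      ((RtoC (/ (2 * PI)) * F eta) * (RtoC (weight eps x) * Cexpi (x * (eta - xi))))%C) (- r) r)).
    2:{ intros x. unfold fr, truncated_iFT.
        rewrite (CInt_ext (fun eta => ((RtoC (/ (2 * PI)) * F eta) * (RtoC (weight eps x) * Cexpi (x * (eta - xi))))%C)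
          (fun eta => ((RtoC (weight eps x) * Cexpi (- (x * xi))) * fkernel x F eta)%C)).
        - rewrite CInt_mult_l by auto with cont. ring.
        - intros eta. unfold fkernel. replace (x * (eta - xi)) with (x * eta + - (x * xi)) by ring.
          rewrite Cexpi_plus. ring. }
    rewrite (CInt_Fubini _ (- N) N (- r) r Hc2).
    rewrite (CInt_ext _ (fun eta => (RtoC (/ (2 * PI)) * F eta *
      CInt (fun x => (RtoC (weight eps x) * Cexpi (x * (eta - xi)))%C) (- N) N)%C))
      by (intros; apply CInt_mult_l; auto 6 with cont).
    assert (Hci : Ccontinuous (fun eta => CInt (fun x => (RtoC (weight eps x) * Cexpi (x * (eta - xi)))%C) (- N) N)).
    { apply (Ccontinuous_CInt_param (fun eta x => (RtoC (weight eps x) * Cexpi (x * (eta - xi)))%C)).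
      apply Ccontinuous2_mult; [apply (Ccontinuous2_snd (fun x => RtoC (weight eps x))); auto with cont|].
      auto with cont. }
    assert (Hcc := continuity_cauchy eps xi He).
    eapply Rle_trans.
    - apply (Cmod_CInt_le _ (fun eta => / PI * B * cauchy eps (xi - eta) + / PI * B * (weight eps N / eps) * 1));
        [lra|auto with cont|auto with cont|].
      intros eta _. rewrite !Cmod_mult, Cmod_R, Rabs_pos_eq by (left; apply inv_2PI_pos).
      assert (B1 := CInt_abel eps (eta - xi) N He HN).
      assert (B2 := Cmod_le_minus (CInt (fun x => (RtoC (weight eps x) * Cexpi (x * (eta - xi)))%C) (- N) N)
        (RtoC (2 * cauchy eps (eta - xi)))).
      rewrite Cmod_R, Rabs_pos_eq in B2 by (generalize (cauchy_pos eps (eta - xi) He); lra).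
      assert (B3 := decay_bounded a B F eta ltac:(lra) HF).
      replace (/ PI * B * cauchy eps (xi - eta) + / PI * B * (weight eps N / eps) * 1)
        with (/ (2 * PI) * B * (2 * cauchy eps (eta - xi) + 2 * (weight eps N / eps))).
      2:{ unfold cauchy. replace ((xi - eta) ^ 2) with ((eta - xi) ^ 2) by ring.
          generalize (cauchy_denominator_pos eps (eta - xi) He); intros Hd. field. lra. }
      apply Rmult_le_compat; [|apply Cmod_ge_0| |lra].
      + apply Rmult_le_pos; [left; apply inv_2PI_pos|apply Cmod_ge_0].
      + apply Rmult_le_compat_l; [left; apply inv_2PI_pos|exact B3].
    (* The mass of the Poisson kernel accounts for one [B], and the boundary error, by [Hsmall], for
       at most another. *)
    - rewrite RInt_lin2 by auto with cont.
      rewrite RInt_const. unfold scal; simpl; unfold mult; simpl.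
      assert (B1 := RInt_cauchy_le eps xi (- r) r He).
      assert (HPB : 0 <= / PI * B) by (apply Rmult_le_pos; [left; apply Rinv_0_lt_compat, HP|exact HB]).
      assert (B4 : / PI * B * RInt (fun y => cauchy eps (xi - y)) (- r) r <= / PI * B * PI)
        by (apply Rmult_le_compat_l; trivial).
      replace (/ PI * B * PI) with B in B4 by (field; lra).
      assert (B5 : / PI * B * (2 * r * (weight eps N / eps)) <= B).
      { assert (/ PI <= 1) by (rewrite <- Rinv_1; apply Rinv_le_contravar; [lra|generalize PI2_3_2; lra]).
        apply Rle_trans with (/ PI * B * 1); [apply Rmult_le_compat_l; trivial|nra]. }
      lra. }
  (* Expanding the conjugate factor and exchanging the integrals leaves the integral over [-r, r] of
     conj F times [G], divided by 2 pi. *)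
  assert (Hc2 : Ccontinuous2 (fun x xi =>
    ((RtoC (/ (2 * PI)) * Cconj (F xi)) * (RtoC (weight eps x) * fr x * Cexpi (- (x * xi))))%C)).
  { apply Ccontinuous2_mult; [apply (Ccontinuous2_snd (fun xi => (RtoC (/ (2 * PI)) * Cconj (F xi))%C)); auto with cont|].
    apply Ccontinuous2_mult; [apply (Ccontinuous2_fst (fun x => (RtoC (weight eps x) * fr x)%C)); auto with cont|].
    auto with cont. }
  rewrite (CInt_ext _ (fun x => CInt (fun xi =>
    ((RtoC (/ (2 * PI)) * Cconj (F xi)) * (RtoC (weight eps x) * fr x * Cexpi (- (x * xi))))%C) (- r) r)).
  2:{ intros x. unfold fr at 2. unfold truncated_iFT.
      rewrite <- CInt_conj by auto with cont.
      rewrite (CInt_ext (fun xi => ((RtoC (/ (2 * PI)) * Cconj (F xi)) * (RtoC (weight eps x) * fr x * Cexpi (- (x * xi))))%C)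
        (fun xi => ((RtoC (weight eps x) * fr x) * Cconj (fkernel x F xi))%C)).
      - rewrite CInt_mult_l by auto with cont. ring.
      - intros xi. unfold fkernel. rewrite !Cmult_conj, Cconj_Cexpi.
        replace (Cconj (RtoC (/ (2 * PI)))) with (RtoC (/ (2 * PI))) by (apply C_eq; simpl; ring). ring. }
  rewrite (CInt_Fubini _ (- N) N (- r) r Hc2).
  rewrite (CInt_ext _ (fun xi => (RtoC (/ (2 * PI)) * Cconj (F xi) * G xi)%C))
    by (intros; apply CInt_mult_l; auto 6 with cont).
  eapply Rle_trans.
  - apply (Cmod_CInt_le _ (fun xi => 2 * B * (/ (2 * PI) * B * weight a xi)));
      [lra|auto with cont|auto with cont|].
    intros xi _. rewrite !Cmod_mult, Cmod_R, Cmod_conj, Rabs_pos_eq by (left; apply inv_2PI_pos).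
    rewrite Rmult_comm. apply Rmult_le_compat; [apply Cmod_ge_0| |apply HG|].
    + apply Rmult_le_pos; [left; apply inv_2PI_pos|apply Cmod_ge_0].
    + rewrite Rmult_assoc. apply Rmult_le_compat_l; [left; apply inv_2PI_pos|apply HF].
  - rewrite (RInt_scal (V := R_CompleteNormedModule)) by auto with cont.
    apply Rmult_le_compat_l; [lra|]. apply RInt_fkernel_weight; trivial; lra.
Qed.

(** On [-M, M] the Abel factor of rate 1 / (M + 1) is at least exp(-1) >= 1/3, so removing it costs
    a factor 3. The bound depends on neither [r] nor [M], as the passage to the limit requires. *)
Lemma truncated_iFT_square_bound (a B r M : R) (F : R -> C) :
  0 < a -> decay a B F -> 0 <= r -> 0 <= M ->
  RInt (fun x => Cmod (truncated_iFT F r x) ^ 2) (- M) M <= 6 * B * (B / (PI * a)).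
Proof.
  intros Ha HF Hr HM. assert (HFc : Ccontinuous F) by apply HF.
  assert (Hfr := Ccontinuous_truncated_iFT F r HFc).
  set (fr := truncated_iFT F r) in *.
  set (eps := / (M + 1)). assert (He : 0 < eps) by (apply Rinv_0_lt_compat; lra).
  destruct (weight_small eps (eps / (2 * r + 1)) He) as [N0 [HN0 HN]].
  { apply Rdiv_lt_0_compat; lra. }
  set (N := Rmax N0 M). assert (B1 := Rmax_l N0 M). assert (B2 := Rmax_r N0 M). fold N in B1, B2.
  specialize (HN N B1).
  assert (Hsq := abel_weighted_square a B eps r N F Ha HF He Hr ltac:(lra)). fold fr in Hsq.
  assert (Hs : 2 * r * (weight eps N / eps) <= 1).
  { apply Rle_trans with (2 * r * (eps / (2 * r + 1) / eps)).
    - apply Rmult_le_compat_l; [lra|]. unfold Rdiv at 1 2.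
      apply Rmult_le_compat_r; [left; apply Rinv_0_lt_compat, He|exact HN].
    - replace (eps / (2 * r + 1) / eps) with (/ (2 * r + 1)) by (field; lra).
      apply Rmult_le_reg_r with (2 * r + 1); [lra|]. rewrite Rmult_assoc, Rinv_l; lra. }
  specialize (Hsq Hs).
  set (h := fun x => weight eps x * Cmod (fr x) ^ 2).
  assert (Hh : continuity h) by (unfold h; auto with cont).
  assert (E : RInt h (- N) N <= 2 * B * (B / (PI * a))).
  { eapply Rle_trans; [|exact Hsq].
    eapply Rle_trans; [|apply Cmod_fst]. eapply Rle_trans; [|apply Rle_abs].
    unfold CInt; simpl. right. apply RInt_ext. intros x _. unfold h. rewrite Cmod2_alt. simpl.
    unfold Re, Im. ring. }
  assert (Hh0 : forall x, 0 <= h x).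
  { intros x. apply Rmult_le_pos; [left; apply weight_pos|apply pow2_ge_0]. }
  assert (E' : RInt h (- M) M <= RInt h (- N) N) by (apply RInt_nonneg_mono; trivial; lra).
  apply Rle_trans with (RInt (fun x => 3 * h x) (- M) M).
  - apply RInt_le; auto with cont; [lra|]. intros x Hx. unfold h.
    assert (Hw : / 3 <= weight eps x).
    { unfold weight. apply Rle_trans with (exp (- (1))).
      - rewrite exp_Ropp. apply Rinv_le_contravar; [apply exp_pos|]. generalize exp_le_3; lra.
      - apply exp_mono. assert (Rabs x <= M) by (apply Rabs_le; lra).
        assert (eps * (M + 1) = 1) by (unfold eps; field; lra). nra. }
    generalize (pow2_ge_0 (Cmod (fr x))). nra.
  - rewrite (RInt_scal (V := R_CompleteNormedModule)) by auto with cont.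
    unfold scal; simpl; unfold mult; simpl. lra.
Qed.

(** On [-M, M], [f] is replaced by a truncation with a uniform error tau that is small relative to
    M. Since (s + tau)^2 <= 2 s^2 + 2 tau^2, the integral of |f|^2 over [-M, M] has a bound
    independent of M. *)
Lemma iFT_L2 (a B : R) (F f : R -> C) : 0 < a -> decay a B F -> iFT F f -> L2 f.
Proof.
  intros Ha HF Hf.
  assert (Hfc : Ccontinuous f).
  { assert (HF' := decay_times_ixi a B F Ha HF).
    destruct (iFT_exists (a / 2) _ _ ltac:(lra) HF') as [g Hg].
    exact (Cderiv_continuous f g (iFT_derivative a B F f g Ha HF Hf Hg)). }
  destruct Hfc as [Hf1 Hf2].
  split; [|split].
  - intros u v; constructor. apply ex_RInt_Reals_0; auto with cont.
  - intros u v; constructor. apply ex_RInt_Reals_0; auto with cont.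
  - assert (Hfc : Ccontinuous f) by (split; trivial).
    assert (Hc : continuity (fun x => Cmod (f x) ^ 2)) by auto with cont.
    destruct (nonneg_bounded_integral (fun x => Cmod (f x) ^ 2) (2 * (6 * B * (B / (PI * a))) + 1))
      as [l [_ [_ Hl]]].
    + exact Hc.
    + intros x; apply pow2_ge_0.
    + intros M HM.
      (* As tau <= 1, the error term is at most 2 tau on a segment of length 2 M. Its integral is at
         most 1, the summand in the bound above. *)
      set (tau := / (2 * (2 * M + 1))).
      assert (Htau : 0 < tau) by (apply Rinv_0_lt_compat; lra).
      assert (Etau : 2 * (2 * M + 1) * tau = 1) by (unfold tau; field; lra).
      assert (Htau1 : tau <= 1) by nra.
      destruct (iFT_tail a B F f tau Ha HF Hf Htau) as [r [Hr Htail]].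
      assert (HQ := truncated_iFT_square_bound a B r M F Ha HF Hr HM).
      assert (Hfr := Ccontinuous_truncated_iFT F r (proj1 HF)).
      set (fr := truncated_iFT F r) in *.
      apply Rle_trans with (RInt (fun x => 2 * Cmod (fr x) ^ 2 + 2 * tau * 1) (- M) M).
      * apply RInt_le; auto 6 with cont; [lra|]. intros x _.
        assert (T := Cmod_le_minus (f x) (fr x)). specialize (Htail x).
        assert (H0 := Cmod_ge_0 (f x)). assert (H1 := Cmod_ge_0 (fr x)).
        assert (H2 : Cmod (f x) <= Cmod (fr x) + tau) by lra.
        apply Rle_trans with ((Cmod (fr x) + tau) ^ 2); [apply pow_incr; lra|].
        assert (0 <= (Cmod (fr x) - tau) ^ 2) by apply pow2_ge_0. nra.
      * rewrite RInt_lin2 by auto with cont. rewrite RInt_const.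
        unfold scal; simpl; unfold mult; simpl in *. nra.
    + exists l. apply improper_integral_iff; trivial.
Qed.

(** * The band-limited integral equation *)

Lemma sqrt2_le : sqrt 2 <= 3 / 2.
Proof. apply Rsqr_incr_0_var; [|lra]. rewrite Rsqr_sqrt by lra. unfold Rsqr; lra. Qed.

Section Symbol.

Variables (lam : R) (b : R -> R).
Hypotheses (Hlam : 0 < lam) (Hb : continuity b) (Hb01 : forall xi, 0 <= b xi <= 1)
  (Hb0 : forall xi, sqrt 2 * lam <= Rabs xi -> b xi = 0).

Definition symbol (xi : R) : R := b xi / (4 * lam ^ 2 - xi ^ 2).

Lemma symbol_zero (xi : R) : sqrt 2 * lam <= Rabs xi -> symbol xi = 0.
Proof. intros H; unfold symbol, Rdiv; rewrite Hb0 by exact H; ring. Qed.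

Lemma symbol_support (xi : R) : 3 / 2 * lam <= Rabs xi -> symbol xi = 0.
Proof. intros H; apply symbol_zero. generalize sqrt2_le; nra. Qed.

(** Where b is not forced to vanish, xi^2 <= 2 lam^2, so the denominator is at least 2 lam^2. *)
Lemma symbol_bound (xi : R) : Rabs (symbol xi) <= / (2 * lam ^ 2).
Proof.
  assert (Hl : 0 < lam ^ 2) by (apply pow_lt, Hlam).
  destruct (Rlt_le_dec (Rabs xi) (sqrt 2 * lam)) as [H|H].
  - assert (Hxi : xi ^ 2 <= 2 * lam ^ 2).
    { rewrite <- (pow2_abs xi).
      replace (2 * lam ^ 2) with ((sqrt 2 * lam) ^ 2) by (rewrite Rpow_mult_distr, pow2_sqrt; lra).
      apply pow_incr; split; [apply Rabs_pos|lra]. }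
    unfold symbol, Rdiv. rewrite Rabs_mult, Rabs_inv, !Rabs_pos_eq by (try apply Hb01; lra).
    rewrite <- (Rmult_1_l (/ (2 * lam ^ 2))).
    apply Rmult_le_compat; try apply Hb01.
    + left; apply Rinv_0_lt_compat; lra.
    + apply Rinv_le_contravar; lra.
  - rewrite symbol_zero, Rabs_R0 by exact H. left; apply Rinv_0_lt_compat; lra.
Qed.

Lemma symbol_bound_id (xi : R) : Rabs xi * Rabs (symbol xi) <= 3 / (4 * lam).
Proof.
  destruct (Rlt_le_dec (Rabs xi) (3 / 2 * lam)) as [H|H].
  - apply Rle_trans with (3 / 2 * lam * / (2 * lam ^ 2)).
    + apply Rmult_le_compat; [apply Rabs_pos|apply Rabs_pos|lra|apply symbol_bound].
    + right; field; lra.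
  - rewrite symbol_support, Rabs_R0, Rmult_0_r by exact H. left; apply Rdiv_lt_0_compat; lra.
Qed.

(* The denominator vanishes at [2 * lam], but the numerator vanishes near that point. *)
Lemma continuity_symbol : continuity symbol.
Proof.
  intros x. destruct (Rlt_le_dec (Rabs x) (2 * lam)) as [H|H].
  - apply (continuity_pt_div b (fun xi => 4 * lam ^ 2 - xi ^ 2)).
    + apply Hb.
    + apply continuity_Rminus; auto with cont.
    + rewrite <- (pow2_abs x). generalize (Rabs_pos x). nra.
  (* As |x| >= 2 lam, this radius keeps |y| >= 3/2 lam, where the symbol is zero. *)
  - intros eps He. exists (lam / 2); split; [lra|]. intros y [_ Hy].
    simpl in *. unfold Rdist in *.
    assert (3 / 2 * lam <= Rabs y).
    { generalize (Rabs_triang_inv x y). rewrite Rabs_minus_sym. lra. }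
    rewrite !symbol_support by lra. rewrite Rminus_diag, Rabs_R0. exact He.
Qed.

End Symbol.

Lemma smooth_continuity (b : R -> R) : smooth b -> continuity b.
Proof.
  intros [d [<- Hd]] x. apply derivable_continuous_pt. exists (d 1%nat x). apply Hd.
Qed.

Lemma decay_L1 (a B : R) (F : R -> C) : 0 < a -> decay a B F -> L1 F.
Proof.
  intros Ha HF. assert (HB := decay_nonneg _ _ _ HF). destruct HF as [HF HFB].
  assert (Hc : continuity (fun x => Cmod (F x))) by auto with cont.
  destruct (nonneg_bounded_integral (fun x => Cmod (F x)) (B * (2 / a))) as [l [_ [_ Hl]]].
  - exact Hc.
  - intros x; apply Cmod_ge_0.
  - intros N HN. eapply Rle_trans; [|apply RInt_scal_weight with (u := - N) (v := N); trivial; lra].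
    apply RInt_le; auto with cont; lra.
  - destruct HF as [HF1 HF2]. split; [|split].
    + intros u v; constructor. apply ex_RInt_Reals_0; auto with cont.
    + intros u v; constructor. apply ex_RInt_Reals_0; auto with cont.
    + exists l. apply improper_integral_iff; trivial.
Qed.

Theorem theorem7p6 (lam Gam a : R) (b : R -> R) (p : R -> Cpx) :
  0 < lam -> 0 < Gam -> 0 < a ->
  lam > 6 * Rmax Gam (/ a) ->
  smooth b ->
  (forall xi, 0 <= b xi <= 1) ->
  (forall xi, Rabs xi <= lam -> b xi = 1) ->
  (forall xi, sqrt 2 * lam <= Rabs xi -> b xi = 0) ->
  Ccontinuous p -> L1 p ->
  (exists ph : R -> Cpx, is_FT p ph /\
     forall xi, Cnorm (ph xi) <= Gam * exp (- (a * Rabs xi))) ->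
  exists sigma sigmah : R -> Cpx,
    L2 sigma /\ Csmooth sigma /\
    L1 sigmah /\ is_invFT sigmah sigma /\
    (exists g dg : R -> Cpx,
       Tb b lam sigmah g /\
       (forall x, Cderiv g x (dg x)) /\
       (forall x, sigma x = Cadd (S_op lam (g x) (dg x)) (p x))) /\
    (forall xi, Cnorm (sigmah xi) <= 2 * Gam * exp (- ((a - / lam) * Rabs xi))).
Proof.
  intros Hlam HGam Ha Hmax Hsm Hb01 _ Hb0 Hp Hp1 [ph [HFT Hbound]].
  assert (Hlg : 6 * Gam < lam) by (generalize (Rmax_l Gam (/ a)); lra).
  assert (Hb := smooth_continuity b Hsm).
  assert (Hm := continuity_symbol lam b Hlam Hb Hb0).
  assert (Hm0 := symbol_bound lam b Hlam Hb01 Hb0).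
  assert (Hm1 := symbol_bound_id lam b Hlam Hb01 Hb0).
  assert (Hs := symbol_support lam b Hlam Hb0).
  set (m := symbol lam b) in *.
  assert (Hph : decay a Gam ph) by (split; [exact (Ccontinuous_FT p ph Hp Hp1 HFT)|exact Hbound]).
  assert (Hinv := Fourier_inversion a Gam p ph Ha Hp Hp1 HFT Hph).
  destruct (Phi_fixed_point lam Gam a m ph Hlam HGam Ha Hlg Hm Hm0 Hm1 Hph) as [F [HF HFix]].
  assert (M1 := mul_symbol_decay lam a m Hm Hm0 _ _ HF).
  assert (M2 := times_ixi_mul_symbol_decay lam a m Hm Hm0 Hm1 _ _ HF).
  destruct (iFT_exists _ _ _ Ha HF) as [sigma Hsigma].
  destruct (iFT_exists _ _ _ Ha M1) as [g Hg].
  destruct (iFT_exists _ _ _ Ha M2) as [dg Hdg].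
  exists sigma, F.
  split; [exact (iFT_L2 a _ F sigma Ha HF Hsigma)|].
  split; [exact (iFT_smooth a _ F sigma Ha HF Hsigma)|].
  split; [exact (decay_L1 a _ F Ha HF)|].
  split; [apply iFT_is_invFT; [apply HF|exact Hsigma]|].
  split.
  - exists g, dg. split; [|split].
    + unfold Tb.
      replace (fun xi => Cscale (b xi / (4 * lam ^ 2 - xi ^ 2)) (F xi)) with (mul_symbol m F).
      * apply iFT_is_invFT; [apply M1|exact Hg].
      * apply functional_extensionality; intros xi. symmetry; apply Cscale_RtoC.
    + exact (iFT_derivative a _ _ g dg Ha M1 Hg Hdg).
    (* [sigma] and S[g] + p are both inverse transforms of the fixed point [F], hence equal at every
       point. *)
    + apply (iFT_unique F); [exact Hsigma|].
      apply (iFT_ext (Phi lam m ph F) F (fun x => (S_op lam (g x) (dg x) + p x)%C));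
        [intros xi; symmetry; apply HFix|reflexivity|].
      exact (iFT_Phi lam Gam a m ph Hlam HGam Ha Hlg Hm Hm0 Hm1 Hph F p g dg HF Hs Hinv Hg Hdg).
  - intros xi. eapply Rle_trans; [exact (proj2 HF xi)|].
    apply Rmult_le_compat_l; [lra|]. apply exp_mono.
    assert (0 < / lam) by (apply Rinv_0_lt_compat, Hlam). generalize (Rabs_pos xi). nra.
Qed.
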